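(* Let $(x,t)\in\mathrm{Cut}_0$, the cut locus of the origin in $\mathbb{F}_3$. Then $$d\big((0,0),(x,t)\big)^2=|x|^2+R(\theta)\,|t|,\qquad\text{where }\ \theta=P^{-1}\Big(\frac{|x|^2}{|t|}\Big)\in[\pi,\phi_1[.$$
   Context: $\mathbb{V}$ is a three-dimensional real vector space with inner product; $\wedge^2\mathbb{V}$ carries the induced inner product $\langle x\wedge y,\xi\wedge\eta\rangle=\langle x,\xi\rangle\langle y,\eta\rangle-\langle x,\eta\rangle\langle y,\xi\rangle$, with norm $|t|$. $\mathbb{F}_3=\mathbb{V}\times\wedge^2\mathbb{V}$ has the Lie group law $(x,t)\cdot(\xi,\tau)=(x+\xi,\,t+\tau+\frac12 x\wedge\xi)$. A curve $\gamma=(x,t)\in W^{1,2}((0,T),\mathbb{F}_3)$ is horizontal with control $u\in L^2((0,T),\mathbb{V})$ if $\dot x=u$ and $\dot t=\frac12 x\wedge u$ a.e.; its length is $\int_0^T|u|\,ds$; $d$ between two points is the infimum of lengths of horizontal curves joining them. Extremal curves are horizontal curves $\gamma:[0,\infty)\to\mathbb{F}_3$ from $(0,0)$ with control $u(s)=a\cos(\lambda s)+b\sin(\lambda s)+z$, where $\lambda\ge0$ and $a,b,z\in\mathbb{V}$ are pairwise orthogonal with $|a|=|b|>0$. The cut time is $t_{\mathrm{cut}}=\sup\{\bar s>0:\gamma\text{ is a length-minimizer on }[0,\bar s]\}$, and $\mathrm{Cut}_0$ is the set of points $\gamma(t_{\mathrm{cut}})$, for extremal curves $\gamma$ from the origin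 with $t_{\mathrm{cut}}<\infty$. It is known that $\mathrm{Cut}_0=\{(x,t):t\ne0,\ x\perp\operatorname{supp}t\}$, where $\operatorname{supp}(y\wedge y')=\operatorname{span}\{y,y'\}$ for $y\wedge y'\neq0$. For $\theta>0$ let $$S(\theta)=\frac{\sin\theta}{\theta},\quad U(\theta)=\frac{\theta-\sin\theta\cos\theta}{4\theta^2},\quad V(\theta)=\frac{\sin\theta-\theta\cos\theta}{2\theta^2},\quad W(\theta)=U(\theta)-S(\theta)V(\theta),$$ $$P(\theta)=-\frac{S(\theta)}{V(\theta)}\sqrt{\frac{W(\theta)}{U(\theta)}},\qquad R(\theta)=\frac{1-S(\theta)^2}{\sqrt{U(\theta)W(\theta)}}.$$ One has $U,W>0$ on $]0,\infty[$. Let $\phi_1\in\,]\pi,\frac32\pi[$ be the first positive zero of $V$. Then $P:[\pi,\phi_1[\,\to[0,+\infty[$ is an increasing bijection and $P^{-1}$ denotes the inverse of $P|_{[\pi,\phi_1[}$. *)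

(* Defs.v *)
From HB Require Import structures.
From mathcomp Require Import all_boot all_order all_algebra.
From mathcomp Require Import all_classical all_reals all_analysis.

Set Implicit Arguments.
Unset Strict Implicit.
Unset Printing Implicit Defensive.

Import Order.TTheory GRing.Theory Num.Theory.
Import numFieldNormedType.Exports.

Local Open Scope classical_set_scope.
Local Open Scope ring_scope.

Section EuclideanCurves.
Variables (R : realType) (E : vectType R) (ip : {dot E for idfun}).
Implicit Types (f u : R -> E) (T s : R).

Definition nrm (v : E) : R := Num.sqrt (ip v v).

Definition abs_continuous T f :=
  forall e : R, 0 < e -> exists2 d : R, 0 < d &
    forall (n : nat) (a b : 'I_n -> R),
      (forall i, 0 <= a i <= b i /\ b i <= T) ->
      trivIset setT (fun i => `]a i, b i[%classic) ->
      \sum_(i < n) (b i - a i) < d ->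
      \sum_(i < n) nrm (f (b i) - f (a i)) < e.

(* A [vectType] carries no topology: limits are taken in the norm of [ip]. *)
Definition has_derivative f s (v : E) :=
  (fun h : R => nrm (h^-1 *: (f (s + h) - f s) - v)) @ 0^' --> (0 : R).

(* As [E] is finite dimensional, u is measurable iff its coordinates are. *)
Definition in_L2 T u :=
  (forall e : E, measurable_fun `]0, T[%classic (fun s => ip e (u s))) /\
  (\int[lebesgue_measure]_(s in `]0%R, T[) ((nrm (u s)) ^+ 2)%:E < +oo)%E.

(* The elements of W^{1,2}((0,T),E), each one represented by its continuous
   extension to [0,T] (so that it has end points). *)
Definition in_W12 T f :=
  abs_continuous T f /\
  exists2 g : R -> E, in_L2 T g &
    {ae lebesgue_measure, forall s, 0 < s < T -> has_derivative f s (g s)}.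

Definition curve_length (u : R -> E) T : \bar R :=
  (\int[lebesgue_measure]_(s in `]0%R, T[) (nrm (u s))%:E)%E.

End EuclideanCurves.

(* (W, wedge) is the exterior square of V, which its universal property
   determines up to a unique isomorphism, and ipW is the inner product
   induced on it by ip. *)
Record is_exterior_square (R : realType) (V W : vectType R)
    (ip : {dot V for idfun}) (wedge : {bilinear V -> V -> W})
    (ipW : {dot W for idfun}) : Prop := {
  wedge_alternating : forall x, wedge x x = 0;
  wedge_factor : forall (M : lmodType R) (f : {bilinear V -> V -> M}),
    (forall x, f x x = 0) ->
    exists g : {linear W -> M}, forall x y, f x y = g (wedge x y);
  wedge_factor_uniq : forall (M : lmodType R) (g h : {linear W -> M}),
    (forall x y, g (wedge x y) = h (wedge x y)) -> g =1 h;
  wedge_inner : forall x y xi eta,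
    ipW (wedge x y) (wedge xi eta) = ip x xi * ip y eta - ip x eta * ip y xi
}.

Section FreeCarnotGroup.
Variables (R : realType) (V W : vectType R).
Variables (ip : {dot V for idfun}) (wedge : {bilinear V -> V -> W})
  (ipW : {dot W for idfun}).

Definition F3 : Type := (V * W)%type.

(* The horizontal curves below are those tangent to the distribution spanned
   by the left translates of V under this law. *)
Definition F3_mul (p q : F3) : F3 :=
  (p.1 + q.1, p.2 + q.2 + 2^-1 *: wedge p.1 q.1).

Record horizontal (T : R) (gamma : R -> F3) (u : R -> V) : Prop := {
  horizontal_x_W12 : in_W12 ip T (fun s => (gamma s).1);
  horizontal_t_W12 : in_W12 ipW T (fun s => (gamma s).2);
  horizontal_control : in_L2 ip T u;
  horizontal_dx : {ae lebesgue_measure, forall s, 0 < s < T ->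
    has_derivative ip (fun r => (gamma r).1) s (u s)};
  horizontal_dt : {ae lebesgue_measure, forall s, 0 < s < T ->
    has_derivative ipW (fun r => (gamma r).2) s
      (2^-1 *: wedge (gamma s).1 (u s))}
}.

Definition dist (p q : F3) : \bar R :=
  ereal_inf [set l | exists T gamma u, [/\ 0 < T, horizontal T gamma u,
    gamma 0 = p, gamma T = q & l = curve_length ip u T]].

Definition extremal (gamma : R -> F3) (u : R -> V) :=
  [/\ gamma 0 = (0, 0),
      (forall T : R, 0 < T -> horizontal T gamma u) &
      exists (lambda : R) (a b z : V),
      [/\ 0 <= lambda,
          [/\ ip a b = 0, ip a z = 0 & ip b z = 0],
          nrm ip a = nrm ip b, 0 < nrm ip a &
          forall s : R, 0 <= s ->
            u s = cos (lambda * s) *: a + sin (lambda * s) *: b + z]].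

Definition length_minimizer (gamma : R -> F3) (u : R -> V) (s : R) :=
  curve_length ip u s = dist (gamma 0) (gamma s).

Definition cut_time (gamma : R -> F3) (u : R -> V) : \bar R :=
  ereal_sup [set s%:E | s in
    [set s : R | 0 < s /\ length_minimizer gamma u s]].

Definition cut_locus : set F3 :=
  [set p | exists gamma u, extremal gamma u /\
    exists2 T : R, cut_time gamma u = T%:E & p = gamma T].

End FreeCarnotGroup.

Section Profile.
Variable R : realType.
Implicit Type theta : R.

Definition fS theta : R := sin theta / theta.
Definition fU theta : R := (theta - sin theta * cos theta) / (4 * theta ^+ 2).
Definition fV theta : R := (sin theta - theta * cos theta) / (2 * theta ^+ 2).
Definition fW theta : R := fU theta - fS theta * fV theta.
Definition fP theta : R :=
  - (fS theta / fV theta) * Num.sqrt (fW theta / fU theta).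
Definition fR theta : R :=
  (1 - fS theta ^+ 2) / Num.sqrt (fU theta * fW theta).

Definition phi1 : R := inf [set theta | 0 < theta /\ fV theta = 0].

Definition fPinv : R -> R := pinv `[pi, phi1[%classic fP.

End Profile.

(* Main.v *)
Require Import Defs.
From HB Require Import structures.
From mathcomp Require Import all_boot all_order all_algebra.
From mathcomp Require Import all_classical all_reals all_analysis.
From mathcomp Require Import measurable_realfun ring lra.

Set Implicit Arguments.
Unset Strict Implicit.
Unset Printing Implicit Defensive.

Import Order.TTheory GRing.Theory Num.Theory.
Import numFieldNormedType.Exports.

Local Open Scope classical_set_scope.
Local Open Scope ring_scope.

(* Let a horizontal curve of length L join (0, 0) to (X e3, t e1 /\ e2), and put
   Q = th sqrt(U/W), rho = 2 th V^2/W. Rotating the frame about e3 one may assume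
   that x2 has mean zero with respect to arc length; let f be x1 minus its mean,
   and let th in [pi, phi1[ solve - th S/V = X^2 / int f^2, with the arc length tau
   rescaled to [-1, 1]. A calibration, whose second and third components are affine
   in (f, tau) and whose first component comes from a Riccati equation for (f, int f)
   on each half of the curve, gives L^2 >= X^2 + 4 Q(th) t + rho(th) X^2. If
   X^2 = P(th0) t, the right-hand side is smallest at th = th0, where it equals
   X^2 + R(th0) t.
   An extremal with lambda > 0 is, in a suitable tilted frame, explicit: at time
   T1 = 2 th / lambda, where S U |a|^2 + V |z|^2 = 0 at th in [pi, phi1[, it reaches
   a point (X e3, t e1 /\ e2) with X^2 = P(th) t, and its length attains the lower
   bound. The half turn about e3 fixes this point, so that replacing gamma by its
   image up to T1 creates a corner, and gamma is not minimizing beyond T1. Hence T1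
   is the cut time; for lambda = 0 the cut time is infinite. *)

(** * Absolutely continuous functions *)

(** The obstacle is that th is at least pi. Once x2 and x3 are calibrated away, the form int f'^2 -
    th^2 int f^2 has to be bounded below for profiles f on [-1, 1] of mean zero, and for th > pi it
    is negative on sin(pi tau). Two devices compensate for this. The component along e2 may contain
    a multiple of tau at no boundary cost, because x2 has mean zero; the best multiple contributes
    (3/2) Q^2 (int tau f)^2, a penalty on odd profiles. And the halves are compared separately with
    a reference profile having the same integral of f on each: on a half the Riccati equation is
    solvable because sin x - x cos x > 0 for 0 < x <= th, that is, because th < phi1. A nonzero
    integral over a half then costs a nonnegative amount, and the deviation of int tau f from that
    of the reference profile enters as a square. The angle th is tied to int f^2, a quantity of the
    curve and not of its end point, because the terms with the end value of f then cancel and int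
    f^2 survives only through rho(th) X^2; the minimality of th0 finally removes the dependence on
    the curve. *)

Lemma is_derive_epsP (R : realType) (F : R -> R) (s d : R) :
  is_derive s 1 F d <-> forall e, 0 < e -> exists2 r, 0 < r &
    forall y, `|y - s| < r -> `|F y - F s - d * (y - s)| <= e * `|y - s|.
Proof.
split=> [[cF dF] e e0|H].
- have /cvgrPdist_le/(_ e e0) : h^-1 *: (F (h *: 1 + s) - F s) @[h --> 0^'] --> d.
    by rewrite -dF; exact: cF.
  case=> r /= r0 Hr; exists r => // y yr.
  have [->|ys] := eqVneq y s; first by rewrite !subrr mulr0 subr0 normr0 mulr0.
  have ys0 : y - s != 0 by rewrite subr_eq0.
  have := Hr (y - s); rewrite /= sub0r normrN => /(_ yr ys0).
  rewrite [(y - s) *: 1]mulr1 subrK distrC => H.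
  have -> : F y - F s - d * (y - s) = ((y - s)^-1 * (F y - F s) - d) * (y - s).
    by field.
  by rewrite normrM ler_wpM2r.
- have : h^-1 *: (F (h *: 1 + s) - F s) @[h --> 0^'] --> d.
    apply/cvgrPdist_le => e e0; have [r r0 Hr] := H e e0.
    exists r => //= h; rewrite /= sub0r normrN => hr h0.
    rewrite [h *: 1]mulr1.
    have := Hr (h + s); rewrite addrK => /(_ hr) {}Hr.
    have -> : d - h^-1 *: (F (h + s) - F s) = - (h^-1 * (F (h + s) - F s - d * h)).
      by rewrite /GRing.scale /=; field; rewrite ?h0.
    by rewrite normrN normrM normfV ler_pdivrMl ?normr_gt0// [leRHS]mulrC.
  move=> cv; split; first by apply/cvg_ex; exists d.
  exact: cvg_lim.
Qed.

Section AbsolutelyContinuous.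
Variable R : realType.
Implicit Types (a b : R) (F f G g H : R -> R).
Local Notation mu := (@lebesgue_measure R).

Lemma ae_imp (P Q : R -> Prop) : (forall s, P s -> Q s) ->
  {ae mu, forall s, P s} -> {ae mu, forall s, Q s}.
Proof. by move=> H; apply: filterS H; exact: (ae_filter_ringOfSetsType mu). Qed.

Lemma ae_imp2 (P Q S : R -> Prop) : (forall s, P s -> Q s -> S s) ->
  {ae mu, forall s, P s} -> {ae mu, forall s, Q s} -> {ae mu, forall s, S s}.
Proof. by move=> H; apply: filterS2 H; exact: (ae_filter_ringOfSetsType mu). Qed.

Definition AC a b F := forall e : R, 0 < e -> exists2 d : R, 0 < d &
  forall (n : nat) (p q : 'I_n -> R), (forall i, a <= p i <= q i /\ q i <= b) ->
    trivIset setT (fun i => `]p i, q i[%classic) ->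
    \sum_(i < n) (q i - p i) < d -> \sum_(i < n) `|F (q i) - F (p i)| < e.

(** Integrals are carried as increments: [F b - F a] stands for the integral of [f], and integrals
    are compared through [AD_ge0]. The density matters only almost everywhere. *)
Definition AD a b F f := AC a b F /\
  {ae mu, forall s, a < s < b -> is_derive s 1 F (f s)}.

Lemma sum_disjoint_itv_le (n : nat) (p q : 'I_n -> R) (O : set R) (d : R) :
  (forall i, p i <= q i) -> trivIset setT (fun i => `]p i, q i[%classic) ->
  measurable O -> (forall i, `]p i, q i[ `<=` O) -> (mu O < d%:E)%E ->
  \sum_(i < n) (q i - p i) < d.
Proof.
move=> pq tr mO sub muO.
rewrite -lte_fin; apply: le_lt_trans muO.
have := @measure_semi_additive_ord _ _ _ (@lebesgue_measure R) n
  (fun i => `]p i, q i[%classic) (fun i => measurable_itv _) tr.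
have mU : measurable (\big[setU/set0]_(i < n) `]p i, q i[%classic).
  by apply: bigsetU_measurable => i _; exact: measurable_itv.
move=> /(_ mU) E.
have -> : ((\sum_(i < n) (q i - p i))%:E = \sum_(i < n) mu `]p i, q i[%classic)%E.
  rewrite -sumEFin; apply: eq_bigr => i _.
  rewrite lebesgue_measure_itv /= lte_fin.
  case: ltP => [//|qp]; congr EFin; apply/eqP; rewrite subr_eq0.
  by rewrite eq_le qp pq.
rewrite -E; apply: le_measure; rewrite ?inE//.
elim/big_ind: _ => //; first by move=> A B HA HB x [/HA|/HB].
Qed.

(* The interval [a, s] is exhausted up to finitely many intervals inside O, on
   which absolute continuity controls F; elsewhere F grows at least like -e. *)
Definition slow_decrease (a e : R) (O : set R) F (s : R) :=
  exists n (p q : 'I_n -> R),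
  [/\ forall i, a <= p i <= q i /\ q i <= s,
      trivIset setT (fun i => `]p i, q i[%classic),
      forall i, `]p i, q i[ `<=` O &
      - e * (s - a) - \sum_(i < n) `|F (q i) - F (p i)| <= F s - F a].

Lemma slow_decrease_add (a e : R) (O : set R) F (s y : R) : a <= s -> s <= y ->
  0 < e -> `]s, y[ `<=` O ->
  slow_decrease a e O F s -> slow_decrease a e O F y.
Proof.
move=> as_ sy e0 sub [n [p [q [H1 H2 H3 H4]]]].
(* The given intervals are kept and ]s, y[ becomes the last one; [ext f x] appends the value x. *)
pose ext (f : 'I_n -> R) x (i : 'I_n.+1) := oapp f x (unlift ord_max i).
have extl (f : 'I_n -> R) x i : ext f x (widen_ord (leqnSn n) i) = f i.
  rewrite /ext; have -> : widen_ord (leqnSn n) i = lift ord_max i.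
    by apply/val_inj; rewrite /= /bump leqNgt ltn_ord.
  by rewrite liftK.
have extm (f : 'I_n -> R) x : ext f x ord_max = x by rewrite /ext unlift_none.
have allP (Q : 'I_n.+1 -> Prop) : (forall i, Q (widen_ord (leqnSn n) i)) ->
    Q ord_max -> forall i, Q i.
  move=> Ql Qm i; case: (unliftP ord_max i) => [j ->|->//].
  have -> : lift ord_max j = widen_ord (leqnSn n) j; last exact: Ql.
  by apply/val_inj; rewrite /= /bump leqNgt ltn_ord.
exists n.+1, (ext p s), (ext q y); split.
- apply: allP => [i|]; last by rewrite !extm as_ sy lexx.
  rewrite !extl; have [-> H] := H1 i; split => //; exact: le_trans sy.
- apply/trivIsetP; elim/allP => [i|].
  + elim/allP => [j|].
    * move=> _ _ ij; rewrite !extl; have /trivIsetP := H2; move=> /(_ i j I I); apply.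
      by apply/eqP => E; rewrite E eqxx in ij.
    * move=> _ _ _; rewrite !extl !extm; rewrite -subset0 => x /= [].
      rewrite !in_itv/= => /andP[_ xq] /andP[sx _].
      have [_ qs] := H1 i.
      by have := lt_trans (lt_le_trans xq qs) sx; rewrite ltxx.
  + elim/allP => [j|]; last by move=> _ _; rewrite eqxx.
    move=> _ _ _; rewrite !extl !extm; rewrite -subset0 => x /= [].
    rewrite !in_itv/= => /andP[sx _] /andP[_ xq].
    have [_ qs] := H1 j.
    by have := lt_trans (lt_le_trans xq qs) sx; rewrite ltxx.
- by apply: allP => [i|]; rewrite ?extl ?extm.
- rewrite big_ord_recr/= !extm.
  under eq_bigr do rewrite !extl.
  have : - `|F y - F s| <= F y - F s by rewrite lerNl -normrN ler_norm.
  have : 0 <= e * (y - s) by rewrite mulr_ge0 ?subr_ge0// ltW.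
  lra.
Qed.

Lemma slow_decrease_step (a e : R) (O : set R) F (s y : R) : s <= y ->
  - e * (y - s) <= F y - F s ->
  slow_decrease a e O F s -> slow_decrease a e O F y.
Proof.
move=> sy Fe [n [p [q [H1 H2 H3 H4]]]]; exists n, p, q; split => //.
- by move=> i; have [-> H] := H1 i; split => //; exact: le_trans sy.
- by lra.
Qed.

(** The supremum of the points where [P] holds cannot stop before b. The step leads from y to z
    across c, since both an open set around c and a derivative at c control such pairs. *)
Lemma real_induction (a b : R) (P : R -> Prop) : a <= b -> P a ->
  (forall c, a <= c <= b -> exists2 r, 0 < r & forall y z, a <= y -> z <= b ->
     c - r < y <= c -> c <= z < c + r -> P y -> P z) -> P b.
Proof.
move=> ab Pa step; pose S := [set s | a <= s <= b /\ P s].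
have Sa : S a by rewrite /S/= lexx ab.
have hs : has_sup S by split; [exists a|exists b => x [/andP[]]].
set c := sup S.
have ac : a <= c by apply: ub_le_sup => //; case: hs.
have cb : c <= b by apply: ge_sup; [case: hs|move=> x [/andP[]]].
have [r r0 Hr] : exists2 r, 0 < r & forall y z, a <= y -> z <= b ->
     c - r < y <= c -> c <= z < c + r -> P y -> P z by apply: step; rewrite ac.
have [y [/andP[ay yb] Py] cy] := sup_adherent r0 hs.
have yc : y <= c by apply: ub_le_sup; [case: hs|rewrite /S/= ay yb].
have Hz z : z <= b -> c <= z < c + r -> P z.
  by move=> zb cz; apply: (Hr y z) => //; rewrite yc andbT.
move: cb; rewrite le_eqVlt => /predU1P[<-|cb].
  by apply: Hz; rewrite ?lexx ?ltrDl// /c; apply: ge_sup; [case: hs|move=> x [/andP[]]].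
pose z := Num.min b (c + r / 2).
have zb : z <= b by rewrite /z ge_min lexx.
have cz : c < z by rewrite /z lt_min cb ltrDl divr_gt0.
have Pz : P z.
  apply: Hz => //; rewrite (ltW cz)/= /z gt_min; apply/orP; right.
  by rewrite ltrD2l ltr_pdivrMr// mulr_natr mulr2n ltrDl.
have : z <= c by apply: ub_le_sup; [case: hs|rewrite /S/= zb (le_trans ac (ltW cz))].
by rewrite leNgt cz.
Qed.

Lemma negligible_open (N : set R) (d : R) : mu.-negligible N -> 0 < d ->
  exists U, [/\ open U, N `<=` U & (mu U < d%:E)%E].
Proof.
case=> A [mA A0 NA] d0.
have [|U [oU AU muU]] := @lebesgue_regularity_outer R A d mA _ d0.
  by rewrite [X in (X < _)%E]A0 ltry.
exists U; split => //; first exact: subset_trans AU.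
have mU := open_measurable oU.
apply: le_lt_trans muU.
have -> : mu U = (mu (U `\` A) + mu (U `&` A))%E.
  exact: measureDI.
rewrite (_ : mu (U `&` A) = 0%E) ?adde0//.
apply: subset_measure0 A0 => //; exact: measurableI.
Qed.

(** The exceptional null set lies in an open set of measure less than d, where absolute continuity
    bounds the variation of F by e; near any other point F decreases at rate at most e. Real
    induction combines the two cases, for arbitrary e. *)
Lemma AD_ge0 a b F f : a <= b -> AD a b F f ->
  {ae mu, forall s, a < s < b -> 0 <= f s} -> F a <= F b.
Proof.
move=> ab [acF dF] f0; rewrite -subr_ge0.
apply/ler_addgt0Pr => e' e'0.
pose e : R := e' / (b - a + 1).
have ba0 : 0 < b - a + 1 by rewrite ltr_wpDl ?subr_ge0.
have e0 : 0 < e by rewrite divr_gt0.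
have [d d0 Hd] := acF e e0.
(* The end points are included, so that every point of [a, b] outside [N] is interior and has a
   nonnegative derivative. *)
pose N := [set s | ~ (a < s < b -> is_derive s 1 F (f s) /\ 0 <= f s)] `|` [set a; b].
have NN : mu.-negligible N.
  apply: negligibleU.
    have H : {ae mu, forall s, a < s < b -> is_derive s 1 F (f s) /\ 0 <= f s}.
      by move: dF f0; apply: ae_imp2 => s H1 H2 H; split; [exact: H1|exact: H2].
    exact: H.
  by apply: negligibleU; apply/negligibleP => //; exact: lebesgue_measure_set1.
have [U [oU NU muU]] := negligible_open NN d0.
suff [n [p [q [H1 H2 H3 H4]]]] : slow_decrease a e U F b.
  have sumd : \sum_(i < n) (q i - p i) < d.
    apply: (sum_disjoint_itv_le _ H2 _ H3 muU); last exact: open_measurable.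
    by move=> i; have [/andP[]] := H1 i.
  have {}Hd := Hd n p q H1 H2 sumd.
  have -> : e' = e * (b - a + 1) by rewrite /e divfK// gt_eqF.
  lra.
apply: (@real_induction a b) => //.
  exists 0%N, (fun=> 0), (fun=> 0); split; [by case|by apply/trivIsetP; case|by case|].
  by rewrite big_ord0 !subrr mulr0 subrr.
move=> c /andP[ac cb].
have [Uc|Uc] := pselect (U c).
  move: oU; rewrite openE => /(_ _ Uc) [r /= r0 Hr].
  exists r => // y z ay zb /andP[cy yc] /andP[cz zc].
  apply: slow_decrease_add => //; first exact: le_trans cz.
  move=> x; rewrite /= in_itv/= => /andP[yx xz]; apply: Hr.
  by rewrite /ball/= ltr_norml; apply/andP; split; lra.
have Hc : a < c < b -> is_derive c 1 F (f c) /\ 0 <= f c.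
  by apply: contrapT => H; apply: Uc; apply: NU; left.
have Hab : a < c < b.
  apply/andP; split; rewrite lt_neqAle ?ac ?cb andbT; apply/eqP => E; apply: Uc; apply: NU;
    right => /=; [left|right] => //.
have [/is_derive_epsP/(_ e e0)[r r0 Hr] fc0] := Hc Hab.
exists r => // y z ay zb /andP[cy yc] /andP[cz zc].
apply: slow_decrease_step; first exact: le_trans cz.
have /Hr : `|y - c| < r by rewrite ltr_norml; apply/andP; split; lra.
have /Hr : `|z - c| < r by rewrite ltr_norml; apply/andP; split; lra.
rewrite [`|z - c|]ger0_norm ?subr_ge0// [`|y - c|]ler0_norm ?subr_le0// => Hz Hy.
have : 0 <= f c * (z - c) by rewrite mulr_ge0// subr_ge0.
have : 0 <= f c * (c - y) by rewrite mulr_ge0// subr_ge0.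
move: Hz Hy; rewrite !ler_norml => /andP[Hz _] /andP[_ Hy].
move: Hz Hy; lra.
Qed.
End AbsolutelyContinuous.

(** * Calculus of absolutely continuous functions and their densities *)

Section ADCalculus.
Variable R : realType.
Implicit Types (a b : R) (F f G g H : R -> R).
Local Notation mu := (@lebesgue_measure R).

Lemma is_derive1_eq F (s d d' : R) : is_derive s 1 F d -> d = d' -> is_derive s 1 F d'.
Proof. by move=> + <-. Qed.

Lemma is_derive_comp1 (F G : R -> R) (s f g : R) :
  is_derive s 1 F f -> is_derive (F s) 1 G g ->
  is_derive s 1 (fun r => G (F r)) (g * f).
Proof.
by move=> dF dG; exact: is_derive1_comp dG dF.
Qed.

Lemma locally_bounded a b F : a <= b ->
  (forall c, a <= c <= b -> exists2 r, 0 < r & exists K, forall y, a <= y <= b ->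
     `|y - c| < r -> `|F y| <= K) ->
  exists2 K, 0 <= K & forall y, a <= y <= b -> `|F y| <= K.
Proof.
move=> ab H.
suff [K HK] : exists K, forall y, a <= y <= b -> `|F y| <= K.
  by exists K => //; rewrite (le_trans _ (HK a _))// lexx.
apply: (@real_induction R a b (fun c => exists K, forall y, a <= y <= c -> `|F y| <= K)) => //.
  exists `|F a| => y /andP[ay ya].
  by have -> : y = a by apply/eqP; rewrite eq_le ay ya.
move=> c acb; have [r r0 [K HK]] := H c acb.
exists r => // y z ay zb /andP[cy yc] /andP[cz zc] [K' HK'].
exists (Num.max K K') => x /andP[ax xz]; rewrite le_max.
have [xy|yx] := leP x y; first by rewrite (HK' x) ?orbT// ax.
by rewrite HK// ?ax ?(le_trans xz zb)// ltr_norml; apply/andP; split; lra.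
Qed.

Lemma AC_sub a b a' b' F : a <= a' -> b' <= b -> AC a b F -> AC a' b' F.
Proof.
move=> aa bb H e e0; have [d d0 Hd] := H e e0; exists d => // n p q H1 H2 H3.
apply: Hd => // i; have [/andP[ap ->] qb] := H1 i.
by rewrite (le_trans aa ap) (le_trans qb bb).
Qed.

Lemma AC_dist a b F e : AC a b F -> 0 < e -> exists2 d, 0 < d &
  forall x y, a <= x <= b -> a <= y <= b -> `|y - x| < d -> `|F y - F x| < e.
Proof.
move=> H e0; have [d d0 Hd] := H e e0; exists d => //.
suff W x y : a <= x <= b -> a <= y <= b -> x <= y -> `|y - x| < d -> `|F y - F x| < e.
  move=> x y hx hy; have [xy|/ltW yx] := leP x y; first exact: W.
  by rewrite distrC [`|F y - _|]distrC; exact: W.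
move=> /andP[ax xb] /andP[ay yb] xy; rewrite ger0_norm ?subr_ge0// => yxd.
have := Hd 1%N (fun=> x) (fun=> y); rewrite !big_ord_recl !big_ord0 !addr0; apply => //.
  by move=> i; rewrite ax xy yb.
by apply/trivIsetP => i j _ _; rewrite !ord1 eqxx.
Qed.

Lemma AC_bounded a b F : a <= b -> AC a b F ->
  exists2 K, 0 <= K & forall y, a <= y <= b -> `|F y| <= K.
Proof.
move=> ab aF; apply: locally_bounded => // c acb.
have [d d0 Hd] := AC_dist aF ltr01; exists d => //.
exists (`|F c| + 1) => y ayb yc; have := Hd c y acb ayb yc.
by have := ler_normD (F y - F c) (F c); rewrite subrK; lra.
Qed.

Lemma AC_dom a b F G H C : 0 <= C -> AC a b F -> AC a b G ->
  (forall x y, a <= x -> x <= y -> y <= b ->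
    `|H y - H x| <= C * (`|F y - F x| + `|G y - G x|)) ->
  AC a b H.
Proof.
move=> C0 aF aG D e e0.
have e'0 : 0 < e / (2 * (C + 1)) by rewrite divr_gt0// mulr_gt0// ltr_wpDl.
have [d1 d10 H1] := aF _ e'0; have [d2 d20 H2] := aG _ e'0.
exists (Num.min d1 d2); first by rewrite lt_min d10.
move=> n p q hpq tr; rewrite lt_min => /andP[s1 s2].
have := H1 n p q hpq tr s1; have := H2 n p q hpq tr s2.
set SF := \sum_(i < n) `|F (q i) - F (p i)|; set SG := \sum_(i < n) `|G (q i) - G (p i)|.
move=> HG HF.
have SF0 : 0 <= SF by apply: sumr_ge0.
have SG0 : 0 <= SG by apply: sumr_ge0.
apply: (@le_lt_trans _ _ (C * (SF + SG))).
  rewrite -big_split/= mulr_sumr; apply: ler_sum => i _.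
  by have [/andP[? ?] ?] := hpq i; exact: D.
have : (C + 1) * (SF + SG) < e.
  have -> : e = (C + 1) * (e / (2 * (C + 1)) + e / (2 * (C + 1))).
    by field; rewrite gt_eqF// ltr_wpDl.
  by rewrite ltr_pM2l; [exact: ltrD|rewrite ltr_wpDl].
nra.
Qed.

Lemma AC_lip a b H C : 0 <= C ->
  (forall x y, a <= x -> x <= y -> y <= b -> `|H y - H x| <= C * (y - x)) -> AC a b H.
Proof.
move=> C0 D e e0.
have e'0 : 0 < e / (C + 1) by rewrite divr_gt0// ltr_wpDl.
exists (e / (C + 1)) => // n p q hpq tr; rewrite ltr_pdivlMr ?ltr_wpDl// => Hs.
apply: (@le_lt_trans _ _ (C * \sum_(i < n) (q i - p i))).
  rewrite mulr_sumr; apply: ler_sum => i _.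
  by have [/andP[? ?] ?] := hpq i; exact: D.
have : 0 <= \sum_(i < n) (q i - p i).
  by apply: sumr_ge0 => i _; have [/andP[_ ?] _] := hpq i; rewrite subr_ge0.
nra.
Qed.

Lemma AD_sub a b a' b' F f : a <= a' -> b' <= b -> AD a b F f -> AD a' b' F f.
Proof.
move=> aa bb [H1 H2]; split; first exact: AC_sub H1.
by apply: ae_imp H2 => s H2 /andP[as_ sb]; apply: H2; rewrite (le_lt_trans aa as_) (lt_le_trans
  sb bb).
Qed.

Lemma AD_ext a b F f g : (forall s, a < s < b -> f s = g s) -> AD a b F f -> AD a b F g.
Proof. by move=> E [H1 H2]; split => //; apply: ae_imp H2 => s H2 /[dup] /E <-. Qed.

Lemma AD_cst a b (c : R) : AD a b (fun=> c) (fun=> 0).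
Proof.
split; last by apply/aeW => s _; exact: is_derive_cst.
by apply: (@AC_lip a b _ 0) => // x y _ xy _; rewrite subrr normr0 mul0r.
Qed.

Lemma AD_id a b : AD a b (fun s => s) (fun=> 1).
Proof.
split; last by apply/aeW => s _; exact: is_derive_id.
by apply: (@AC_lip a b _ 1) => // x y _ xy _; rewrite mul1r ger0_norm// subr_ge0.
Qed.

Lemma AD_add a b F f G g : AD a b F f -> AD a b G g ->
  AD a b (fun s => F s + G s) (fun s => f s + g s).
Proof.
move=> [aF dF] [aG dG]; split.
  apply: (@AC_dom a b F G _ 1) => // x y _ _ _; rewrite mul1r.
  by rewrite opprD addrACA ler_normD.
by apply: ae_imp2 dF dG => s dF dG H; exact: is_deriveD (dF H) (dG H).
Qed.

Lemma AD_mul a b F f G g : a <= b -> AD a b F f -> AD a b G g ->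
  AD a b (fun s => F s * G s) (fun s => f s * G s + F s * g s).
Proof.
move=> ab [aF dF] [aG dG]; split.
  have [KF KF0 HF] := AC_bounded ab aF; have [KG KG0 HG] := AC_bounded ab aG.
  apply: (@AC_dom a b F G _ (KF + KG)) => //; first exact: addr_ge0.
  move=> x y ax xy yb.
  have -> : F y * G y - F x * G x = F y * (G y - G x) + (F y - F x) * G x by ring.
  have hy : `|F y| <= KF by apply: HF; rewrite yb (le_trans ax xy).
  have hx : `|G x| <= KG by apply: HG; rewrite ax (le_trans xy yb).
  apply: le_trans (ler_normD _ _) _; rewrite !normrM.
  have := ler_wpM2r (normr_ge0 (G y - G x)) hy.
  have := ler_wpM2l (normr_ge0 (F y - F x)) hx.
  have := mulr_ge0 KF0 (normr_ge0 (F y - F x)).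
  have := mulr_ge0 KG0 (normr_ge0 (G y - G x)).
  lra.
apply: ae_imp2 dF dG => s dF dG H.
apply: (is_derive1_eq (is_deriveM (dF H) (dG H))).
by rewrite /GRing.scale /=; ring.
Qed.

Lemma AD_opp a b F f : AD a b F f -> AD a b (fun s => - F s) (fun s => - f s).
Proof.
move=> [aF dF]; split.
  apply: (@AC_dom a b F F _ 1) => // x y _ _ _; rewrite mul1r.
  have -> : - F y - - F x = - (F y - F x) by ring.
  by rewrite normrN lerDl.
by apply: ae_imp dF => s dF H; exact: is_deriveN (dF H).
Qed.

Lemma AD_sc a b F f (c : R) : AD a b F f -> AD a b (fun s => c * F s) (fun s => c * f s).
Proof.
move=> [aF dF]; split.
  apply: (@AC_dom a b F F _ `|c|) => // x y _ _ _; rewrite -mulrBr normrM.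
  by rewrite ler_wpM2l// lerDl.
by apply: ae_imp dF => s dF H; exact: is_deriveZ (dF H).
Qed.

Lemma AD_le a b F f G g : a <= b -> AD a b F f -> AD a b G g ->
  {ae mu, forall s, a < s < b -> f s <= g s} -> F b - F a <= G b - G a.
Proof.
move=> ab dF dG fg.
have := AD_ge0 ab (AD_add dG (AD_opp dF)).
have H : {ae mu, forall s, a < s < b -> 0 <= g s + - f s}.
  by apply: ae_imp fg => s H /H; rewrite subr_ge0.
by move=> /(_ H); lra.
Qed.

Lemma AD_eq a b F f G g : a <= b -> AD a b F f -> AD a b G g ->
  {ae mu, forall s, a < s < b -> f s = g s} -> F b - F a = G b - G a.
Proof.
move=> ab dF dG fg; apply/eqP; rewrite eq_le; apply/andP; split.
  by apply: AD_le dF dG _ => //; apply: ae_imp fg => s H /H ->.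
by apply: AD_le dG dF _ => //; apply: ae_imp fg => s H /H ->.
Qed.

Lemma derive_bounded_lip (m M K : R) (G g : R -> R) :
  (forall y, m <= y <= M -> is_derive y 1 G (g y)) ->
  (forall y, m <= y <= M -> `|g y| <= K) ->
  forall x y, m <= x <= M -> m <= y <= M -> `|G y - G x| <= K * `|y - x|.
Proof.
move=> dG gK.
suff W x y : m <= x -> x <= y -> y <= M -> `|G y - G x| <= K * `|y - x|.
  move=> x y /andP[mx xM] /andP[my yM].
  have [xy|/ltW yx] := leP x y; first exact: W.
  by rewrite distrC [`|y - x|]distrC; exact: W.
move=> mx xy yM.
have [||c cxy ->] := @MVT_segment _ G g x y xy.
- move=> z; rewrite in_itv/= => /andP[xz zy]; apply: dG.
  by rewrite (le_trans mx (ltW xz)) (le_trans (ltW zy) yM).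
- apply: continuous_in_subspaceT => z; rewrite inE/= in_itv/= => /andP[xz zy].
  have [+ _] : is_derive z 1 G (g z) by apply: dG; rewrite (le_trans mx xz) (le_trans zy yM).
  by move=> /derivable1_diffP/differentiable_continuous.
rewrite normrM ler_wpM2r// gK//; move: cxy; rewrite in_itv/= => /andP[xc cy].
by rewrite (le_trans mx xc) (le_trans cy yM).
Qed.

Lemma is_derive_bounded (m M : R) (G g : R -> R) : m <= M ->
  (forall y, m <= y <= M -> is_derive y 1 G (g y)) ->
  exists2 K, 0 <= K & forall y, m <= y <= M -> `|G y| <= K.
Proof.
move=> mM dG; apply: locally_bounded => // c /dG /is_derive_epsP /(_ _ ltr01) [r r0 Hr].
exists r => //; exists (`|G c| + (`|g c| + 1) * r) => y _ yc.
have := Hr y yc; rewrite mul1r => H.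
have -> : G y = G c + (G y - G c - g c * (y - c)) + g c * (y - c) by ring.
apply: le_trans (ler_normD _ _) _; rewrite normrM.
have := ler_normD (G c) (G y - G c - g c * (y - c)).
have := normr_ge0 (g c); have := normr_ge0 (y - c).
nra.
Qed.

(** [G] is Lipschitz on [m, M] because its derivative [g], being differentiable with derivative
    [g'], is bounded there. *)
Lemma AD_comp a b (m M : R) F f (G g g' : R -> R) : a <= b -> AD a b F f ->
  (forall s, a <= s <= b -> m <= F s <= M) ->
  (forall y, m <= y <= M -> is_derive y 1 G (g y)) ->
  (forall y, m <= y <= M -> is_derive y 1 g (g' y)) ->
  AD a b (fun s => G (F s)) (fun s => g (F s) * f s).
Proof.
move=> ab [aF dF] FmM dG dg.
have /andP[h1 h2] : m <= F a <= M by apply: FmM; rewrite lexx.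
have mM : m <= M := le_trans h1 h2.
have [K K0 HK] := is_derive_bounded mM dg.
split.
  apply: (@AC_dom a b F F _ K) => // x y ax xy yb.
  apply: (@le_trans _ _ (K * `|F y - F x|)); last by rewrite ler_wpM2l// lerDl.
  by apply: (derive_bounded_lip dG HK); apply: FmM; rewrite ?ax ?yb ?(le_trans xy yb)
    ?(le_trans ax xy).
apply: ae_imp dF => s dF /[dup] sab /dF {}dF.
apply: (is_derive_comp1 dF); apply: dG; apply: FmM.
by case/andP: sab => /ltW -> /ltW ->.
Qed.

Lemma AD_smooth a b (G g g' : R -> R) : a <= b ->
  (forall y, a <= y <= b -> is_derive y 1 G (g y)) ->
  (forall y, a <= y <= b -> is_derive y 1 g (g' y)) -> AD a b G g.
Proof.
move=> ab dG dg; have := @AD_comp a b a b _ _ G g g' ab (AD_id a b) (fun s => id) dG dg.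
by apply: AD_ext => s _; rewrite mulr1.
Qed.

End ADCalculus.

Ltac AD_rules := repeat first
  [ eassumption | notypeclasses refine (AD_cst _ _ _) | notypeclasses refine (AD_id _ _)
  | notypeclasses refine (AD_add _ _) | notypeclasses refine (AD_opp _)
  | notypeclasses refine (AD_sc _ _) | notypeclasses refine (AD_mul _ _ _) ].
(** The rules build some density; what remains is its pointwise equality with the density of the
    goal. *)
Ltac AD_by := notypeclasses refine (AD_ext _ _); cycle 1; [AD_rules|rewrite /=].

(** * Primitives of square integrable functions *)

Section Primitive.
Variable R : realType.
Local Notation mu := (@lebesgue_measure R).

(** Absolute continuity follows from |h| <= eta h^2 + 1 / (4 eta): the integral of |h| over a set is
    at most eta times that of h^2, plus a multiple of the measure of the set. *)
Lemma AD_prim (a b : R) (g : R -> R) : a < b ->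
  measurable_fun `]a, b[%classic g ->
  (\int[mu]_(s in `]a, b[) ((g s) ^+ 2)%:E < +oo)%E ->
  exists G, [/\ G a = 0, AD a b G g &
    (\int[mu]_(s in `]a, b[) (g s)%:E = (G b)%:E)%E].
Proof.
move=> ab mg g2.
have mI : measurable (`]a, b[%classic : set R) by exact: measurable_itv.
have ig2 : mu.-integrable `]a, b[ (EFin \o (fun s => g s ^+ 2)).
  apply/integrableP; split.
    by apply/measurable_EFinP; exact: measurable_funX.
  apply: le_lt_trans g2; rewrite le_eqVlt; apply/orP; left; apply/eqP.
  by apply: eq_integral => s _ /=; rewrite ger0_norm// sqr_ge0.
have ifin (c : R) : mu.-integrable `]a, b[ (EFin \o (fun=> c)).
  apply/integrableP; split; first by apply/measurable_EFinP; exact: measurable_cst.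
  rewrite integral_cst//= lebesgue_measure_itv/= lte_fin ab -EFinB -EFinM; exact: ltry.
have ig : mu.-integrable `]a, b[ (EFin \o g).
  apply: (@le_integrable _ _ _ mu _ _ _ (EFin \o (fun s => g s ^+ 2 + 1))) => //.
  - exact/measurable_EFinP.
  - move=> s _ /=; rewrite lee_fin [leRHS]ger0_norm ?addr_ge0 ?sqr_ge0//.
    by rewrite -[g s ^+ 2]real_normK ?num_real//; nra.
  - have := @integrableD _ _ _ mu _ mI _ _ ig2 (ifin 1).
    by apply: eq_integrable.
(* The extension by 0 allows integrals from -oo, for which the fundamental theorem of calculus is
   applied. *)
pose h := g \_ `]a, b[.
have ih : mu.-integrable setT (EFin \o h).
  by rewrite /h -restrict_EFin; apply/(@integrable_mkcond _ _ _ mu _ _ mI).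
have mh : measurable_fun setT h by apply/(measurable_restrictT _ mI).
pose h2 := (fun s => g s ^+ 2) \_ `]a, b[.
have h2E : h2 = (fun s => h s ^+ 2).
  by apply/funext => s; rewrite /h2 /h !patchE; case: ifP => //; rewrite expr0n.
have mh2 : measurable_fun setT h2 by rewrite h2E; exact: measurable_funX.
pose M := fine (\int[mu]_s (h2 s)%:E).
have h20 s : 0 <= h2 s by rewrite h2E sqr_ge0.
have ME : (\int[mu]_s (h2 s)%:E = M%:E)%E.
  rewrite fineK// ge0_fin_numE; last by apply: integral_ge0 => s _; rewrite lee_fin.
  have -> : (\int[mu]_s (h2 s)%:E = \int[mu]_(s in `]a, b[) ((g s) ^+ 2)%:E)%E.
    by rewrite [RHS]integral_mkcond restrict_EFin.
  exact: g2.
have M0 : 0 <= M by rewrite -lee_fin -ME; apply: integral_ge0 => s _; rewrite lee_fin.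
pose G x := \int[mu]_(t in `]-oo, x]) h t.
have ihS (A : set R) : measurable A -> mu.-integrable A (EFin \o h).
  by move=> mA; exact: integrableS ih.
exists G; split.
- rewrite /G; rewrite (@eq_Rintegral _ _ _ mu _ (fun=> 0));
  first by rewrite Rintegral_cst// mul0r.
  by move=> x; rewrite inE/= in_itv/= => xa; rewrite /h patchE memNset//= in_itv/= ltNge xa.
- split; last first.
    have lh : locally_integrable setT h by apply: open_integrable_locally => //; exact: openT.
    have := FTC1Ny (fun y => ihS _ (measurable_itv _)) lh.
    apply: ae_imp => s [ds vs] sab; split; first exact: ds.
    by rewrite -derive1E vs /h patchE mem_set//= in_itv.
  move=> e e0.
  pose eta : R := e / (2 * (M + 1)).
  have M1 : 0 < M + 1 by rewrite ltr_wpDl.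
  have eta0 : 0 < eta by rewrite divr_gt0// mulr_gt0.
  pose c : R := (4 * eta)^-1.
  have c0 : 0 < c by rewrite invr_gt0 mulr_gt0.
  exists (e / (2 * c)); first by rewrite divr_gt0// mulr_gt0.
  move=> n p q hpq tr hd.
  pose J i : set R := `]p i, q i[%classic.
  have mII i : measurable (J i) by exact: measurable_itv.
  pose U := \big[setU/set0]_(i <- index_enum 'I_n) J i.
  have mU : measurable U by apply: bigsetU_measurable => i _.
  have muU : mu U = (\sum_(i < n) (q i - p i))%:E.
    rewrite /U (@measure_semi_additive_ord _ _ _ mu n J mII tr mU) -sumEFin.
    apply: eq_bigr => i _; rewrite -[LHS]/(lebesgue_measure (`]p i,
      q i[%classic : set R)) lebesgue_measure_itv /= lte_fin.
    have [/andP[_ pq] _] := hpq i.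
    case: ltP => [//|qp]; congr EFin; apply/esym/eqP; rewrite subr_eq0.
    by rewrite eq_le qp pq.
  have H1 i : (`|G (q i) - G (p i)|%:E <= \int[mu]_(s in J i) `|h s|%:E)%E.
    have [/andP[_ pq] _] := hpq i.
    have -> : G (q i) - G (p i) = \int[mu]_(t in `](p i), (q i)]) h t.
      by rewrite /G Rintegral_itvB//; exact: ihS.
    apply: le_trans (_ : (\int[mu]_(t in `](p i), (q i)]) `|h t|)%:E <= _)%E.
      by rewrite lee_fin le_normr_Rintegral//; exact: ihS.
    rewrite /Rintegral fineK; last first.
      apply: integrable_fin_num => //; exact: integrable_abse (ihS _ _).
    rewrite integral_itv_bndoo// /J; apply/measurable_EFinP.
    by apply: measurableT_comp => //; exact: measurable_funS mh.
  rewrite -lte_fin -sumEFin.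
  apply: (@le_lt_trans _ _ (\int[mu]_(s in U) `|h s|%:E)%E).
    rewrite /U ge0_integral_bigsetU//.
    - exact: lee_sum.
    - exact: index_enum_uniq.
    - by apply/trivIsetP => i j _ _ ij; move/trivIsetP : tr => /(_ i j I I); apply.
    - by apply/measurable_EFinP; apply: measurableT_comp => //; exact: measurable_funS mh.
  apply: (@le_lt_trans _ _ (\int[mu]_(s in U) (eta * h2 s + c)%:E)%E).
    apply: ge0_le_integral => //.
    - by apply/measurable_EFinP; apply: measurableT_comp => //; exact: measurable_funS mh.
    - apply/measurable_EFinP; apply: measurable_funD => //; apply: measurable_funM => //.
      exact: measurable_funS mh2.
    - move=> s _; rewrite lee_fin h2E -[h s ^+ 2]real_normK ?num_real//.
      have := sqr_ge0 (2 * eta * `|h s| - 1).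
      have E : eta * c * 4 = 1 by rewrite /c; field; rewrite gt_eqF.
      rewrite -subr_ge0; have -> : eta * `|h s| ^+ 2 + c - `|h s| = c * (2 * eta * `|h s| - 1)
        ^+ 2 + (1 - eta * c * 4) * (`|h s| ^+ 2 * eta - `|h s|) by ring.
      by rewrite E subrr mul0r addr0 => H; rewrite mulr_ge0// ltW.
  apply: (@le_lt_trans _ _ (eta * M + c * \sum_(i < n) (q i - p i))%:E).
    under eq_integral do rewrite EFinD.
    rewrite ge0_integralD//=; last 3 first.
    - by move=> s _; rewrite lee_fin mulr_ge0// ltW.
    - apply/measurable_EFinP; apply: measurable_funM => //.
      exact: measurable_funS mh2.
    - by move=> s _; rewrite lee_fin ltW.
    rewrite integral_cst// EFinD; apply: leeD.
      under eq_integral do rewrite EFinM.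
      rewrite ge0_integralZl//; last 3 first.
      - by apply/measurable_EFinP; exact: measurable_funS mh2.
      - by move=> s _; rewrite lee_fin.
      - by rewrite lee_fin ltW.
      rewrite [leRHS]EFinM lee_pmul2l ?lte_fin// -ME.
      apply: ge0_subset_integral => //; last by move=> s _; rewrite lee_fin.
      exact/measurable_EFinP.
    by rewrite EFinM -muU.
  rewrite lte_fin.
  have : eta * M = e / 2 - eta by rewrite /eta; field; rewrite gt_eqF.
  have : c * \sum_(i < n) (q i - p i) < c * (e / (2 * c)) by rewrite ltr_pM2l.
  have -> : c * (e / (2 * c)) = e / 2 by field; rewrite gt_eqF.
  lra.
- rewrite /G.
  have -> : (\int[mu]_(s in `]a, b[) (g s)%:E = \int[mu]_s (h s)%:E)%E.
    by rewrite integral_mkcond restrict_EFin.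
  rewrite -[LHS]fineK; last by apply: integrable_fin_num.
  congr EFin; rewrite -/(Rintegral mu setT h) [RHS]Rintegral_mkcond.
  congr Rintegral; apply/funext => s; rewrite patchE; case: ifPn => //.
  rewrite notin_setE/= in_itv/= => /negP; rewrite -ltNge => bs.
  by rewrite /h patchE memNset//= in_itv/= [s < b]ltNge (ltW bs) andbF.
Qed.

End Primitive.

(** * The functions S, U, V, W, P, R *)

Section RealDerivatives.
Variable R : realType.
Implicit Types (F G : R -> R) (s f g c a b : R).

Lemma is_derive1D F G s f g : is_derive s 1 F f -> is_derive s 1 G g ->
  is_derive s 1 (fun x => F x + G x) (f + g).
Proof. by move=> dF dG; exact: is_deriveD dF dG. Qed.

Lemma is_derive1N F s f : is_derive s 1 F f -> is_derive s 1 (fun x => - F x) (- f).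
Proof. by move=> dF; exact: is_deriveN dF. Qed.

Lemma is_derive1M F G s f g : is_derive s 1 F f -> is_derive s 1 G g ->
  is_derive s 1 (fun x => F x * G x) (f * G s + F s * g).
Proof.
move=> dF dG; apply: (is_derive1_eq (is_deriveM dF dG)).
by rewrite /GRing.scale /=; ring.
Qed.

Lemma is_derive1X F s f n : is_derive s 1 F f ->
  is_derive s 1 (fun x => F x ^+ n.+1) (n.+1%:R * F s ^+ n * f).
Proof.
move=> dF; elim: n => [|n IH].
  by rewrite expr0 mulr1 mul1r (_ : (fun x => _) = F)//; apply/funext => x; rewrite expr1.
rewrite (_ : (fun x => _) = fun x => F x * F x ^+ n.+1); last first.
  by apply/funext => x; rewrite exprS.
by apply: (is_derive1_eq (is_derive1M dF IH)); rewrite -[in RHS]natr1 exprS; ring.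
Qed.

Lemma is_derive1V F s f : F s != 0 -> is_derive s 1 F f ->
  is_derive s 1 (fun x => (F x)^-1) (- f / F s ^+ 2).
Proof.
move=> Fs dF; have [dF1 dF2] := dF.
split; first exact: derivableV.
by rewrite deriveV// dF2 /GRing.scale /=; field.
Qed.

Lemma is_derive1_cos F s f : is_derive s 1 F f ->
  is_derive s 1 (fun x => cos (F x)) (- sin (F s) * f).
Proof. by move=> dF; exact: (is_derive_comp1 dF). Qed.

Lemma is_derive1_sin F s f : is_derive s 1 F f ->
  is_derive s 1 (fun x => sin (F x)) (cos (F s) * f).
Proof. by move=> dF; exact: (is_derive_comp1 dF). Qed.

Lemma is_derive1_sqrt_comp F s f : 0 < F s -> is_derive s 1 F f ->
  is_derive s 1 (fun x => Num.sqrt (F x)) ((2 * Num.sqrt (F s))^-1 * f).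
Proof. by move=> F0 dF; exact: (is_derive_comp1 dF (is_derive1_sqrt F0)). Qed.

Lemma is_derive1_id s : is_derive s 1 (fun x : R => x) 1.
Proof. exact: is_derive_id. Qed.

Lemma is_derive1_cst c s : is_derive s 1 (fun=> c) 0.
Proof. exact: is_derive_cst. Qed.

Lemma is_derive_within a b (G g : R -> R) :
  (forall y, a <= y <= b -> is_derive y 1 G (g y)) -> {within `[a, b], continuous G}.
Proof.
move=> dG; apply: continuous_in_subspaceT => z; rewrite inE/= in_itv/= => zab.
by have [/derivable1_diffP/differentiable_continuous] := dG z zab.
Qed.

Lemma is_derive_ge0_le a b (G g : R -> R) : a <= b ->
  (forall y, a <= y <= b -> is_derive y 1 G (g y)) ->
  (forall y, a <= y <= b -> 0 <= g y) -> G a <= G b.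
Proof.
move=> ab dG g0.
have [||c] := @MVT_segment _ G g a b ab.
- by move=> z; rewrite in_itv/= => /andP[/ltW az /ltW zb]; apply: dG; rewrite az.
- exact: is_derive_within dG.
rewrite in_itv/= => cab E; rewrite -subr_ge0 E mulr_ge0 ?subr_ge0//; exact: g0.
Qed.

Lemma is_derive_gt0_lt a b (G g : R -> R) : a < b ->
  (forall y, a <= y <= b -> is_derive y 1 G (g y)) ->
  (forall y, a < y < b -> 0 < g y) -> G a < G b.
Proof.
move=> ab dG g0.
have [||c] := @MVT _ G g a b ab.
- by move=> z; rewrite in_itv/= => /andP[/ltW az /ltW zb]; apply: dG; rewrite az.
- exact: is_derive_within dG.
rewrite in_itv/= => cab E; rewrite -subr_gt0 E mulr_gt0 ?subr_gt0//; exact: g0.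
Qed.

Lemma is_derive_IVT a b (G g : R -> R) : a <= b ->
  (forall y, a <= y <= b -> is_derive y 1 G (g y)) ->
  (G a) * (G b) <= 0 -> exists2 c, a <= c <= b & G c = 0.
Proof.
move=> ab dG Gab.
have [|c] := @IVT _ G a b 0 ab (is_derive_within dG).
  rewrite ge_min le_max.
  have [a0|a0] := leP (G a) 0; have [b0|b0] := leP (G b) 0; rewrite ?andbT //=.
  - have [->|aN] := eqVneq (G a) 0; first by rewrite lexx.
    have [->|bN] := eqVneq (G b) 0; first by rewrite lexx orbT.
    have Ha : G a < 0 by rewrite lt_neqAle aN.
    have Hb : G b < 0 by rewrite lt_neqAle bN.
    by have := mulr_gt0 (y := - G b) (x := - G a); rewrite mulrNN !oppr_gt0 => /(_ Ha Hb);
      rewrite ltNge Gab.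
  - by rewrite (ltW b0) orbT.
  - by rewrite (ltW a0).
  - by have := mulr_gt0 a0 b0; rewrite ltNge Gab.
by rewrite in_itv/=; exists c.
Qed.

End RealDerivatives.

(* notypeclasses: the library declares [is_derive] a type class, whose instances
   would pick another form of the derivative. *)
Ltac derive_rules := repeat first
  [ eassumption
  | notypeclasses refine (is_derive1_cst _ _) | notypeclasses refine (is_derive1_id _)
  | notypeclasses refine (is_derive1D _ _) | notypeclasses refine (is_derive1N _)
  | notypeclasses refine (is_derive1M _ _) | notypeclasses refine (is_derive1X _ _)
  | notypeclasses refine (is_derive1V _ _)
  | notypeclasses refine (is_derive1_cos _) | notypeclasses refine (is_derive1_sin _) ].
Ltac derive_by := notypeclasses refine (is_derive1_eq _ _); [derive_rules|rewrite /=].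

Section ProfileCalculus.
Variable R : realType.
Implicit Types (th x y : R).
Local Notation S := (@fS R).
Local Notation U := (@fU R).
Local Notation V := (@fV R).
Local Notation W := (@fW R).
Local Notation P := (@fP R).

Lemma cos2E th : cos th ^+ 2 = 1 - sin th ^+ 2.
Proof. by have := cos2Dsin2 th => <-; rewrite addrK. Qed.

Lemma is_derive_fS th : th != 0 -> is_derive th 1 S (- 2 * V th).
Proof. by move=> h; rewrite /fS; derive_by => //; rewrite /fV; field. Qed.

Lemma is_derive_fV th : th != 0 -> is_derive th 1 V (S th / 2 - 2 * V th / th).
Proof.
move=> h; have h2 : 2 * th ^+ 2 != 0 by rewrite mulf_neq0// expf_neq0.
by rewrite /fV; derive_by; rewrite /fS; field.
Qed.

Lemma is_derive_fU th : th != 0 -> is_derive th 1 U (S th ^+ 2 / 2 - 2 * U th / th).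
Proof.
move=> h; have h2 : 4 * th ^+ 2 != 0 by rewrite mulf_neq0// expf_neq0.
by rewrite /fU; derive_by; rewrite /fS; field: (cos2E th).
Qed.

Lemma is_derive_fW th : th != 0 -> is_derive th 1 W (2 * V th ^+ 2 - 2 * W th / th).
Proof.
move=> h; have dS := is_derive_fS h; have dU := is_derive_fU h; have dV := is_derive_fV h.
by rewrite /fW; derive_by; field.
Qed.

(** This is cos^2 + sin^2 = 1 in terms of S, U and V; it is what makes 4 Q' equal to - P rho' in
    [is_derive_fQ]. *)
Lemma profile_identity th : th != 0 ->
  2 * U th / th + S th * V th / th - S th ^+ 2 / 2 - 2 * V th ^+ 2 = 0.
Proof.
move=> h; have -> : 2 * U th / th + S th * V th / th - S th ^+ 2 / 2 - 2 * V th ^+ 2 =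
    (1 - sin th ^+ 2 - cos th ^+ 2) / (2 * th ^+ 2).
  by rewrite /fS /fU /fV; field.
by rewrite cos2E subrr mul0r.
Qed.

Lemma profile_UW th : th != 0 -> 2 * th * (U th + W th) = 1 - S th ^+ 2.
Proof. by move=> h; rewrite /fW /fS /fU /fV; field. Qed.

Lemma is_derive_num th : is_derive th 1 (fun x => sin x - x * cos x) (th * sin th).
Proof. by derive_by; ring. Qed.

Lemma pi32_lt : pi < 3 / 2 * pi :> R. Proof. by have := pi_gt0 R; lra. Qed.

Lemma sin32_lt0 th : pi < th <= 3 / 2 * pi -> sin th < 0.
Proof.
move=> /andP[h1 h2]; rewrite -[th](subrK pi) sinDpi oppr_lt0.
by apply: sin_gt0_pi; have := pi_gt0 R; lra.
Qed.

Lemma cos32_lt0 th : pi <= th < 3 / 2 * pi -> cos th < 0.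
Proof.
move=> /andP[h1 h2]; rewrite -[th](subrK pi) cosDpi oppr_lt0.
by apply: cos_gt0_pihalf; have := pi_gt0 R; lra.
Qed.

Lemma num_gt0 th : 0 < th <= pi -> 0 < sin th - th * cos th.
Proof.
move=> /andP[t0 tpi].
have := @is_derive_gt0_lt R 0 th (fun x => sin x - x * cos x) (fun x => x * sin x) t0.
rewrite sin0 mul0r subr0; apply; first by move=> y _; exact: is_derive_num.
move=> y /andP[y0 yt]; rewrite mulr_gt0// sin_gt0_pi// y0/=; exact: lt_le_trans tpi.
Qed.

Lemma num_decr x y : pi <= x -> x < y -> y <= 3 / 2 * pi ->
  sin y - y * cos y < sin x - x * cos x.
Proof.
move=> px xy y32.
have := @is_derive_gt0_lt R x y (fun x => - (sin x - x * cos x)) (fun x => - (x * sin x)) xy.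
rewrite ltrN2; apply; first by move=> z _; apply: is_derive1N; exact: is_derive_num.
move=> z /andP[xz zy]; rewrite -mulrN mulr_gt0 ?oppr_gt0//.
  by have := pi_gt0 R; lra.
by apply: sin32_lt0; rewrite (le_lt_trans px xz) (le_trans (ltW zy) y32).
Qed.

(** The numerator sin x - x cos x of V has derivative x sin x: it increases from 0 on [0, pi], then
    strictly decreases to -1 at 3 pi / 2. Its zero in between is the infimum that defines [phi1]. *)
Lemma phi1P : [/\ pi < phi1 R, phi1 R < 3 / 2 * pi,
  sin (phi1 R) - phi1 R * cos (phi1 R) = 0 &
  forall th, 0 < th < phi1 R -> 0 < sin th - th * cos th].
Proof.
have p0 := pi_gt0 R.
have E32 : sin (3 / 2 * pi) - 3 / 2 * pi * cos (3 / 2 * pi) = -1 :> R.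
  have -> : 3 / 2 * pi = pi / 2 + pi :> R by field.
  by rewrite sinDpi cosDpi sin_pihalf cos_pihalf; ring.
have [||z /andP[z1 z2] zE] := @is_derive_IVT R pi (3 / 2 * pi) (fun x => sin x - x * cos x)
    (fun x => x * sin x) (ltW pi32_lt).
- by move=> y _; exact: is_derive_num.
- by rewrite E32 mulrN1 oppr_le0 ltW// num_gt0// p0/=.
have zpi : pi < z.
  rewrite lt_neqAle z1 andbT; apply/eqP => E.
  by have := @num_gt0 z; rewrite zE ltxx -E p0 lexx => /(_ isT).
have z32 : z < 3 / 2 * pi.
  rewrite lt_neqAle z2 andbT; apply/eqP => E.
  by move: zE; rewrite E E32 => /eqP; rewrite oppr_eq0 oner_eq0.
have pos th : 0 < th < z -> 0 < sin th - th * cos th.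
  move=> /andP[t0 tz]; have [tp|pt] := leP th pi; first by apply: num_gt0; rewrite t0.
  by rewrite -zE; apply: num_decr => //; exact: ltW.
suff -> : phi1 R = z by split.
have z0 : 0 < z := lt_trans p0 zpi.
have Vz th : 0 < th -> (V th = 0) <-> sin th - th * cos th = 0.
  move=> t0; rewrite /fV; split => [/eqP|->]; last by rewrite mul0r.
  by rewrite mulf_eq0 invr_eq0 mulf_eq0 expf_eq0/= pnatr_eq0 (gt_eqF t0) /= !orbF => /eqP.
rewrite /phi1; apply/eqP; rewrite eq_le; apply/andP; split.
  apply: ge_inf; first by exists 0 => y [/ltW].
  by split => //; apply/Vz.
apply: lb_le_inf; first by exists z; split => //; apply/Vz.
move=> y [y0 /Vz yE]; rewrite leNgt; apply/negP => yz.
by have := pos y; rewrite y0 yz yE// ltxx => /(_ isT).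
Qed.

End ProfileCalculus.

Section ProfileInequalities.
Variable R : realType.
Implicit Types (th x y : R).
Local Notation S := (@fS R).
Local Notation U := (@fU R).
Local Notation V := (@fV R).
Local Notation W := (@fW R).
Local Notation P := (@fP R).
Local Notation phi := (phi1 R).

(** A numerical bound, which lets the arithmetic tactics work without pi. *)
Lemma cut_angle_ge2 th : pi <= th -> 2 <= th.
Proof. by apply: le_trans; exact: pi_ge2. Qed.

Lemma cut_angle_sin th : pi <= th <= phi -> sin th <= 0.
Proof.
move=> /andP[h1 h2]; have [p1 p2 _ _] := phi1P R.
move: h1; rewrite le_eqVlt => /predU1P[<-|h1]; first by rewrite sinpi.
by rewrite ltW// sin32_lt0// h1 (le_trans h2 (ltW p2)).
Qed.

Lemma cut_angle_cos th : pi <= th <= phi -> cos th < 0.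
Proof.
move=> /andP[h1 h2]; have [p1 p2 _ _] := phi1P R.
by rewrite cos32_lt0// h1 (le_lt_trans h2 p2).
Qed.

Lemma fU_gt0 th : 2 <= th -> 0 < U th.
Proof.
move=> h; have t0 : 0 < th by lra.
rewrite /fU divr_gt0// ?mulr_gt0 ?exprn_gt0//.
have := cos2Dsin2 th; have := sqr_ge0 (cos th - sin th); nra.
Qed.

Lemma fS_le0 th : pi <= th <= phi -> S th <= 0.
Proof.
move=> h; have t0 : 2 <= th by apply: cut_angle_ge2; case/andP: h.
by rewrite /fS mulr_le0_ge0 ?cut_angle_sin// invr_ge0; lra.
Qed.

Lemma fV_gt0 th : pi <= th < phi -> 0 < V th.
Proof.
move=> /andP[h1 h2]; have t0 : 2 <= th by apply: cut_angle_ge2.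
have [_ _ _ pos] := phi1P R.
rewrite /fV divr_gt0 ?mulr_gt0 ?exprn_gt0 ?pos//; lra.
Qed.

Lemma fW_geU th : pi <= th < phi -> U th <= W th.
Proof.
move=> h; rewrite /fW; have := fV_gt0 h.
have : S th <= 0 by apply: fS_le0; case/andP: h => -> /ltW.
nra.
Qed.

Lemma fW_gt0 th : pi <= th < phi -> 0 < W th.
Proof.
move=> h; apply: lt_le_trans (fW_geU h); apply: fU_gt0.
by case/andP: h => h _; exact: cut_angle_ge2.
Qed.

(** Up to the factor 2 th^2 this is th + 2 th cos^2 - 3 sin cos, and 3 sin cos <= 3/2 < th. It
    serves twice: for the monotonicity of P, and as a denominator in [odd_extremal_exists]. *)
Lemma fUS_gt0 th : pi <= th <= phi -> 0 < 6 * U th - th * S th ^+ 2.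
Proof.
move=> h; have t0 : 2 <= th by apply: cut_angle_ge2; case/andP: h.
have t00 : 0 < th by lra.
have -> : 6 * U th - th * S th ^+ 2 =
    (3 * (th - sin th * cos th) - 2 * th * sin th ^+ 2) / (2 * th ^+ 2).
  by rewrite /fU /fS; field; rewrite gt_eqF.
rewrite divr_gt0 ?mulr_gt0 ?exprn_gt0//.
have := cos2Dsin2 th; have := sqr_ge0 (cos th - sin th); have := sqr_ge0 (cos th); nra.
Qed.

Definition fQ th := th * Num.sqrt (U th / W th).
Definition frho th := 2 * th * V th ^+ 2 / W th.

Lemma frho_ge0 th : pi <= th < phi -> 0 <= frho th.
Proof.
move=> h; have W0 := fW_gt0 h.
have t2 : 2 <= th by case/andP: h => h _; exact: cut_angle_ge2.
apply: divr_ge0; last exact: ltW.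
by apply: mulr_ge0; [lra|exact: sqr_ge0].
Qed.

Lemma fQ_sqr th : pi <= th < phi -> fQ th ^+ 2 * W th = th ^+ 2 * U th.
Proof.
move=> h; have W0 := fW_gt0 h.
have U0 : 0 < U th by apply: fU_gt0; case/andP: h => h _; exact: cut_angle_ge2.
have k0 : 0 <= U th / W th by rewrite divr_ge0// ltW.
by rewrite /fQ exprMn (sqr_sqrtr k0) -mulrA divfK// lt0r_neq0.
Qed.

Lemma fP_E th : pi <= th < phi -> P th = - (S th / V th) / Num.sqrt (U th / W th).
Proof.
move=> h; rewrite /fP; congr (_ * _).
by rewrite -sqrtrV ?invf_div// divr_ge0// ltW ?fW_gt0// fU_gt0// cut_angle_ge2//; case/andP: h.
Qed.

(** With k = sqrt(U / W), both sides equal 2 th (k + 1 / k): the left one by [profile_UW], the right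
    one because - S V = W - U = (1 - k^2) W. *)
Lemma fR_decomp th : pi <= th < phi -> fR th = 4 * fQ th + P th * frho th.
Proof.
move=> h; have W0 := fW_gt0 h; have V0 := fV_gt0 h.
have t2 : 2 <= th by case/andP: h => h _; exact: cut_angle_ge2.
have U0 := fU_gt0 t2.
have k0 : 0 < Num.sqrt (U th / W th) by rewrite sqrtr_gt0 divr_gt0.
have k2 : Num.sqrt (U th / W th) ^+ 2 = U th / W th by rewrite sqr_sqrtr// divr_ge0// ltW.
rewrite fP_E// /fR -profile_UW; last by rewrite gt_eqF//; lra.
have -> : Num.sqrt (U th * W th) = W th * Num.sqrt (U th / W th).
  have -> : U th * W th = W th ^+ 2 * (U th / W th) by field; rewrite gt_eqF.
  by rewrite sqrtrM ?sqr_ge0// sqrtr_sqr gtr0_norm.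
rewrite /fQ /frho; set k := Num.sqrt _ in k0 k2 *.
have SV : S th * V th = U th - W th by rewrite /fW; ring.
have kn0 := lt0r_neq0 k0; have Vn0 := lt0r_neq0 V0; have Wn0 := lt0r_neq0 W0.
have -> : - (S th / V th) / k * (2 * th * V th ^+ 2 / W th) =
    - (S th * V th) * (2 * th) / (k * W th).
  by field; rewrite !gt_eqF.
have UE : U th = k ^+ 2 * W th by rewrite k2 divfK// gt_eqF.
by rewrite SV UE; field; rewrite !gt_eqF.
Qed.

Lemma is_derive_sqrtUW th : pi <= th < phi -> is_derive th 1
  (fun x => Num.sqrt (U x / W x))
  ((S th ^+ 2 / 2 - 2 * V th ^+ 2 * (U th / W th)) / (2 * W th * Num.sqrt (U th / W th))).
Proof.
move=> h; have W0 := fW_gt0 h.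
have t2 : 2 <= th by case/andP: h => h _; exact: cut_angle_ge2.
have U0 := fU_gt0 t2; have tn0 : th != 0 by rewrite gt_eqF//; lra.
have dU := is_derive_fU tn0; have dW := is_derive_fW tn0.
have k0 : 0 < U th / W th by rewrite divr_gt0.
have k1 : Num.sqrt (U th / W th) != 0 by rewrite gt_eqF// sqrtr_gt0.
notypeclasses refine (is_derive1_eq _ _).
  notypeclasses refine (@is_derive1_sqrt_comp R (fun x => U x / W x) th _ k0 _); derive_rules;
    exact: lt0r_neq0.
by rewrite /=; field; rewrite k1 tn0 lt0r_neq0.
Qed.

Lemma fP_nondecreasing x y : pi <= x -> x <= y -> y < phi -> P x <= P y.
Proof.
move=> px xy yp.
have dom z : x <= z <= y -> pi <= z < phi.
  by move=> /andP[xz zy]; rewrite (le_trans px xz) (le_lt_trans zy yp).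
rewrite !fP_E ?dom ?lexx ?xy//.
pose k z := Num.sqrt (U z / W z).
(* [br / k] is the derivative of P. All summands are visibly nonnegative, as S <= 0 < V, except that
   S^2 / (4 U) <= 2 / z has to be drawn from [fUS_gt0]. *)
pose br z := 2 + S z ^+ 2 / (2 * V z ^+ 2) + (- (S z / V z)) * (2 / z - S z ^+ 2 / (4 * U z) +
  V z ^+ 2 / W z).
apply: (@is_derive_ge0_le R x y (fun z => - (S z / V z) / k z) (fun z => br z / k z) xy).
- move=> z /dom h; have W0 := fW_gt0 h; have V0 := fV_gt0 h.
  have t2 : 2 <= z by case/andP: h => h _; exact: cut_angle_ge2.
  have U0 := fU_gt0 t2; have zn0 : z != 0 by rewrite gt_eqF//; lra.
  have dS := is_derive_fS zn0; have dV := is_derive_fV zn0.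
  have dk := is_derive_sqrtUW h; rewrite -/(k z) in dk.
  have k0 : 0 < k z by rewrite sqrtr_gt0 divr_gt0.
  have kU : U z = k z ^+ 2 * W z.
    have k'0 : 0 <= U z / W z by rewrite divr_ge0// ltW.
    by rewrite /k (sqr_sqrtr k'0) divfK// gt_eqF.
  have kn0 : k z != 0 := lt0r_neq0 k0.
  have Vn0 : V z != 0 := lt0r_neq0 V0.
  derive_by => //; rewrite /br -/(k z) kU; field.
  by rewrite kn0 zn0 Vn0 lt0r_neq0.
- move=> z /dom h; have W0 := fW_gt0 h; have V0 := fV_gt0 h.
  have t2 : 2 <= z by case/andP: h => h _; exact: cut_angle_ge2.
  have U0 := fU_gt0 t2; have z0 : 0 < z by lra.
  have h' : pi <= z <= phi by case/andP: h => -> /ltW.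
  apply: divr_ge0; last exact: sqrtr_ge0.
  rewrite /br.
  have US : S z ^+ 2 / (4 * U z) <= 2 / z.
    have -> : S z ^+ 2 / (4 * U z) = z * S z ^+ 2 / (4 * U z) / z.
      by field; rewrite !gt_eqF.
    have U4 : 0 < 4 * U z by apply: mulr_gt0.
    rewrite ler_pM2r ?invr_gt0// ler_pdivrMr//.
    by have := fUS_gt0 h'; lra.
  apply: addr_ge0; last first.
    apply: mulr_ge0; first by rewrite -mulNr divr_ge0// ?oppr_ge0 ?fS_le0// ltW.
    have : 0 <= V z ^+ 2 / W z by rewrite divr_ge0 ?sqr_ge0// ltW.
    lra.
  apply: addr_ge0 => //; apply: divr_ge0; [exact: sqr_ge0|apply: mulr_ge0 => //; exact: sqr_ge0].
Qed.

Lemma is_derive_frho th : pi <= th < phi -> is_derive th 1 frho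
  (frho th * (S th / V th - 1 / th - 2 * V th ^+ 2 / W th)).
Proof.
move=> h; have W0 := fW_gt0 h; have V0 := fV_gt0 h.
have t2 : 2 <= th by case/andP: h => h _; exact: cut_angle_ge2.
have tn0 : th != 0 by rewrite gt_eqF//; lra.
have dV := is_derive_fV tn0; have dW := is_derive_fW tn0.
rewrite /frho; derive_by; first exact: lt0r_neq0.
by field; rewrite tn0 !lt0r_neq0.
Qed.

(** The relation is 4 Q' = - P rho': the function x |-> 4 Q(x) + P(th) rho(x) is stationary at x =
    th. *)
Lemma is_derive_fQ th : pi <= th < phi -> is_derive th 1 fQ
  (- P th / 4 * (frho th * (S th / V th - 1 / th - 2 * V th ^+ 2 / W th))).
Proof.
move=> h; have W0 := fW_gt0 h; have V0 := fV_gt0 h.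
have t2 : 2 <= th by case/andP: h => h _; exact: cut_angle_ge2.
have U0 := fU_gt0 t2; have tn0 : th != 0 by rewrite gt_eqF//; lra.
have dk := is_derive_sqrtUW h.
have k0 : 0 < Num.sqrt (U th / W th) by rewrite sqrtr_gt0 divr_gt0.
have k2 : Num.sqrt (U th / W th) ^+ 2 = U th / W th by rewrite sqr_sqrtr// divr_ge0// ltW.
have I := profile_identity tn0.
rewrite /fQ; derive_by; rewrite fP_E// /frho; set k := Num.sqrt _ in dk k0 k2 *.
have kn0 := lt0r_neq0 k0; have Vn0 := lt0r_neq0 V0; have Wn0 := lt0r_neq0 W0.
apply/eqP; rewrite -subr_eq0; apply/eqP.
transitivity (th / (2 * W th * k) * (2 * (k ^+ 2 - U th / W th) * W th / th +
   (2 * U th / th + S th * V th / th - S th ^+ 2 / 2 - 2 * V th ^+ 2)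
   + 2 * V th ^+ 2 / W th * (W th - (U th - S th * V th)))).
  by field; rewrite kn0 tn0 Vn0 Wn0.
by rewrite I k2 subrr -/(fW th) subrr !(mulr0, mul0r, addr0).
Qed.

(* th minimizes x |-> 4 Q(x) + P(th) rho(x), since the derivative of this
   function is rho'(x) (P(th) - P(x)) with rho' < 0 and P increasing. *)
Lemma fR_le th x : pi <= th < phi -> pi <= x < phi ->
  fR th <= 4 * fQ x + P th * frho x.
Proof.
move=> hth hx; rewrite fR_decomp//.
pose g z := 4 * fQ z + P th * frho z.
pose r z := frho z * (S z / V z - 1 / z - 2 * V z ^+ 2 / W z).
have dg z : pi <= z < phi -> is_derive z 1 g ((P th - P z) * r z).
  move=> h; have dQ := is_derive_fQ h; have drho := is_derive_frho h.
  by rewrite /g; derive_by; rewrite /r; field; rewrite ?lt0r_neq0 ?fV_gt0 ?fW_gt0//;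
    case/andP: h => /cut_angle_ge2; lra.
have r0 z : pi <= z < phi -> r z <= 0.
  move=> h; have W0 := fW_gt0 h; have V0 := fV_gt0 h.
  have z2 : 2 <= z by case/andP: h => h _; exact: cut_angle_ge2.
  have z0 : 0 < z by lra.
  rewrite /r mulr_ge0_le0//; first by apply: frho_ge0.
  have : S z / V z <= 0.
    by rewrite mulr_le0_ge0 ?fS_le0 ?invr_ge0 ?(ltW V0)//; case/andP: h => -> /ltW.
  have : 0 <= 1 / z by rewrite divr_ge0// ltW.
  have : 0 <= 2 * V z ^+ 2 / W z.
    by apply: divr_ge0; [apply: mulr_ge0 => //; exact: sqr_ge0|exact: ltW].
  lra.
have [tp tphi] := andP hth; have [xp xphi] := andP hx.
have [tx|/ltW xt] := leP th x.
- apply: (@is_derive_ge0_le R th x g (fun z => (P th - P z) * r z) tx).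
    by move=> z /andP[tz zx]; apply: dg; rewrite (le_trans tp tz) (le_lt_trans zx xphi).
  move=> z /andP[tz zx].
  have hz : pi <= z < phi by rewrite (le_trans tp tz) (le_lt_trans zx xphi).
  rewrite mulr_le0 ?r0// subr_le0; apply: fP_nondecreasing => //; exact: le_lt_trans xphi.
- rewrite -lerN2.
  apply: (@is_derive_ge0_le R x th (fun z => - g z) (fun z => - ((P th - P z) * r z)) xt).
    move=> z /andP[xz zt]; apply: is_derive1N.
    by apply: dg; rewrite (le_trans xp xz) (le_lt_trans zt tphi).
  move=> z /andP[xz zt].
  have hz : pi <= z < phi by rewrite (le_trans xp xz) (le_lt_trans zt tphi).
  rewrite -mulrN mulr_ge0 ?oppr_ge0 ?r0// subr_ge0.
  apply: fP_nondecreasing => //; exact: le_trans xz.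
Qed.

(** This solves - th S / V = c without dividing by V, which vanishes at phi1: the left-hand side is
    nonnegative at pi, where sin = 0, and negative at phi1. *)
Lemma cut_angle_exists (c : R) : 0 <= c ->
  exists2 th, pi <= th < phi & sin th + c * V th = 0.
Proof.
move=> c0; have [p1 p2 p3 _] := phi1P R.
have Vphi : V phi = 0 by rewrite /fV p3 mul0r.
have sphi : sin phi < 0 by apply: sin32_lt0; rewrite p1 ltW.
have [||th /andP[t1 t2] tE] := @is_derive_IVT R pi phi (fun x => sin x + c * V x)
   (fun x => cos x + c * (S x / 2 - 2 * V x / x)) (ltW p1).
- move=> y /andP[y1 _].
  have yn0 : y != 0 by have := cut_angle_ge2 y1; rewrite gt_eqF//; lra.
  by have dV := is_derive_fV yn0; derive_by; ring.
- rewrite Vphi mulr0 addr0 sinpi add0r mulr_ge0_le0 ?(ltW sphi)//.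
  by rewrite mulr_ge0// ltW// fV_gt0// lexx p1.
exists th => //; rewrite t1 lt_neqAle t2 andbT; apply/eqP => E.
by move: tE; rewrite E Vphi mulr0 addr0 => E'; rewrite E' ltxx in sphi.
Qed.

End ProfileInequalities.

(** * The lower bound for the length *)

Section OddCoefficients.
Variable R : realType.
Local Notation S := (@fS R).
Local Notation U := (@fU R).
Local Notation V := (@fV R).
Local Notation W := (@fW R).
Local Notation phi := (phi1 R).

(* ep sin(th y) + be y + ze (1 - cos (th y)) is the odd part of the optimal profile
   [xi] of [calibrated_length]: it vanishes at 1, has integral c over [0, 1], and the
   third equation is the self-consistency of the nonlocal term [K]. *)
Lemma odd_extremal_exists (th c : R) : pi <= th < phi -> exists ep be ze : R,
  [/\ ep * sin th + be + ze * (1 - cos th) = 0,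
      ep * (1 - cos th) / th + be / 2 + ze * (1 - S th) = c,
      W th * be = 3 * U th * (2 * ep * V th + be / 3
        + ze * (2^-1 - (cos th + th * sin th - 1) / th ^+ 2)) &
      ze * c <= 0].
Proof.
move=> h; have W0 := fW_gt0 h; have V0 := fV_gt0 h.
have h' : pi <= th <= phi by case/andP: h => -> /ltW.
have t2 : 2 <= th by case/andP: h => h _; exact: cut_angle_ge2.
have t0 : 0 < th by lra.
have U0 := fU_gt0 t2; have den0 := fUS_gt0 h'; have S0 := fS_le0 h'.
have s0 := cut_angle_sin h'; have C0 := cut_angle_cos h'.
have SE : th * S th = sin th by rewrite /fS mulrC divfK// gt_eqF.
have VE : 2 * th ^+ 2 * V th = sin th - th * cos th by rewrite /fV mulrC divfK// gt_eqF//
  mulr_gt0// exprn_gt0.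
have WE : W th = U th - S th * V th by [].
have C1 : -1 <= cos th := cos_geN1 th.
have jE : 1 / 2 <= 2^-1 - (cos th + th * sin th - 1) / th ^+ 2.
  have : (cos th + th * sin th - 1) / th ^+ 2 <= 0.
    rewrite mulr_le0_ge0 ?invr_ge0 ?sqr_ge0//; nra.
  lra.
move: jE; set j := 2^-1 - _ => jE.
have tn0 := lt0r_neq0 t0.
have Wn := lt0r_neq0 W0; have Vn := lt0r_neq0 V0; have dn := lt0r_neq0 den0.
move: (sin th) (cos th) (S th) (U th) (V th) (W th) Wn Vn dn
  W0 V0 U0 den0 S0 s0 C0 SE VE WE C1 => s C Sv Uv Vv Wv Wn0 Vn0 dn0 W0 V0 U0 den0 S0 s0 C0 SE
    VE WE C1 {h h'}.
set den := 6 * Uv - th * Sv ^+ 2 in dn0 den0.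
(* With ze = - k and ep = k rat, the first equation gives be, the third one determines rat, and the
   second one reads k Gm = c. The point is Gm > 0, which also gives the sign of ze c. *)
pose num := (1 - C) * (- Sv * Vv) + 3 * Uv * j.
pose rat := num / (Vv * den).
have ratE : th / 2 <= rat.
  have Vden : 0 < Vv * den by rewrite mulr_gt0.
  rewrite /rat ler_pdivlMr//.
  have V1 : 2 * th * Vv <= 1.
    rewrite -(ler_pM2l t0) mulr1 (_ : th * _ = 2 * th ^+ 2 * Vv); last by ring.
    rewrite VE; nra.
  have den6 : den <= 6 * Uv by rewrite /den; have := sqr_ge0 Sv; nra.
  have : 0 <= (1 - C) * (- Sv * Vv) by rewrite !mulr_ge0// ?oppr_ge0 ?(ltW V0)//; lra.
  have : th / 2 * (Vv * den) <= den / 4 by nra.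
  rewrite /num; nra.
pose Gm := ((1 - C) / th - s / 2) * rat - (1 + C) / 2 + Sv.
have Gm0 : 0 < Gm.
  have a0 : 0 <= (1 - C) / th - s / 2.
    have : 0 <= (1 - C) / th by rewrite divr_ge0 ?ltW//; lra.
    lra.
  have := ler_wpM2l a0 ratE.
  have -> : ((1 - C) / th - s / 2) * (th / 2) = (1 - C) / 2 - s * th / 4 by field.
  have : th * Sv <= 4 * Sv / 2 by nra.
  rewrite /Gm; nra.
exists (c / Gm * rat), (- (c / Gm * rat) * s + c / Gm * (1 - C)), (- (c / Gm)).
have Gn0 := lt0r_neq0 Gm0.
split.
- by ring.
- have E : c = c / Gm * (((1 - C) / th - s / 2) * rat - (1 + C) / 2 + Sv).
    by rewrite -/Gm divfK.
  by rewrite [RHS]E; field; rewrite tn0 Gn0.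
- have E : rat * (Vv * den) = num by rewrite /rat divfK// mulf_neq0.
  have {}E : rat * (Vv * (6 * Uv - th * Sv ^+ 2)) = (1 - C) * (- Sv * Vv) + 3 * Uv * j := E.
  set k := c / Gm.
  apply/eqP; rewrite -subr_eq0; apply/eqP.
  transitivity (k * ((1 - C) * (- Sv * Vv) + 3 * Uv * j - rat * (Vv * (6 * Uv - th * Sv ^+ 2)))
    + (Wv - (Uv - Sv * Vv)) * (k * (1 - C) - k * rat * s) 
    + k * rat * Sv * Vv * (s - th * Sv)); first by field.
  by rewrite E WE SE !subrr !(mulr0, mul0r, addr0).
- rewrite mulNr oppr_le0 mulrAC mulr_ge0 ?invr_ge0 ?(ltW Gm0)//.
  by rewrite -expr2 sqr_ge0.
Qed.

End OddCoefficients.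

(** * Riccati fields for the one-dimensional comparison *)

Section FieldOfExtremals.
Variable R : realType.
Local Notation mu := (@lebesgue_measure R).
Local Notation phi := (phi1 R).

(** The matrix Riccati equation for the symmetric matrix with entries A, B, B, C: if f' = p and F' =
    f, then p^2 - th^2 f^2 minus the derivative of A f^2 + 2 B f F + C F^2 is the square of p - (A f
    + B F). *)
Record riccati (th lo hi : R) (A B C : R -> R) : Prop := Riccati {
  riccati_A : forall y, lo <= y <= hi ->
    is_derive y 1 A (- th ^+ 2 - 2 * B y - A y ^+ 2);
  riccati_B : forall y, lo <= y <= hi -> is_derive y 1 B (- C y - A y * B y);
  riccati_C : forall y, lo <= y <= hi -> is_derive y 1 C (- B y ^+ 2) }.

(** Reversing the direction of y changes the sign of the quadratic form in (f, F) and also that of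
    F; so A and C change sign, and B does not. *)
Lemma riccati_flip th A B C : riccati th 0 1 A B C ->
  riccati th (-1) 0 (fun y => - A (- y)) (fun y => B (- y)) (fun y => - C (- y)).
Proof.
move=> [dA dB dC].
have opp (y : R) : is_derive y 1 (fun z : R => - z) (- 1).
  by apply: is_derive1N; exact: is_derive1_id.
split=> y /andP[y1 y2]; have h : 0 <= - y <= 1 by apply/andP; split; lra.
- by apply: (is_derive1_eq (is_derive1N (is_derive_comp1 (opp y) (dA _ h)))); ring.
- by apply: (is_derive1_eq (is_derive_comp1 (opp y) (dB _ h))); ring.
- by apply: (is_derive1_eq (is_derive1N (is_derive_comp1 (opp y) (dC _ h)))); ring.
Qed.

(* The solutions of f'' + th^2 f = const with F' = f and f'(0) = 0 are spanned
   by (cos, sin / th) and a second one normalized by F(0) = 1; D is the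
   determinant of these two, and n is chosen so large that D does not vanish. *)
Lemma riccati_exists th : pi <= th < phi ->
  exists A B C, riccati th 0 1 A B C /\ A 0 = 0.
Proof.
move=> /andP[h1 h2]; have [p1 p2 p3 pos] := phi1P R.
have p0 := pi_gt0 R; have t2 := cut_angle_ge2 h1; have t0 : 0 < th by lra.
pose N (x : R) := sin x - x * cos x.
have dN (x : R) : is_derive x 1 N (x * sin x) := is_derive_num x.
have Nth : 0 < N th by apply: pos; rewrite t0.
(* N increases from 1 on [pi / 2, pi] and then decreases to N th, so m bounds it below on
   [pi / 2, th]. There n N >= 2 outweighs cos >= -1; before pi / 2 the cosine is positive. *)
pose m := Num.min 1 (N th).
have m0 : 0 < m by rewrite lt_min ltr01.
have Nm x : pi / 2 <= x <= th -> m <= N x.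
  move=> /andP[x1 x2]; rewrite ge_min; have [xp|px] := leP x pi.
    apply/orP; left.
    have -> : 1 = N (pi / 2) by rewrite /N sin_pihalf cos_pihalf mulr0 subr0.
    apply: (@is_derive_ge0_le R (pi / 2) x N (fun x => x * sin x) x1 (fun y _ => dN y)).
    move=> y /andP[y1 y2]; rewrite mulr_ge0 ?sin_ge0_pi//; first by lra.
    by apply/andP; split; lra.
  apply/orP; right; move: x2; rewrite le_eqVlt => /predU1P[->//|x2].
  by apply/ltW/num_decr => //; [exact: ltW|exact: ltW (lt_trans h2 p2)].
pose n := 2 / m; have n0 : 0 < n by rewrite divr_gt0.
pose D x := cos x + n * N x.
have D0 x : 0 <= x <= th -> 0 < D x.
  move=> /andP[x0 xt]; have [xp|px] := ltP x (pi / 2).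
    have c0 : 0 < cos x by apply: cos_gt0_pihalf; apply/andP; split; lra.
    move: x0; rewrite le_eqVlt => /predU1P[x0|x0].
      by rewrite /D /N -x0 mul0r sin0 subrr mulr0 addr0 cos0.
    by rewrite /D ltr_wpDr// mulr_ge0 ?(ltW n0)// ltW// pos// x0 (le_lt_trans xt).
  have := Nm x; rewrite px xt => /(_ isT) mN.
  have : n * m <= n * N x by rewrite ler_pM2l.
  rewrite /n divfK ?gt_eqF// -/n => nN.
  by have := cos_geN1 x; rewrite /D; lra.
have dD (x : R) : is_derive x 1 D (sin x * (n * x - 1)).
  by have dNx := dN x; rewrite /D; derive_by; ring.
have Dn0 y : 0 <= y <= 1 -> D (th * y) != 0.
  move=> /andP[y0 y1]; rewrite lt0r_neq0// D0//; apply/andP; split; nra.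
have dty (y : R) : is_derive y 1 (fun z => th * z) th by derive_by; ring.
have dDy (y : R) : is_derive y 1 (fun z => D (th * z)) (sin (th * y) * (n * (th * y) - 1) * th).
  exact: is_derive_comp1 (dty y) (dD _).
exists (fun y => th * sin (th * y) * (n * (th * y) - 1) / D (th * y)),
  (fun y => - n * th ^+ 2 * sin (th * y) / D (th * y)),
  (fun y => n * th ^+ 3 * cos (th * y) / D (th * y)).
split; last by rewrite mulr0 sin0 mulr0 mul0r mul0r.
split=> y hy; have Dy := Dn0 y hy; have dDyy := dDy y.
- derive_by => //; apply/eqP; rewrite -subr_eq0; apply/eqP.
  transitivity (th ^+ 2 * (cos (th * y) + n * (sin (th * y) - th * y * cos (th * y)) - D (th * y))
     * (-1) / D (th * y) ^+ 1 * 1 + 0); first by rewrite /D /N; field.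
  by rewrite subrr !(mulr0, mul0r, addr0).
- derive_by => //; apply/eqP; rewrite -subr_eq0; apply/eqP; rewrite /D /N in Dy *.
  by field.
- derive_by => //; rewrite /D /N in Dy *; field: (cos2E (th * y)); exact: Dy.
Qed.

(** The field of extremals around [xi] has slope k = eta + A (f - xi) + B (F - Xi), and [Z] is built
    so that its derivative is 2 k p - k^2 w. The hypothesis on [e] expresses e >= p^2 / w in a form
    that makes sense for w = 0. The constants mu0 and th^2 be are the multipliers of the integral F
    and of the moment K. *)
Lemma riccati_bound (a b lo hi th mu0 be : R) (f p tau w F G K E e : R -> R)
    (A B C xi eta Xi M : R -> R) : a <= b ->
  AD a b f p -> AD a b tau w -> AD a b F (fun s => f s * w s) ->
  AD a b G (fun s => f s * f s * w s) -> AD a b K (fun s => tau s * f s * w s) ->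
  AD a b E e ->
  {ae mu, forall s, a < s < b -> forall k, 2 * k * p s - k ^+ 2 * w s <= e s} ->
  (forall s, a <= s <= b -> lo <= tau s <= hi) ->
  riccati th lo hi A B C ->
  (forall y : R, is_derive y 1 xi (eta y)) ->
  (forall y : R, is_derive y 1 eta (mu0 + th ^+ 2 * be * y - th ^+ 2 * xi y)) ->
  (forall y : R, is_derive y 1 Xi (xi y)) -> (forall y : R, is_derive y 1 M (y * xi y)) ->
  let Z := fun s => th ^+ 2 * G s
    + (A (tau s) * ((f s - xi (tau s)) * (f s - xi (tau s)))
       + 2 * (B (tau s) * ((f s - xi (tau s)) * (F s - Xi (tau s))))
       + C (tau s) * ((F s - Xi (tau s)) * (F s - Xi (tau s))))
    + (eta (tau s) * (2 * f s - xi (tau s)) - 2 * mu0 * F s - 2 * th ^+ 2 * be * K s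
       + mu0 * Xi (tau s) + th ^+ 2 * be * M (tau s)) in
  is_true (Z b - Z a <= E b - E a).
Proof.
move=> ab df dtau dF dG dK dE ek tauI [dA dB dC] dxi deta dXi dM Z.
have dAt : AD a b (fun s => A (tau s)) (fun s => (- th ^+ 2 - 2 * B (tau s) - A (tau s) ^+ 2) *
  w s).
  apply: (AD_comp (g' := fun y => - (2 * (- C y - A y * B y)) - 2 * A y * (- th ^+ 2 - 2 * B y
    - A y ^+ 2)) ab dtau tauI dA).
  by move=> y hy; have := dA y hy; have := dB y hy => dBy dAy; derive_by; ring.
have dBt : AD a b (fun s => B (tau s)) (fun s => (- C (tau s) - A (tau s) * B (tau s)) * w s).
  apply: (AD_comp (g' := fun y => B y ^+ 2 - ((- th ^+ 2 - 2 * B y - A y ^+ 2) * B y + A y * (-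
    C y - A y * B y))) ab dtau tauI dB).
  by move=> y hy; have := dA y hy; have := dB y hy; have := dC y hy => dCy dBy dAy; derive_by;
    ring.
have dCt : AD a b (fun s => C (tau s)) (fun s => (- B (tau s) ^+ 2) * w s).
  apply: (AD_comp (g' := fun y => - (2 * B y * (- C y - A y * B y))) ab dtau tauI dC).
  by move=> y hy; have := dB y hy => dBy; derive_by; ring.
have dxit : AD a b (fun s => xi (tau s)) (fun s => eta (tau s) * w s).
  exact: (AD_comp ab dtau tauI (fun y _ => dxi y) (fun y _ => deta y)).
have detat : AD a b (fun s => eta (tau s))
    (fun s => (mu0 + th ^+ 2 * be * tau s - th ^+ 2 * xi (tau s)) * w s).
  apply: (AD_comp (g' := fun y => th ^+ 2 * be - th ^+ 2 * eta y) ab dtau tauI (fun y _ =>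
    deta y)).
  by move=> y _; have := dxi y => dxiy; derive_by; ring.
have dXit : AD a b (fun s => Xi (tau s)) (fun s => xi (tau s) * w s).
  exact: (AD_comp ab dtau tauI (fun y _ => dXi y) (fun y _ => dxi y)).
have dMt : AD a b (fun s => M (tau s)) (fun s => tau s * xi (tau s) * w s).
  apply: (AD_comp (g' := fun y => xi y + y * eta y) ab dtau tauI (fun y _ => dM y)).
  by move=> y _; have := dxi y => dxiy; derive_by; ring.
pose k s := eta (tau s) + A (tau s) * (f s - xi (tau s)) + B (tau s) * (F s - Xi (tau s)).
suff dZ : AD a b Z (fun s => 2 * k s * p s - k s ^+ 2 * w s).
  by apply: (AD_le ab dZ dE); apply: ae_imp ek => s H /H.
rewrite /Z; AD_by => s _; rewrite /k; ring.
Qed.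

End FieldOfExtremals.

(** * The calibration inequality *)

Section CalibratedBound.
Variable R : realType.
Local Notation mu := (@lebesgue_measure R).
Local Notation phi := (phi1 R).

Lemma AC_continuous (a b : R) (F : R -> R) : a < b -> AC a b F ->
  {within `[a, b], continuous F}.
Proof.
move=> ab aF.
have dist c e : a <= c <= b -> 0 < e -> exists2 d, 0 < d &
    forall y, a <= y <= b -> `|y - c| < d -> `|F c - F y| < e.
  move=> hc e0; have [d d0 Hd] := AC_dist aF e0; exists d => // y hy yc.
  by rewrite distrC; exact: Hd.
apply/continuous_within_itvP => //; split.
- move=> c; rewrite in_itv/= => /andP[ac cb]; apply/cvgrPdist_lt => e e0.
  have [d d0 Hd] := dist c e (introT andP (conj (ltW ac) (ltW cb))) e0.
  near=> y; apply: Hd.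
    apply/andP; split; near: y; [exact: lt_le_nbhsr|exact: lt_le_nbhsl].
  rewrite distrC; near: y; by apply/nbhs_ballP; exists d.
- apply/cvgrPdist_lt => e e0.
  have [d d0 Hd] := dist a e (introT andP (conj (lexx a) (ltW ab))) e0.
  near=> y.
  have ay : a < y by near: y; exact: nbhs_right_gt.
  have yb : y < b by near: y; exact: nbhs_right_lt.
  apply: Hd; first by rewrite !ltW.
  rewrite ger0_norm ?subr_ge0 ?ltW// ltrBlDl; near: y.
  by apply: nbhs_right_lt; rewrite ltrDl.
- apply/cvgrPdist_lt => e e0.
  have [d d0 Hd] := dist b e (introT andP (conj (ltW ab) (lexx b))) e0.
  near=> y.
  have ay : a < y by near: y; exact: nbhs_left_gt.
  have yb : y < b by near: y; exact: nbhs_left_lt.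
  apply: Hd; first by rewrite !ltW.
  rewrite ler0_norm ?subr_le0 ?ltW// opprB ltrBlDl -ltrBlDr; near: y.
  by apply: nbhs_left_gt; rewrite ltrBlDr ltrDl.
Unshelve. all: by end_near. Qed.

Lemma AC_measurable (a b : R) (F : R -> R) : a < b -> AC a b F ->
  measurable_fun `]a, b[%classic F.
Proof.
move=> ab /(AC_continuous ab) /(continuous_within_itvP _ ab) [cF _ _].
apply: open_continuous_measurable_fun; first exact: interval_open.
by move=> x; rewrite inE; exact: cF.
Qed.

Lemma AD_weighted_primitive (a b : R) (g w : R -> R) : a < b -> AC a b g ->
  measurable_fun `]a, b[%classic w ->
  (\int[mu]_(s in `]a, b[) ((w s) ^+ 2)%:E < +oo)%E ->
  exists G, G a = 0 /\ AD a b G (fun s => g s * w s).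
Proof.
move=> ab aG mw w2; have [K K0 HK] := AC_bounded (ltW ab) aG.
have mg := AC_measurable ab aG.
have [||G [Ga dG _]] := @AD_prim R a b (fun s => g s * w s) ab; last by exists G.
  exact: measurable_funM.
apply: (@le_lt_trans _ _ (\int[mu]_(s in `]a, b[) ((K ^+ 2)%:E * ((w s) ^+ 2)%:E))%E).
  apply: ge0_le_integral => //.
  - by move=> s _; rewrite lee_fin sqr_ge0.
  - by apply/measurable_EFinP/measurable_funX/measurable_funM.
  - apply/measurable_EFinP; apply: measurable_funM => //; exact: measurable_funX.
  - move=> s; rewrite /= in_itv/= => /andP[as_ sb].
    rewrite -EFinM lee_fin exprMn ler_wpM2r ?sqr_ge0//.
    rewrite -[g s ^+ 2]real_normK ?num_real// lerXn2r ?nnegrE//.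
    by apply: HK; rewrite !ltW.
rewrite ge0_integralZl//; last 3 first.
- by apply/measurable_EFinP/measurable_funX.
- by move=> s _; rewrite lee_fin sqr_ge0.
- by rewrite lee_fin sqr_ge0.
rewrite lte_mul_pinfty ?lee_fin ?sqr_ge0//.
Qed.

Lemma AD_IVT (a b : R) (F f : R -> R) : a < b -> AD a b F f -> F a <= 0 <= F b ->
  exists2 s, a <= s <= b & F s = 0.
Proof.
move=> ab [aF _] /andP[Fa Fb].
have [|s] := @IVT _ F a b 0 (ltW ab) (AC_continuous ab aF).
  by rewrite ge_min le_max Fa Fb orbT.
by rewrite in_itv/=; exists s.
Qed.

(** For w > 0 this is the sum of the squares (u_i - k_i w)^2 divided by w. Writing c^2 w for |u|^2 /
    w covers w = 0 too, where the u_i vanish. *)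
Lemma pointwise_calibration (c w u1 u2 u3 k1 k2 k3 : R) : 0 <= w ->
  u1 ^+ 2 + u2 ^+ 2 + u3 ^+ 2 = c ^+ 2 * w ^+ 2 ->
  (2 * k1 * u1 - k1 ^+ 2 * w) + (2 * k2 * u2 - k2 ^+ 2 * w)
    + (2 * k3 * u3 - k3 ^+ 2 * w) <= c ^+ 2 * w.
Proof.
rewrite le_eqVlt => /predU1P[<-|w0] E.
  have H := sqr_ge0 u1; have H2 := sqr_ge0 u2; have H3 := sqr_ge0 u3.
  rewrite expr0n mulr0 in E.
  have /eqP : u1 ^+ 2 = 0 by lra.
  have /eqP : u2 ^+ 2 = 0 by lra.
  have /eqP : u3 ^+ 2 = 0 by lra.
  by rewrite !expf_eq0/= => /eqP -> /eqP -> /eqP ->; lra.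
rewrite -subr_ge0 -(pmulr_rge0 _ w0).
have -> : w * (c ^+ 2 * w - (2 * k1 * u1 - k1 ^+ 2 * w + (2 * k2 * u2 - k2 ^+ 2 * w)
    + (2 * k3 * u3 - k3 ^+ 2 * w))) =
    (u1 - k1 * w) ^+ 2 + (u2 - k2 * w) ^+ 2 + (u3 - k3 * w) ^+ 2
    + (c ^+ 2 * w ^+ 2 - (u1 ^+ 2 + u2 ^+ 2 + u3 ^+ 2)) by ring.
by rewrite E subrr addr0 !addr_ge0 ?sqr_ge0.
Qed.

End CalibratedBound.

Section CalibratedLength.
Variable R : realType.
Local Notation mu := (@lebesgue_measure R).
Local Notation phi := (phi1 R).
Local Notation S := (@fS R).
Local Notation U := (@fU R).
Local Notation V := (@fV R).
Local Notation W := (@fW R).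

(* The length is 2 c, and tau is the arc length rescaled to [-1, 1]. *)
Lemma calibrated_length (T c X t m1 th0 : R)
    (x1 x2 x3 u1 u2 u3 t12 t13 tau w F1 F2 : R -> R) :
  0 < T -> 0 < c -> 0 < t -> pi <= th0 < phi -> X ^+ 2 = fP th0 * t ->
  AD 0 T x1 u1 -> AD 0 T x2 u2 -> AD 0 T x3 u3 ->
  AD 0 T t12 (fun s => 2^-1 * (x1 s * u2 s - x2 s * u1 s)) ->
  AD 0 T t13 (fun s => 2^-1 * (x1 s * u3 s - x3 s * u1 s)) ->
  AD 0 T tau w -> (forall s, 0 <= w s) ->
  (forall s, u1 s ^+ 2 + u2 s ^+ 2 + u3 s ^+ 2 = c ^+ 2 * w s ^+ 2) ->
  measurable_fun `]0, T[%classic w ->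
  (\int[mu]_(s in `]0%R, T[) ((w s) ^+ 2)%:E < +oo)%E ->
  tau 0 = -1 -> tau T = 1 ->
  AD 0 T F1 (fun s => x1 s * w s) -> AD 0 T F2 (fun s => x2 s * w s) ->
  F1 T - F1 0 = 2 * m1 -> F2 T = F2 0 ->
  x1 0 = 0 -> x2 0 = 0 -> x3 0 = 0 -> t12 0 = 0 -> t13 0 = 0 ->
  x1 T = 0 -> x2 T = 0 -> x3 T = X -> t12 T = t -> t13 T = 0 ->
  X ^+ 2 + fR th0 * t <= 4 * c ^+ 2.
Proof.
move=> T0 c0 t0 hth0 XP dx1 dx2 dx3 dt12 dt13 dtau w0 uw mw w2 tau0 tauT dF1 dF2 F1T F2T
  x10 x20 x30 t120 t130 x1T x2T x3T t12T t13T.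
have T0' := ltW T0.
have [sm /andP[sm0 smT] tausm] : exists2 s, 0 <= s <= T & tau s = 0.
  by apply: (AD_IVT T0 dtau); rewrite tau0 tauT lerN10 ler01.
have tau_mono x y : 0 <= x -> x <= y -> y <= T -> tau x <= tau y.
  move=> x0 xy yT; apply: (AD_ge0 xy (AD_sub x0 yT dtau)).
  by apply: aeW => s _.
pose f s := x1 s - m1.
have df : AD 0 T f u1 by rewrite /f; AD_by => s _; ring.
(* Normalized to vanish at the middle, the common origin of the two fields of extremals; since f has
   mean zero, F takes equal values at the two ends. *)
pose F s := F1 s - m1 * tau s - (F1 sm - m1 * tau sm).
have dF : AD 0 T F (fun s => f s * w s) by rewrite /F; AD_by => s _; rewrite /f; ring.
have Fsm : F sm = 0 by rewrite /F subrr.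
have FT0 : F T = F 0 by rewrite /F tau0 tauT; lra.
have dff : AD 0 T (fun s => f s * f s) (fun s => 2 * f s * u1 s) by AD_by => s _; ring.
have dtf : AD 0 T (fun s => tau s * f s) (fun s => w s * f s + tau s * u1 s) by AD_by => s _;
  ring.
have [G [G0 dG]] := AD_weighted_primitive T0 dff.1 mw w2.
have [K [K0 dK]] := AD_weighted_primitive T0 dtf.1 mw w2.
(* An integration by parts turns the area forms into f dx2 and, for [B13], f dx3. *)
pose A12 s := t12 s + 2^-1 * (x1 s * x2 s) - m1 * x2 s.
have dA12 : AD 0 T A12 (fun s => f s * u2 s) by rewrite /A12; AD_by => s _; rewrite /f; field.
pose B13 s := t13 s + 2^-1 * (x1 s * x3 s) - m1 * x3 s.
have dB13 : AD 0 T B13 (fun s => f s * u3 s) by rewrite /B13; AD_by => s _; rewrite /f; field.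
have A12T : A12 T - A12 0 = t by rewrite /A12 t12T x1T x2T t120 x10 x20; ring.
have B13T : B13 T - B13 0 = - m1 * X by rewrite /B13 t13T x1T x3T t130 x10 x30; ring.
(* otherwise f = 0, and the plane curve could not enclose the area t *)
have GT0 : 0 < G T.
  rewrite ltNge; apply/negP => GT.
  (* If G T <= 0, the left-hand side of [H] is at least 2 n t = 4 c^2, while the right-hand side is
     2 c^2. *)
  pose n := 2 * c ^+ 2 / t.
  have H : (2 * n * A12 T - n ^+ 2 * G T) - (2 * n * A12 0 - n ^+ 2 * G 0) <= c ^+ 2 * tau T -
    c ^+ 2 * tau 0.
    apply: (@AD_le R 0 T (fun s => 2 * n * A12 s - n ^+ 2 * G s)
      (fun s => 2 * n * (f s * u2 s) - n ^+ 2 * (f s * f s * w s))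
      (fun s => c ^+ 2 * tau s) (fun s => c ^+ 2 * w s)) => //.
    - by AD_by => s _; ring.
    - by AD_by => s _; ring.
    - apply: aeW => s _; have := pointwise_calibration 0 (n * f s) 0 (w0 s) (uw s); lra.
  have nt : n * t = 2 * c ^+ 2 by rewrite /n divfK// gt_eqF.
  have c2 : 0 < c ^+ 2 by rewrite exprn_gt0.
  have := sqr_ge0 n; rewrite tau0 tauT G0 in H.
  have : 2 * n * A12 T - 2 * n * A12 0 = 2 * (n * t) by rewrite -A12T; ring.
  by rewrite nt; nra.
(* The equation is - th S / V = X^2 / G T. It cancels the boundary term r^2 X^2 / G T ([rE]) and
   expresses (th^2 - Q^2) G T through th and X ([QG]). *)
have [th hth thE] := cut_angle_exists (divr_ge0 (sqr_ge0 X) (ltW GT0)).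
have W0 := fW_gt0 hth; have V0 := fV_gt0 hth.
have th2 : 2 <= th by case/andP: hth => h _; exact: cut_angle_ge2.
have th00 : 0 < th by lra.
have thn0 := lt0r_neq0 th00; have Vn0 := lt0r_neq0 V0; have Wn0 := lt0r_neq0 W0.
have Gn0 := lt0r_neq0 GT0.
pose Q := fQ th.
have QE : Q ^+ 2 * W th = th ^+ 2 * U th := fQ_sqr hth.
(* [r] is the value of f at both ends, and [c1] the integral of f over the right half; over the left
   half it is - c1. *)
pose r := - m1; pose c1 := F T.
have [ep [be [ze [ode1 ode2 ode3 ode4]]]] := odd_extremal_exists c1 hth.
(* The even part al + de cos(th y) is to have mean zero and the value r at y = 1. *)
pose de := - r / (2 * th * V th); pose al := - de * S th.
pose si := sin th; pose co := cos th.
have SE : th * S th = si by rewrite /fS mulrC divfK.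
have VE : 2 * th ^+ 2 * V th = si - th * co by rewrite /fV mulrC divfK// mulf_neq0// expf_neq0.
(* the optimal profile f = xi(tau), with sg = -1 for tau < 0 and sg = 1 for tau > 0 *)
pose xi (sg y : R) := al + de * cos (th * y) + ep * sin (th * y) + be * y + sg * ze * (1 - cos
  (th * y)).
pose eta (sg y : R) := - de * th * sin (th * y) + ep * th * cos (th * y) + be + sg * ze * th *
  sin (th * y).
pose mu_ (sg : R) := th ^+ 2 * (al + sg * ze).
pose Xi (sg y : R) := al * y + de * sin (th * y) / th + ep * (1 - cos (th * y)) / th + be * y
  ^+ 2 / 2
  + sg * ze * (y - sin (th * y) / th).
pose M (sg y : R) := al * y ^+ 2 / 2 + de * (y * sin (th * y) / th + cos (th * y) / th ^+ 2)
  + ep * (sin (th * y) / th ^+ 2 - y * cos (th * y) / th) + be * y ^+ 3 / 3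
  + sg * ze * (y ^+ 2 / 2 - y * sin (th * y) / th - cos (th * y) / th ^+ 2).
have dxi sg (y : R) : is_derive y 1 (xi sg) (eta sg y).
  by rewrite /xi; derive_by; rewrite /eta; ring.
have deta sg (y : R) : is_derive y 1 (eta sg) (mu_ sg + th ^+ 2 * be * y - th ^+ 2 * xi sg y).
  by rewrite /eta; derive_by; rewrite /mu_ /xi; ring.
have dXi sg (y : R) : is_derive y 1 (Xi sg) (xi sg y).
  by rewrite /Xi; derive_by; rewrite /xi; field.
have dM sg (y : R) : is_derive y 1 (M sg) (y * xi sg y).
  by rewrite /M; derive_by; rewrite /xi; field.
(* The integral of y xi(y) over [-1, 1], to which only the odd part contributes. The third equation
   for ep, be, ze says that th^2 be = (3/2) Q^2 Kx ([bE]). *)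
pose Kx := 2 * (2 * ep * V th + be / 3 + ze * (2^-1 - (co + th * si - 1) / th ^+ 2)).
(* [ga] maximizes - 2 Q ga K T - (2/3) ga^2 in the increment of [Z2], and [ka] maximizes 2 ka r X -
   ka^2 G T in that of [Z3]. *)
pose ga := - (3 / 2) * Q * K T.
pose ka := r * X / G T.
pose k2 s := Q * f s + ga * tau s.
pose k3 s := X / 2 + ka * f s.
pose Z2 s := 2 * Q * A12 s + 2 * ga * (tau s * x2 s - F2 s) - Q ^+ 2 * G s
  - 2 * Q * ga * K s - ga ^+ 2 / 3 * (tau s * (tau s * tau s)).
have dZ2 : AD 0 T Z2 (fun s => 2 * k2 s * u2 s - k2 s ^+ 2 * w s).
  by rewrite /Z2; AD_by => s _; rewrite /k2; field.
pose Z3 s := X * x3 s + 2 * ka * B13 s - X ^+ 2 / 4 * tau s - X * ka * F s - ka ^+ 2 * G s.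
have dZ3 : AD 0 T Z3 (fun s => 2 * k3 s * u3 s - k3 s ^+ 2 * w s).
  by rewrite /Z3; AD_by => s _; rewrite /k3; field.
pose E s := c ^+ 2 * tau s - Z2 s - Z3 s.
pose e s := c ^+ 2 * w s - (2 * k2 s * u2 s - k2 s ^+ 2 * w s) - (2 * k3 s * u3 s - k3 s ^+ 2 *
  w s).
have dE : AD 0 T E e by rewrite /E; AD_by => s _; rewrite /e; ring.
have ek (a b : R) : {ae mu, forall s, a < s < b -> forall k, 2 * k * u1 s - k ^+ 2 * w s <= e s}.
  apply: aeW => s _ k; rewrite /e.
  by have := pointwise_calibration k (k2 s) (k3 s) (w0 s) (uw s); lra.
have [A [B [C [ricc A0]]]] := riccati_exists hth.
have Hr := @riccati_bound R sm T 0 1 th (mu_ 1) be f u1 tau w F G K E e A B C (xi 1) (eta 1)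
  (Xi 1) (M 1)
  smT (AD_sub sm0 (lexx T) df) (AD_sub sm0 (lexx T) dtau) (AD_sub sm0 (lexx T) dF)
  (AD_sub sm0 (lexx T) dG) (AD_sub sm0 (lexx T) dK) (AD_sub sm0 (lexx T) dE) (ek _ _).
have Hl := @riccati_bound R 0 sm (-1) 0 th (mu_ (-1)) be f u1 tau w F G K E e
  (fun y => - A (- y)) (fun y => B (- y)) (fun y => - C (- y)) (xi (-1)) (eta (-1)) (Xi (-1))
    (M (-1))
  sm0 (AD_sub (lexx 0) smT df) (AD_sub (lexx 0) smT dtau) (AD_sub (lexx 0) smT dF)
  (AD_sub (lexx 0) smT dG) (AD_sub (lexx 0) smT dK) (AD_sub (lexx 0) smT dE) (ek _ _).
have tau_r s : sm <= s <= T -> 0 <= tau s <= 1.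
  move=> /andP[h1 h2]; apply/andP; split.
    by rewrite -[leLHS]tausm; exact: tau_mono.
  by rewrite -tauT; apply: tau_mono => //; exact: le_trans h1.
have tau_l s : 0 <= s <= sm -> -1 <= tau s <= 0.
  move=> /andP[h1 h2]; apply/andP; split.
    by rewrite -tau0; apply: tau_mono => //; exact: le_trans h2 smT.
  by rewrite -[leRHS]tausm; exact: tau_mono.
have {}Hr := Hr tau_r ricc (dxi 1) (deta 1) (dXi 1) (dM 1).
have {}Hl := Hl tau_l (riccati_flip ricc) (dxi (-1)) (deta (-1)) (dXi (-1)) (dM (-1)).
have fT : f T = r by rewrite /f x1T sub0r.
have f0 : f 0 = r by rewrite /f x10 sub0r.
have coS : co - S th = - 2 * th * V th.
  apply: (mulfI thn0); rewrite mulrBr SE.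
  by transitivity (- (2 * th ^+ 2 * V th)); [rewrite VE|]; ring.
have der : de * (co - S th) = r by rewrite coS /de; field; rewrite thn0 Vn0.
have xi1 : xi 1 1 = r.
  have -> : xi 1 1 = de * (co - S th) + (ep * si + be + ze * (1 - co)).
    by rewrite /xi /al !mulr1 -/si -/co; ring.
  by rewrite ode1 addr0.
have xiN1 : xi (-1) (-1) = r.
  have -> : xi (-1) (-1) = de * (co - S th) - (ep * si + be + ze * (1 - co)).
    by rewrite /xi /al mulrN1 cosN sinN -/si -/co; ring.
  by rewrite ode1 subr0.
have Xi1 : Xi 1 1 = c1.
  rewrite -ode2 /Xi !mulr1 -/si -/co /al /fS -/si; field; exact: thn0.
have XiN1 : Xi (-1) (-1) = c1.
  rewrite -ode2 /Xi !mulrN !mulr1 cosN sinN -/si -/co /al /fS -/si; field; exact: thn0.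
(* The quadratic parts drop out: at the ends f = xi and F = Xi, and in the middle F = Xi = 0 and A 0
   = 0, whatever f is there. The linear terms of the two halves agree in the middle, since xi and
   eta at 0 do not depend on sg. *)
move: Hr; rewrite /= tausm tauT fT Fsm xi1 Xi1 -/c1 A0 => Hr.
move: Hl; rewrite /= tausm tau0 f0 -FT0 Fsm xiN1 XiN1 -/c1 oppr0 A0 => Hl.
have Xi0 sg : Xi sg 0 = 0 by rewrite /Xi !mulr0 sin0 cos0; field.
rewrite !Xi0 in Hr Hl.
have HE : th ^+ 2 * G T - 2 * r * de * th * si - 2 * th ^+ 2 * ze * c1
    - 2 * th ^+ 2 * be * K T + th ^+ 2 * be * Kx <= E T - E 0.
  have := lerD Hr Hl; rewrite (_ : E T - E sm + (E sm - E 0) = E T - E 0); last by ring.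
  apply: le_trans; rewrite le_eqVlt; apply/orP; left; apply/eqP.
  rewrite G0 K0 /M /eta /xi /mu_ /Kx /fV -/si -/co !(mulr1, mulr0, mulrN1, sin0, cos0, cosN,
    sinN) -/si -/co.
  by clear - thn0; field.
have bE : th ^+ 2 * be = 3 / 2 * Q ^+ 2 * Kx.
  apply: (mulfI Wn0).
  transitivity (th ^+ 2 * (W th * be)); first by ring.
  rewrite ode3 -/si -/co.
  transitivity (3 / 2 * (th ^+ 2 * U th) * Kx); first by rewrite /Kx; field.
  by rewrite -QE; ring.
have rE : - 2 * r * de * th * si = - (r ^+ 2 * X ^+ 2 / G T).
  have -> : si = - (X ^+ 2 / G T * V th) by apply/eqP; rewrite -addr_eq0 [_ + _]thE.
  by rewrite /de; clear - thn0 Vn0 Gn0; field; rewrite thn0 Vn0 Gn0.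
have QG : 2 * (th ^+ 2 - Q ^+ 2) * G T = frho th * X ^+ 2.
  apply: (mulfI Wn0).
  transitivity (2 * (th ^+ 2 * W th - Q ^+ 2 * W th) * G T); first by ring.
  rewrite QE.
  transitivity (- 2 * th * (th * S th) * V th * G T); first by rewrite /fW; ring.
  have -> : th * S th = - (X ^+ 2 / G T * V th) by apply/eqP; rewrite SE -addr_eq0 [_ + _]thE.
  by rewrite /frho; clear - Wn0 Gn0; field; rewrite Wn0 Gn0.
have Z2E : Z2 T - Z2 0 = 2 * Q * t - Q ^+ 2 * G T + 3 / 2 * Q ^+ 2 * K T ^+ 2.
  transitivity (2 * Q * (A12 T - A12 0) - Q ^+ 2 * G T - 2 * Q * ga * K T - 2 / 3 * ga ^+ 2).
    by rewrite /Z2 x2T x20 tauT tau0 F2T G0 K0; clear; field.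
  by rewrite A12T /ga; clear; field.
have Z3E : Z3 T - Z3 0 = X ^+ 2 / 2 + r ^+ 2 * X ^+ 2 / G T.
  transitivity (X ^+ 2 / 2 + 2 * ka * (B13 T - B13 0) - ka ^+ 2 * G T).
    by rewrite /Z3 x3T x30 tauT tau0 FT0 G0; clear; field.
  by rewrite B13T -/r /ka; clear - Gn0; field.
have EE : E T - E 0 = 2 * c ^+ 2 - (Z2 T - Z2 0) - (Z3 T - Z3 0).
  by rewrite /E tauT tau0; clear; ring.
rewrite {}EE {}Z2E {}Z3E in HE.
have HR := fR_le hth0 hth.
have {HR} : fR th0 * t <= 4 * Q * t + frho th * X ^+ 2.
  rewrite XP mulrA [frho th * _]mulrC -mulrDl; exact: ler_wpM2r (ltW t0) _ _ HR.
(* The two surplus terms: the cost of a nonzero integral over a half, and the square completing the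
   moment terms. *)
have : - 2 * th ^+ 2 * ze * c1 >= 0.
  rewrite (_ : - 2 * th ^+ 2 * ze * c1 = (2 * th ^+ 2) * (- (ze * c1))); last by clear; ring.
  by apply: mulr_ge0; [apply: mulr_ge0 => //; exact: sqr_ge0|rewrite oppr_ge0].
have : 0 <= 3 / 2 * Q ^+ 2 * (K T - Kx) ^+ 2.
  by apply: mulr_ge0; [apply: mulr_ge0; [exact: divr_ge0|exact: sqr_ge0]|exact: sqr_ge0].
have : th ^+ 2 * G T - Q ^+ 2 * G T = frho th * X ^+ 2 / 2 by rewrite -QG; clear; field.
have : 2 * th ^+ 2 * be * K T = 3 * Q ^+ 2 * Kx * K T.
  by transitivity (2 * (th ^+ 2 * be) * K T); [|rewrite bE]; clear; field.
move: HE; rewrite bE.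
have -> : th ^+ 2 * G T - 2 * r * de * th * si = th ^+ 2 * G T + (- 2 * r * de * th * si) by
  clear; ring.
rewrite rE.
have -> : 3 / 2 * Q ^+ 2 * (K T - Kx) ^+ 2 = 3 / 2 * Q ^+ 2 * K T ^+ 2 - 3 * Q ^+ 2 * Kx * K T
  + 3 / 2 * Q ^+ 2 * Kx * Kx by clear; field.
clear; move: (r ^+ 2 * X ^+ 2 / G T) (th ^+ 2 * G T) (2 * th ^+ 2 * be * K T) (Q ^+ 2 * G T)
 (frho th * X ^+ 2) => z1 z2 z3 z4 z5; lra.
Qed.

End CalibratedLength.

(** * Reduction to the calibrated situation *)

Section LengthLowerBound.
Variable R : realType.
Local Notation mu := (@lebesgue_measure R).
Local Notation phi := (phi1 R).

Lemma rotation_exists (m1 m2 : R) : exists co si : R,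
  co ^+ 2 + si ^+ 2 = 1 /\ - si * m1 + co * m2 = 0.
Proof.
have [/eqP|m0] := eqVneq (m1 ^+ 2 + m2 ^+ 2) 0.
  rewrite paddr_eq0 ?sqr_ge0// !expf_eq0/= => /andP[/eqP -> /eqP ->].
  by exists 1, 0; split; ring.
have mp : 0 < m1 ^+ 2 + m2 ^+ 2 by rewrite lt0r m0 addr_ge0 ?sqr_ge0.
pose n := Num.sqrt (m1 ^+ 2 + m2 ^+ 2).
have n2 : n ^+ 2 = m1 ^+ 2 + m2 ^+ 2 by rewrite sqr_sqrtr ?ltW.
have n0 : n != 0 by rewrite gt_eqF// sqrtr_gt0.
exists (m1 / n), (m2 / n); split; last by field.
rewrite !expr_div_n -mulrDl n2 divff//; rewrite -n2 expf_neq0//.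
Qed.

Lemma length_lower_bound (T X t th0 : R)
    (x1 x2 x3 u1 u2 u3 t12 t13 t23 l om : R -> R) :
  0 < T -> 0 < t -> pi <= th0 < phi -> X ^+ 2 = fP th0 * t ->
  AD 0 T x1 u1 -> AD 0 T x2 u2 -> AD 0 T x3 u3 ->
  AD 0 T t12 (fun s => 2^-1 * (x1 s * u2 s - x2 s * u1 s)) ->
  AD 0 T t13 (fun s => 2^-1 * (x1 s * u3 s - x3 s * u1 s)) ->
  AD 0 T t23 (fun s => 2^-1 * (x2 s * u3 s - x3 s * u2 s)) ->
  AD 0 T l om -> (forall s, 0 <= om s) ->
  (forall s, u1 s ^+ 2 + u2 s ^+ 2 + u3 s ^+ 2 = om s ^+ 2) ->
  measurable_fun `]0, T[%classic om ->
  (\int[mu]_(s in `]0%R, T[) ((om s) ^+ 2)%:E < +oo)%E ->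
  l 0 = 0 -> x1 0 = 0 -> x2 0 = 0 -> x3 0 = 0 -> t12 0 = 0 -> t13 0 = 0 -> t23 0 = 0 ->
  x1 T = 0 -> x2 T = 0 -> x3 T = X -> t12 T = t -> t13 T = 0 -> t23 T = 0 ->
  X ^+ 2 + fR th0 * t <= l T ^+ 2.
Proof.
move=> T0 t0 hth0 XP dx1 dx2 dx3 dt12 dt13 dt23 dl om0 uom mom om2 l0
  x10 x20 x30 t120 t130 t230 x1T x2T x3T t12T t13T t23T.
have T0' := ltW T0.
have le_l x u : AD 0 T x u -> x 0 = 0 -> (forall s, u s <= om s) ->
    forall s, 0 <= s <= T -> x s <= l s.
  move=> dx x0 uo s /andP[s0 sT].
  have := AD_le s0 (AD_sub (lexx 0) sT dx) (AD_sub (lexx 0) sT dl).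
  by rewrite x0 l0 !subr0; apply; apply: aeW.
have u_le u s : u ^+ 2 <= om s ^+ 2 -> `|u| <= om s.
  by move=> H; rewrite -(@ler_pXn2r _ 2)// ?nnegrE ?om0// real_normK ?num_real.
have u1_le s : `|u1 s| <= om s.
  by apply: u_le; rewrite -uom; have := sqr_ge0 (u2 s); have := sqr_ge0 (u3 s); lra.
have u2_le s : `|u2 s| <= om s.
  by apply: u_le; rewrite -uom; have := sqr_ge0 (u1 s); have := sqr_ge0 (u3 s); lra.
(* Otherwise x1 and x2 vanish identically, and t12 cannot reach t > 0. *)
have lT0 : 0 < l T.
  rewrite ltNge; apply/negP => lT.
  have ls s : 0 <= s <= T -> l s <= 0.
    move=> /andP[s0 sT]; apply: le_trans lT.
    by apply: (AD_ge0 sT (AD_sub s0 (lexx T) dl)); apply: aeW.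
  have zero x u : AD 0 T x u -> x 0 = 0 -> (forall s, `|u s| <= om s) ->
      forall s, 0 <= s <= T -> x s = 0.
    move=> dx x0 uo s hs; apply/eqP; rewrite eq_le; apply/andP; split.
      apply: le_trans (ls s hs); apply: (le_l x u) => // r.
      exact: le_trans (ler_norm _) (uo r).
    rewrite -oppr_le0; apply: le_trans (ls s hs).
    apply: (le_l (fun r => - x r) (fun r => - u r)) => //; first exact: AD_opp.
      by rewrite x0 oppr0.
    by move=> r; apply: le_trans (ler_norm _) _; rewrite normrN.
  have z1 := zero _ _ dx1 x10 u1_le; have z2 := zero _ _ dx2 x20 u2_le.
  have := AD_eq T0' dt12 (AD_cst 0 T 0).
  rewrite t12T t120 !subr0 => H; have {H} : t = 0.
    apply: H; apply: aeW => s /andP[/ltW s0 /ltW sT].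
    by rewrite z1 ?z2 ?s0// !mul0r subr0 mulr0.
  by move=> E; rewrite E ltxx in t0.
pose c := l T / 2; have c0 : 0 < c by rewrite divr_gt0.
have cn0 := lt0r_neq0 c0.
pose w s := c^-1 * om s; pose tau s := c^-1 * l s + -1.
have dtau : AD 0 T tau w by rewrite /tau; AD_by => s _; rewrite /w; ring.
have mw : measurable_fun `]0, T[%classic w by exact: measurable_funM.
have w2 : (\int[mu]_(s in `]0%R, T[) ((w s) ^+ 2)%:E < +oo)%E.
  under eq_integral do rewrite exprMn EFinM.
  rewrite ge0_integralZl//; last 3 first.
  - by apply/measurable_EFinP/measurable_funX.
  - by move=> s _; rewrite lee_fin sqr_ge0.
  - by rewrite lee_fin sqr_ge0.
  by rewrite lte_mul_pinfty ?lee_fin ?sqr_ge0.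
have [F1 [F10 dF1]] := AD_weighted_primitive T0 dx1.1 mw w2.
have [F2 [F20 dF2]] := AD_weighted_primitive T0 dx2.1 mw w2.
(* After this rotation F2 has increment 0, so that a multiple of tau may enter the second component
   of the calibration. t12 is invariant, and (t13, t23) rotates like a vector, so that it still ends
   at 0. *)
have [co [si [cs1 cs2]]] := rotation_exists (F1 T) (F2 T).
have -> : l T ^+ 2 = 4 * c ^+ 2 by rewrite /c; field.
apply: (@calibrated_length R T c X t ((co * F1 T + si * F2 T) / 2) th0
  (fun s => co * x1 s + si * x2 s) (fun s => - si * x1 s + co * x2 s) x3
  (fun s => co * u1 s + si * u2 s) (fun s => - si * u1 s + co * u2 s) u3
  t12 (fun s => co * t13 s + si * t23 s) tau w
  (fun s => co * F1 s + si * F2 s) (fun s => - si * F1 s + co * F2 s)) => //.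
- by AD_by => s _; ring.
- by AD_by => s _; ring.
- apply: AD_ext dt12 => s _.
  transitivity (2^-1 * ((co ^+ 2 + si ^+ 2) * (x1 s * u2 s - x2 s * u1 s))); last by ring.
  by rewrite cs1 mul1r.
- by AD_by => s _; ring.
- by move=> s; rewrite mulr_ge0 ?invr_ge0 ?(ltW c0).
- move=> s; have -> : c ^+ 2 * w s ^+ 2 = om s ^+ 2 by rewrite /w; clear - cn0; field.
  rewrite -uom.
  transitivity ((co ^+ 2 + si ^+ 2) * (u1 s ^+ 2 + u2 s ^+ 2) + u3 s ^+ 2); first by ring.
  by rewrite cs1 mul1r.
- by rewrite /tau l0 mulr0 add0r.
- by rewrite /tau /c; field; rewrite gt_eqF.
- by AD_by => s _; ring.
- by AD_by => s _; ring.
- by rewrite F10 F20; field.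
- by rewrite cs2 F10 F20; ring.
- by rewrite x10 x20; ring.
- by rewrite x10 x20; ring.
- by rewrite t130 t230; ring.
- by rewrite x1T x2T; ring.
- by rewrite x1T x2T; ring.
- by rewrite t13T t23T; ring.
Qed.

End LengthLowerBound.

(** * Horizontal curves in an orthonormal frame *)

Section InnerProduct.
Variables (R : realType) (E : vectType R) (ip : {dot E for idfun}).
Implicit Types (x y z : E) (c : R).

Lemma ipC x y : ip x y = ip y x.
Proof. by rewrite (hermC ip) /= expr0 mul1r. Qed.

Lemma ipDl x y z : ip (x + y) z = ip x z + ip y z.
Proof. exact: linearDl. Qed.

Lemma ipZl c x z : ip (c *: x) z = c * ip x z.
Proof. exact: linearZl_LR. Qed.

Lemma ipDr x y z : ip z (x + y) = ip z x + ip z y.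
Proof. by rewrite ![ip z _]ipC ipDl. Qed.

Lemma ipZr c x z : ip z (c *: x) = c * ip z x.
Proof. by rewrite ![ip z _]ipC ipZl. Qed.

Lemma ip0l z : ip 0 z = 0.
Proof. by rewrite -(scale0r z) ipZl mul0r. Qed.

Lemma ip0r z : ip z 0 = 0.
Proof. by rewrite ipC ip0l. Qed.

Lemma ipNl x z : ip (- x) z = - ip x z.
Proof. by rewrite -scaleN1r ipZl mulN1r. Qed.

Lemma ipNr x z : ip z (- x) = - ip z x.
Proof. by rewrite ipC ipNl ipC. Qed.

Lemma ip_gt0 x : x != 0 -> 0 < ip x x.
Proof. exact: neq0_dnorm_gt0. Qed.

Lemma ip_ge0 x : 0 <= ip x x.
Proof. by have [->|/ip_gt0/ltW//] := eqVneq x 0; rewrite ip0l. Qed.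

Lemma ip_eq0 x : ip x x = 0 -> x = 0.
Proof. by move=> H; apply/eqP; apply: contraT => /ip_gt0; rewrite H ltxx. Qed.

Lemma nrm_ge0 x : 0 <= nrm ip x. Proof. exact: sqrtr_ge0. Qed.

Lemma nrm_sqr x : nrm ip x ^+ 2 = ip x x.
Proof. by rewrite sqr_sqrtr// ip_ge0. Qed.

Lemma nrm_eq0 x : nrm ip x = 0 -> x = 0.
Proof. by move=> H; apply: ip_eq0; rewrite -nrm_sqr H expr0n. Qed.

Lemma nrmZ c x : nrm ip (c *: x) = `|c| * nrm ip x.
Proof. by rewrite /nrm ipZl ipZr mulrA -expr2 sqrtrM ?sqr_ge0// sqrtr_sqr. Qed.

Lemma cauchy_schwarz x y : `|ip x y| <= nrm ip x * nrm ip y.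
Proof.
rewrite -(@ler_pXn2r _ 2)// ?nnegrE ?mulr_ge0 ?nrm_ge0//.
rewrite exprMn !nrm_sqr real_normK ?num_real//.
have [->|y0] := eqVneq y 0; first by rewrite !ip0r expr0n mulr0.
have yy := ip_gt0 y0.
have E1 : ip (ip y y *: x - ip x y *: y) (ip y y *: x - ip x y *: y) =
    ip y y * (ip x x * ip y y - ip x y ^+ 2).
  by rewrite ipDl !ipDr !(ipNl, ipNr) !(ipZl, ipZr) [ip y x]ipC; ring.
by have := ip_ge0 (ip y y *: x - ip x y *: y); rewrite E1 pmulr_rge0// subr_ge0.
Qed.

End InnerProduct.

Section OrthonormalFrame.
Variables (R : realType) (V : vectType R) (ip : {dot V for idfun}).
Implicit Types (e x y v : V).

Record orthonormal3 e1 e2 e3 : Prop := Orthonormal3 {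
  on11 : ip e1 e1 = 1; on22 : ip e2 e2 = 1; on33 : ip e3 e3 = 1;
  on12 : ip e1 e2 = 0; on13 : ip e1 e3 = 0; on23 : ip e2 e3 = 0 }.

Lemma orthonormal3_expand e1 e2 e3 : \dim {:V} = 3%N -> orthonormal3 e1 e2 e3 ->
  forall v, v = ip e1 v *: e1 + ip e2 v *: e2 + ip e3 v *: e3.
Proof.
move=> dim3 [h11 h22 h33 h12 h13 h23] v.
have h21 := h12; have h31 := h13; have h32 := h23.
rewrite ipC in h21; rewrite ipC in h31; rewrite ipC in h32.
pose X := [tuple e1; e2; e3].
have ipX (k : 'I_3 -> R) : let s := \sum_(i < 3) k i *: X`_i in
    [/\ ip e1 s = k (inord 0), ip e2 s = k (inord 1) & ip e3 s = k (inord 2)].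
  have i0 : inord 0 = ord0 :> 'I_3 by apply/val_inj; rewrite /= inordK.
  have i1 : inord 1 = lift ord0 ord0 :> 'I_3 by apply/val_inj; rewrite /= inordK.
  have i2 : inord 2 = lift ord0 (lift ord0 ord0) :> 'I_3 by apply/val_inj; rewrite /= inordK.
  rewrite /= i0 i1 i2 !big_ord_recl big_ord0 addr0 /=.
  by rewrite !ipDr !ipZr h11 h22 h33 h12 h13 h23 h21 h31 h32; split; ring.
have fX : free X.
  apply/freeP => k /(congr1 (fun s => (ip e1 s, ip e2 s, ip e3 s))).
  have [-> -> ->] := ipX k; rewrite !ip0r => -[k0 k1 k2].
  by case=> -[|[|[|//]]] hi; [rewrite -k0|rewrite -k1|rewrite -k2]; congr k; apply/val_inj;
    rewrite /= inordK.
have bX : basis_of fullv X by rewrite basisEfree fX subvf dim3 /=.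
have decomp (k : 'I_3 -> R) : let s := \sum_(i < 3) k i *: X`_i in
    s = ip e1 s *: e1 + ip e2 s *: e2 + ip e3 s *: e3.
  have [/= -> -> ->] := ipX k.
  rewrite !big_ord_recl big_ord0 addr0 /= addrA.
  by do 2?[congr (_ + _)]; congr (k _ *: _); apply/val_inj; rewrite /= inordK.
by have := decomp (fun i => coord X i v); rewrite /= -(coord_basis bX (memvf v)).
Qed.

Lemma orthonormal3_norm e1 e2 e3 v : \dim {:V} = 3%N -> orthonormal3 e1 e2 e3 ->
  ip v v = ip e1 v ^+ 2 + ip e2 v ^+ 2 + ip e3 v ^+ 2.
Proof.
move=> dim3 on; rewrite {1}(orthonormal3_expand dim3 on v) !ipDl !ipZl; ring.
Qed.

Lemma orthonormal3_complete e1 e2 : \dim {:V} = 3%N ->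
  ip e1 e1 = 1 -> ip e2 e2 = 1 -> ip e1 e2 = 0 -> exists e3, orthonormal3 e1 e2 e3.
Proof.
move=> dim3 h11 h22 h12.
have /subvPn[v _ vN] : ~~ (fullv <= <<[:: e1; e2]>>)%VS.
  apply/negP => /dimvS; rewrite dim3; apply/negP; rewrite -ltnNge.
  exact: leq_ltn_trans (dim_span _) _.
pose w := v - ip e1 v *: e1 - ip e2 v *: e2.
have w0 : w != 0.
  apply: contra vN => /eqP wE.
  have -> : v = ip e1 v *: e1 + ip e2 v *: e2.
    by apply/eqP; rewrite -subr_eq0 opprD addrA -/w wE.
  by rewrite memvD// memvZ// memv_span// !inE eqxx ?orbT.
have h21 := h12; rewrite ipC in h21.
have w1 : ip e1 w = 0 by rewrite /w !(ipDr, ipNr, ipZr) h11 h12; ring.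
have w2 : ip e2 w = 0 by rewrite /w !(ipDr, ipNr, ipZr) h22 h21; ring.
have nw : nrm ip w != 0.
  by apply: contra w0 => /eqP/nrm_eq0 ->.
exists ((nrm ip w)^-1 *: w); split => //.
- by rewrite ipZl ipZr -nrm_sqr; field.
- by rewrite ipZr w1 mulr0.
- by rewrite ipZr w2 mulr0.
Qed.

End OrthonormalFrame.

Section ExteriorSquare.
Variables (R : realType) (V W : vectType R) (ip : {dot V for idfun})
  (wedge : {bilinear V -> V -> W}) (ipW : {dot W for idfun}).
Hypothesis hW : is_exterior_square ip wedge ipW.
Implicit Types (x y : V) (c : R).

Lemma wedgexx x : wedge x x = 0. Proof. exact: (wedge_alternating hW). Qed.

Lemma wedgeDl x y z : wedge (x + y) z = wedge x z + wedge y z.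
Proof. exact: linearDl. Qed.

Lemma wedgeDr x y z : wedge z (x + y) = wedge z x + wedge z y.
Proof. exact: linearDr. Qed.

Lemma wedgeZl c x z : wedge (c *: x) z = c *: wedge x z.
Proof. exact: linearZl_LR. Qed.

Lemma wedgeZr c x z : wedge z (c *: x) = c *: wedge z x.
Proof. exact: linearZr_LR. Qed.

Lemma wedgeC x y : wedge x y = - wedge y x.
Proof.
apply/eqP; rewrite -addr_eq0; apply/eqP.
by have := wedgexx (x + y); rewrite wedgeDl !wedgeDr !wedgexx add0r addr0.
Qed.

Lemma wedge_combine (e1 e2 e3 : V) (a1 a2 a3 b1 b2 b3 : R) :
  wedge (a1 *: e1 + a2 *: e2 + a3 *: e3) (b1 *: e1 + b2 *: e2 + b3 *: e3) =
  (a1 * b2 - a2 * b1) *: wedge e1 e2 + (a1 * b3 - a3 * b1) *: wedge e1 e3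
  + (a2 * b3 - a3 * b2) *: wedge e2 e3.
Proof.
rewrite !wedgeDl !wedgeDr !wedgeZl !wedgeZr !wedgexx !scaler0 !add0r !addr0.
rewrite [wedge e2 e1]wedgeC [wedge e3 e1]wedgeC [wedge e3 e2]wedgeC.
rewrite !scalerN !scalerA !scalerBl.
set a := _ *: wedge e1 e2; set b := _ *: wedge e1 e3; set d := (_ * b3) *: wedge e2 e3.
by rewrite [a + b + _]addrACA -[LHS]addrA [b + d + _]addrACA -[RHS]addrA.
Qed.

Variables e1 e2 e3 : V.
Hypotheses (dim3 : \dim {:V} = 3%N) (on : orthonormal3 ip e1 e2 e3).

(** The right-hand side is linear in t and fixes all x /\ y, so it is the identity by the uniqueness
    half of the universal property. *)
Lemma wedge_expand t : t = ipW (wedge e1 e2) t *: wedge e1 e2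
  + ipW (wedge e1 e3) t *: wedge e1 e3 + ipW (wedge e2 e3) t *: wedge e2 e3.
Proof.
pose h (t : W) := ipW (wedge e1 e2) t *: wedge e1 e2
  + ipW (wedge e1 e3) t *: wedge e1 e3 + ipW (wedge e2 e3) t *: wedge e2 e3.
have hlin : linear h.
  move=> c s r; rewrite /h !ipDr !ipZr !scalerDl !scalerDr !scalerA.
  by rewrite [RHS]addrACA; congr (_ + _); exact: addrACA.
pose H := GRing.isLinear.Build R W W _ h hlin.
pose h' : {linear W -> W} := HB.pack h H.
have := wedge_factor_uniq hW (g := idfun) (h := h').
apply => x y /=.
have [h11 h22 h33 h12 h13 h23] := on.
rewrite /h !(wedge_inner hW).
rewrite {1}(orthonormal3_expand dim3 on x) {1}(orthonormal3_expand dim3 on y) wedge_combine.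
by do 2?[congr (_ + _)]; congr ((_ - _) *: _); exact: mulrC.
Qed.

End ExteriorSquare.

Section Coordinates.
Variables (R : realType) (E : vectType R) (ip : {dot E for idfun}).
Local Notation mu := (@lebesgue_measure R).

Lemma AC_coord (T : R) (f : R -> E) (e : E) : abs_continuous ip T f ->
  AC 0 T (fun s => ip e (f s)).
Proof.
move=> af d d0; have e1 : 0 < nrm ip e + 1 by rewrite ltr_wpDl// nrm_ge0.
have [r r0 H] := af (d / (nrm ip e + 1)) (divr_gt0 d0 e1).
exists r => // n p q hpq tr hs; have {}H := H n p q hpq tr hs.
apply: (@le_lt_trans _ _ ((nrm ip e + 1) * \sum_(i < n) nrm ip (f (q i) - f (p i)))).
  rewrite mulr_sumr; apply: ler_sum => i _.
  rewrite -ipNr -ipDr; apply: le_trans (cauchy_schwarz _ _ _) _.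
  by rewrite ler_wpM2r ?nrm_ge0// lerDl.
by rewrite mulrC -ltr_pdivlMr.
Qed.

Lemma is_derive_coord (f : R -> E) (s : R) (v e : E) : has_derivative ip f s v ->
  is_derive s 1 (fun r => ip e (f r)) (ip e v).
Proof.
move=> hf; apply/is_derive_epsP => d d0.
have e1 : 0 < nrm ip e + 1 by rewrite ltr_wpDl// nrm_ge0.
move/cvgrPdist_lt : hf => /(_ _ (divr_gt0 d0 e1)) [r /= r0 Hr].
exists r => // y ys; have [->|yn] := eqVneq y s.
  by rewrite !subrr mulr0 subr0 normr0 mulr0.
have hn : y - s != 0 by rewrite subr_eq0.
have := Hr (y - s); rewrite /= !sub0r !normrN => /(_ ys hn).
rewrite addrCA subrr addr0 ger0_norm ?nrm_ge0// => H.
have -> : ip e (f y) - ip e (f s) - ip e v * (y - s) =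
    ip e ((y - s)^-1 *: (f y - f s) - v) * (y - s).
  by rewrite ipDr ipNr ipZr ipDr ipNr; field.
rewrite normrM ler_wpM2r//; apply: le_trans (cauchy_schwarz _ _ _) _.
move: H; rewrite ltr_pdivlMr// => H.
have := nrm_ge0 ip ((y - s)^-1 *: (f y - f s) - v); lra.
Qed.

End Coordinates.

Section HorizontalCoordinates.
Variables (R : realType) (V W : vectType R) (ip : {dot V for idfun})
  (wedge : {bilinear V -> V -> W}) (ipW : {dot W for idfun}).
Hypothesis hW : is_exterior_square ip wedge ipW.
Hypothesis dim3 : \dim {:V} = 3%N.
Local Notation mu := (@lebesgue_measure R).
Variables (T : R) (gamma : R -> F3 V W) (u : R -> V).
Hypotheses (T0 : 0 < T) (hor : horizontal ip wedge ipW T gamma u).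

Lemma horizontal_AD_x (e : V) :
  AD 0 T (fun s => ip e (gamma s).1) (fun s => ip e (u s)).
Proof.
have [[ax _] _ _ dx _] := hor; split; first exact: AC_coord ax.
by apply: ae_imp dx => s H /H; exact: is_derive_coord.
Qed.

Lemma horizontal_AD_t (e f : V) :
  AD 0 T (fun s => ipW (wedge e f) (gamma s).2)
    (fun s => 2^-1 * (ip e (gamma s).1 * ip f (u s) - ip f (gamma s).1 * ip e (u s))).
Proof.
have [_ [at_ _] _ _ dt] := hor; split; first exact: AC_coord at_.
apply: ae_imp dt => s H /H /(is_derive_coord (wedge e f)).
rewrite ipZr (wedge_inner hW) => D; apply: (is_derive1_eq D).
by congr (_ * (_ - _)); exact: mulrC.
Qed.

Lemma control_norm_measurable e1 e2 e3 : orthonormal3 ip e1 e2 e3 ->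
  measurable_fun `]0, T[%classic (fun s => nrm ip (u s)).
Proof.
move=> on; have [_ _ [mu_ _] _ _] := hor.
have -> : (fun s => nrm ip (u s)) = (fun s => Num.sqrt (ip e1 (u s) ^+ 2 + ip e2 (u s) ^+ 2 +
  ip e3 (u s) ^+ 2)).
  by apply/funext => s; rewrite /nrm (orthonormal3_norm _ dim3 on).
apply: (measurableT_comp (f := @Num.sqrt R)).
  by apply: continuous_measurable_fun; exact: sqrt_continuous.
by do 2?[apply: measurable_funD]; apply: measurable_funX.
Qed.

Lemma horizontal_length e1 e2 e3 : orthonormal3 ip e1 e2 e3 ->
  exists l, [/\ l 0 = 0, AD 0 T l (fun s => nrm ip (u s)) &
    curve_length ip u T = (l T)%:E].
Proof.
move=> on; have [_ _ [_ u2] _ _] := hor.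
by have [l [l0 dl lT]] := AD_prim T0 (control_norm_measurable on) u2; exists l.
Qed.

(** Cauchy-Schwarz against x, integrated along the curve; it settles the straight extremals, those
    with lambda = 0. *)
Lemma curve_length_ge e1 e2 e3 (x : V) : orthonormal3 ip e1 e2 e3 ->
  (gamma 0).1 = 0 -> (gamma T).1 = x -> ((nrm ip x)%:E <= curve_length ip u T)%E.
Proof.
move=> on g0 gT; have [l [l0 dl ->]] := horizontal_length on; rewrite lee_fin.
have [->|x0] := eqVneq (nrm ip x) 0.
  have -> : 0 = l 0 by [].
  by apply: (AD_ge0 (ltW T0) dl); apply: aeW => s _; exact: nrm_ge0.
have xp : 0 < nrm ip x by rewrite lt0r x0 nrm_ge0.
rewrite -(ler_pM2l xp) -expr2.
have := AD_le (ltW T0) (horizontal_AD_x x) (AD_sc (nrm ip x) dl).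
rewrite g0 gT l0 ip0r mulr0 !subr0 -nrm_sqr; apply; apply: aeW => s _.
exact: le_trans (ler_norm _) (cauchy_schwarz _ _ _).
Qed.

Lemma horizontal_length_bound e1 e2 e3 (X t th : R) (x : V) (r : W) :
  orthonormal3 ip e1 e2 e3 -> 0 < t -> pi <= th < phi1 R -> X ^+ 2 = fP th * t ->
  x = X *: e3 -> r = t *: wedge e1 e2 ->
  gamma 0 = (0, 0) -> gamma T = (x, r) ->
  exists2 l, 0 <= l & curve_length ip u T = l%:E /\ X ^+ 2 + fR th * t <= l ^+ 2.
Proof.
move=> on t0 hth XP xE rE g0 gT; have [l [l0 dl lT]] := horizontal_length on.
have [h11 h22 h33 h12 h13 h23] := on.
have [_ _ [_ u2] _ _] := hor.
have h21 := h12; rewrite ipC in h21; have h31 := h13; rewrite ipC in h31.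
have h32 := h23; rewrite ipC in h32.
exists (l T).
  have -> : 0 = l 0 by [].
  by apply: (AD_ge0 (ltW T0) dl); apply: aeW => s _; exact: nrm_ge0.
split=> //; apply: (length_lower_bound T0 t0 hth XP (horizontal_AD_x e1) (horizontal_AD_x e2)
  (horizontal_AD_x e3) (horizontal_AD_t e1 e2) (horizontal_AD_t e1 e3) (horizontal_AD_t e2 e3)
    dl);
  rewrite ?g0 ?gT /= ?ip0r// ?xE ?rE ?ipZr ?(wedge_inner hW) ?h11 ?h22 ?h33 ?h12 ?h13 ?h23 ?h21
    ?h31 ?h32;
  try ring.
- by move=> s; exact: nrm_ge0.
- by move=> s; rewrite nrm_sqr (orthonormal3_norm _ dim3 on).
- exact: control_norm_measurable on.
Qed.

End HorizontalCoordinates.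

(** * Extremals at and beyond the cut point *)

Section CutPoint.
Variable R : realType.
Local Notation S := (@fS R).
Local Notation U := (@fU R).
Local Notation V := (@fV R).
Local Notation W := (@fW R).
Local Notation phi := (phi1 R).

(** The expression is the determinant of the two linear conditions on (ka, si) in [tilt_exists]. It
    is nonnegative at pi, where S = 0, and negative at phi1, where V = 0. *)
Lemma balance_angle_exists (rho ze : R) : 0 < rho ->
  exists2 th, pi <= th < phi & S th * U th * rho ^+ 2 + V th * ze ^+ 2 = 0.
Proof.
move=> r0; have [p1 p2 p3 _] := phi1P R; have p0 := pi_gt0 R.
have Vphi : V phi = 0 by rewrite /fV p3 mul0r.
have phi0 : 0 < phi by exact: lt_trans p1.
have Sphi : S phi < 0.
  by rewrite /fS pmulr_llt0 ?invr_gt0//; apply: sin32_lt0; rewrite p1 ltW.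
have Uphi : 0 < U phi by apply: fU_gt0; apply: cut_angle_ge2; exact: ltW.
have Ephi : S phi * U phi * rho ^+ 2 + V phi * ze ^+ 2 < 0.
  by rewrite Vphi mul0r addr0 pmulr_llt0 ?exprn_gt0// pmulr_llt0.
have [||th /andP[t1 t2] tE] := @is_derive_IVT R pi phi
   (fun x => S x * U x * rho ^+ 2 + V x * ze ^+ 2)
   (fun x => (- 2 * V x * U x + S x * (S x ^+ 2 / 2 - 2 * U x / x)) * rho ^+ 2
      + (S x / 2 - 2 * V x / x) * ze ^+ 2) (ltW p1).
- move=> y /andP[y1 _].
  have yn0 : y != 0 by have := cut_angle_ge2 y1; rewrite gt_eqF//; lra.
  have dV := is_derive_fV yn0; have dS := is_derive_fS yn0; have dU := is_derive_fU yn0.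
  by derive_by; ring.
- rewrite mulr_ge0_le0 ?(ltW Ephi)// {1}/fS sinpi !mul0r add0r mulr_ge0 ?sqr_ge0//.
  by rewrite ltW// fV_gt0// lexx p1.
exists th => //; rewrite t1 lt_neqAle t2 andbT; apply/eqP => E.
by move: tE; rewrite E => E'; rewrite E' ltxx in Ephi.
Qed.

(** (ka, si) are the cosine and sine of the tilt, normalized by W = U - S V. The condition with S
    makes the first control component have mean zero up to the cut time, the one with U and V makes
    t23 vanish there; S <= 0 forces si <= 0. *)
Lemma tilt_exists (rho ze th : R) : 0 < rho -> 0 <= ze -> pi <= th < phi ->
  S th * U th * rho ^+ 2 + V th * ze ^+ 2 = 0 -> exists ka si : R,
  [/\ 0 < ka, si ^+ 2 + ka ^+ 2 = 1, ka * rho * S th = si * ze,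
      rho * si * U th + ka * ze * V th = 0 & ka = Num.sqrt (U th / W th)].
Proof.
move=> r0 z0 h E; have W0 := fW_gt0 h; have V0 := fV_gt0 h.
have h' : pi <= th <= phi by case/andP: h => -> /ltW.
have t2 : 2 <= th by case/andP: h => h _; exact: cut_angle_ge2.
have U0 := fU_gt0 t2; have S0 := fS_le0 h'.
have WE : W th = U th - S th * V th by [].
pose ka := Num.sqrt (U th / W th).
have k0 : 0 < ka by rewrite sqrtr_gt0 divr_gt0.
have k2 : ka ^+ 2 * W th = U th by rewrite sqr_sqrtr ?divfK ?lt0r_neq0// divr_ge0// ltW.
have sv : 0 <= - (S th * V th) / W th.
  by rewrite divr_ge0 ?(ltW W0)// oppr_ge0 mulr_le0_ge0// ltW.
pose sq := Num.sqrt (- (S th * V th) / W th).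
have s0 : 0 <= sq := sqrtr_ge0 _.
have s2 : sq ^+ 2 * W th = - (S th * V th).
  by rewrite sqr_sqrtr// divfK ?lt0r_neq0.
have eq_sqr (x y : R) : 0 <= x -> 0 <= y -> x ^+ 2 = y ^+ 2 -> x = y.
  by move=> x0 y0 /eqP; rewrite eqrXn2// => /eqP.
exists ka, (- sq); split => //.
- apply: (mulIf (lt0r_neq0 W0)); rewrite sqrrN mulrDl k2 s2 mul1r WE; ring.
- rewrite mulNr; apply: oppr_inj; rewrite opprK; apply: eq_sqr.
  + by rewrite oppr_ge0 mulr_ge0_le0// mulr_ge0// ltW.
  + by rewrite mulr_ge0.
  + rewrite sqrrN; apply: (mulIf (lt0r_neq0 W0)).
    transitivity ((ka ^+ 2 * W th) * rho ^+ 2 * S th ^+ 2); first by ring.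
    transitivity ((sq ^+ 2 * W th) * ze ^+ 2); last by ring.
    rewrite k2 s2; transitivity (S th * (S th * U th * rho ^+ 2)); first by ring.
    by rewrite -[S th * U th * _](addrK (V th * ze ^+ 2)) E; ring.
- rewrite mulrN mulNr; apply/eqP; rewrite addrC subr_eq0; apply/eqP; apply: eq_sqr.
  + by apply: mulr_ge0; [apply: mulr_ge0 => //|]; exact: ltW.
  + by apply: mulr_ge0; [apply: mulr_ge0 => //|]; exact: ltW.
  + apply: (mulIf (lt0r_neq0 W0)).
    transitivity ((ka ^+ 2 * W th) * ze ^+ 2 * V th ^+ 2); first by ring.
    transitivity ((sq ^+ 2 * W th) * rho ^+ 2 * U th ^+ 2); last by ring.
    rewrite k2 s2; transitivity (U th * V th * (V th * ze ^+ 2)); first by ring.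
    by rewrite -[V th * ze ^+ 2](addKr (S th * U th * rho ^+ 2)) E; ring.
Qed.

(** The vector T (rho S, ze) has the coordinates X and ka rho S - si ze = 0 in the tilted frame,
    whence X^2. The last value is the square of the length, since rho^2 + ze^2 is the squared
    speed. *)
Lemma cut_point_values (rho ze th ka si T : R) : 0 < rho -> 0 <= ze -> pi <= th < phi ->
  S th * U th * rho ^+ 2 + V th * ze ^+ 2 = 0 ->
  si ^+ 2 + ka ^+ 2 = 1 -> ka * rho * S th = si * ze -> ka = Num.sqrt (U th / W th) ->
  let X := T * (si * rho * S th + ka * ze) in let t := ka * rho ^+ 2 * T ^+ 2 * W th in
  X ^+ 2 = fP th * t /\ X ^+ 2 + fR th * t = T ^+ 2 * (rho ^+ 2 + ze ^+ 2).
Proof.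
move=> r0 z0 h E sk kS kE; have W0 := fW_gt0 h; have V0 := fV_gt0 h.
have t2 : 2 <= th by case/andP: h => h _; exact: cut_angle_ge2.
have U0 := fU_gt0 t2.
have k0 : 0 < ka by rewrite kE sqrtr_gt0 divr_gt0.
have kn0 := lt0r_neq0 k0; have Vn0 := lt0r_neq0 V0; have Wn0 := lt0r_neq0 W0.
have WE : W th = U th - S th * V th by [].
have UE : U th = ka ^+ 2 * W th by rewrite kE sqr_sqrtr ?divfK// divr_ge0// ltW.
move=> X t.
have XE : X ^+ 2 = T ^+ 2 * (S th ^+ 2 * rho ^+ 2 + ze ^+ 2).
  transitivity (T ^+ 2 * ((si ^+ 2 + ka ^+ 2) * (rho ^+ 2 * S th ^+ 2 + ze ^+ 2)
     - (ka * rho * S th - si * ze) ^+ 2)); first by rewrite /X; ring.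
  by rewrite sk kS; ring.
have RE : fR th * t = (1 - S th ^+ 2) * rho ^+ 2 * T ^+ 2.
  rewrite /fR /t; have -> : Num.sqrt (U th * W th) = ka * W th.
    rewrite UE; have -> : ka ^+ 2 * W th * W th = (ka * W th) ^+ 2 by ring.
    by rewrite sqrtr_sqr gtr0_norm// mulr_gt0.
  by field; rewrite kn0 Wn0.
split; last by rewrite XE RE; ring.
rewrite fP_E// -kE XE /t.
have zE : ze ^+ 2 = - (S th / V th) * U th * rho ^+ 2.
  apply: (mulfI Vn0); rewrite -[LHS](addKr (S th * U th * rho ^+ 2)) E.
  by field.
by rewrite zE WE; field; rewrite kn0 Vn0.
Qed.

End CutPoint.

(** * Gluing two curves at a corner *)

Section Gluing.
Variable R : realType.
Local Notation mu := (@lebesgue_measure R).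

(** Every interval is cut at b into a part [lo] in [a, b] and a part [up] in [b, c], one of which
    may be degenerate. *)
Lemma AC_glue (a b c : R) (F : R -> R) : a <= b -> b <= c ->
  AC a b F -> AC b c F -> AC a c F.
Proof.
move=> ab bc H1 H2 e e0; have e2 : 0 < e / 2 by rewrite divr_gt0.
have [d1 d10 D1] := H1 _ e2; have [d2 d20 D2] := H2 _ e2.
exists (Num.min d1 d2); first by rewrite lt_min d10.
move=> n p q hpq tr; rewrite lt_min => /andP[s1 s2].
pose lo (f : 'I_n -> R) i := Num.min (f i) b; pose up (f : 'I_n -> R) i := Num.max (f i) b.
have cases i : [/\ lo p i <= lo q i, up p i <= up q i,
    lo q i - lo p i <= q i - p i, up q i - up p i <= q i - p i &
    `|F (q i) - F (p i)| <= `|F (lo q i) - F (lo p i)| + `|F (up q i) - F (up p i)|].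
  have [/andP[_ pq] _] := hpq i; rewrite /lo /up.
  have [qb|bq] := leP (q i) b; have [pb|bp] := leP (p i) b.
  - by split; rewrite ?subrr ?normr0 ?addr0 ?subr_ge0 ?lexx.
  - by have := lt_le_trans bp (le_trans pq qb); rewrite ltxx.
  - split; [exact: pb|exact: ltW|lra|lra|].
    by rewrite [leRHS]addrC; exact: ler_distD.
  - by split; rewrite ?subrr ?normr0 ?add0r ?subr_ge0 ?lexx.
have L : \sum_(i < n) `|F (lo q i) - F (lo p i)| < e / 2.
  apply: D1.
  - move=> i; have [h _ _ _ _] := cases i; have [/andP[ap pq] qc] := hpq i.
    by rewrite h /lo ge_min lexx orbT le_min ap ab.
  - apply/trivIsetP => i j _ _ ij; move/trivIsetP : tr => /(_ i j I I ij) tr.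
    rewrite -subset0 => x /= []; rewrite !in_itv/= /lo !lt_min !gt_min =>
      /andP[/orP[] h1 /andP[h2 h3]] /andP[/orP[] h4 /andP[h5 h6]]; 
      try by [have := lt_trans h1 h3; rewrite ltxx|have := lt_trans h4 h6; rewrite ltxx].
    by have : set0 x by rewrite -tr; split; rewrite /= in_itv/= ?h1 ?h2 ?h4 ?h5.
  - apply: le_lt_trans s1; apply: ler_sum => i _; by have [] := cases i.
have U : \sum_(i < n) `|F (up q i) - F (up p i)| < e / 2.
  apply: D2.
  - move=> i; have [_ h _ _ _] := cases i; have [/andP[ap pq] qc] := hpq i.
    by rewrite h /up le_max lexx orbT ge_max qc bc.
  - apply/trivIsetP => i j _ _ ij; move/trivIsetP : tr => /(_ i j I I ij) tr.
    rewrite -subset0 => x /= []; rewrite !in_itv/= /up !gt_max !lt_max =>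
      /andP[/andP[h2 h3] /orP[] h1] /andP[/andP[h5 h6] /orP[] h4];
      try by [have := lt_trans h1 h3; rewrite ltxx|have := lt_trans h4 h6; rewrite ltxx].
    by have : set0 x by rewrite -tr; split; rewrite /= in_itv/= ?h1 ?h2 ?h4 ?h5.
  - apply: le_lt_trans s2; apply: ler_sum => i _; by have [] := cases i.
apply: (@le_lt_trans _ _ (\sum_(i < n) (`|F (lo q i) - F (lo p i)| + `|F (up q i) - F (up p
  i)|))).
  by apply: ler_sum => i _; have [] := cases i.
rewrite big_split/=; lra.
Qed.

Lemma is_derive_local (F G : R -> R) (s d r : R) : 0 < r ->
  (forall y, `|y - s| < r -> F y = G y) -> is_derive s 1 G d -> is_derive s 1 F d.
Proof.
move=> r0 FG /is_derive_epsP H; apply/is_derive_epsP => e e0.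
have [r' r'0 Hr] := H e e0; exists (Num.min r r'); first by rewrite lt_min r0.
move=> y; rewrite lt_min => /andP[y1 y2]; rewrite !FG ?subrr ?normr0//; exact: Hr.
Qed.

Definition glue (b : R) (F1 F2 : R -> R) s := if s <= b then F1 s else F2 s.

Lemma AC_eq (a b : R) (F G : R -> R) : (forall s, a <= s <= b -> F s = G s) ->
  AC a b F -> AC a b G.
Proof.
move=> E H e e0; have [d d0 D] := H e e0; exists d => // n p q hpq tr hs.
rewrite (eq_bigr (fun i => `|F (q i) - F (p i)|)); first exact: D.
by move=> i _; have [/andP[ap pq] qb] := hpq i; rewrite !E// ?ap ?(le_trans pq qb)// (le_trans
  ap pq) qb.
Qed.

Lemma AD_glue (a b c : R) (F1 F2 f1 f2 : R -> R) : a <= b -> b <= c -> F1 b = F2 b ->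
  AD a b F1 f1 -> AD b c F2 f2 -> AD a c (glue b F1 F2) (glue b f1 f2).
Proof.
move=> ab bc E [A1 D1] [A2 D2]; split.
  apply: (AC_glue ab bc).
    by apply: (AC_eq _ A1) => s /andP[_ sb]; rewrite /glue sb.
  apply: (AC_eq _ A2) => s /andP[bs _]; rewrite /glue; case: ifPn => // sb.
  by have -> : s = b by apply/eqP; rewrite eq_le sb bs.
have Nb : {ae mu, forall s, s <> b}.
  exists [set b]; split => //; first exact: lebesgue_measure_set1.
  by move=> s /= /contrapT.
apply: ae_imp2 Nb (ae_imp2 (fun s => @conj _ _) D1 D2) => s sb [H1 H2] /andP[as_ sc].
rewrite /glue; case: ifPn => [s_b|].
  have lsb : s < b by rewrite lt_neqAle s_b andbT; apply/eqP.
  apply: (@is_derive_local _ F1 s _ (b - s)); rewrite ?subr_gt0//.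
    by move=> y /ltr_normlW; rewrite ltrD2r => /ltW ->.
  by apply: H1; rewrite as_.
rewrite -ltNge => bs.
apply: (@is_derive_local _ F2 s _ (s - b)); rewrite ?subr_gt0//.
  move=> y; rewrite distrC => /ltr_normlW; rewrite ltrD2l ltrN2 => yb.
  by rewrite leNgt yb.
by apply: H2; rewrite bs.
Qed.

Lemma glue_measurable (a b c : R) (f1 f2 : R -> R) : 
  measurable_fun setT f1 -> measurable_fun setT f2 ->
  measurable_fun `]a, c[%classic (glue b f1 f2).
Proof.
move=> m1 m2; apply: (measurable_funS measurableT) => //.
rewrite /glue; apply: measurable_fun_ifT => //.
by apply: measurable_fun_ler.
Qed.

(** The polynomial k (s - p)^3 (s - q)^4, with k normalizing the third derivative at p. For p the
    corner and q the far end of a side, b3 + la^2 b1 is 1 at p and 0 at q, while b0, b1, b2 leave no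
    boundary terms. *)
Lemma bump_exists (p q : R) : p != q -> exists b0 b1 b2 b3 b4 : R -> R,
  [/\ [/\ forall y : R, is_derive y 1 b0 (b1 y), forall y : R, is_derive y 1 b1 (b2 y),
          forall y : R, is_derive y 1 b2 (b3 y), forall y : R, is_derive y 1 b3 (b4 y) &
          forall y : R, exists d, is_derive y 1 b4 d],
      [/\ b0 p = 0, b1 p = 0, b2 p = 0 & b3 p = 1] &
      [/\ b0 q = 0, b1 q = 0, b2 q = 0 & b3 q = 0]].
Proof.
move=> pq; have n0 : p - q != 0 by rewrite subr_eq0.
pose k := (6 * (p - q) ^+ 4)^-1.
exists (fun s => k * ((s - p) ^+ 3 * (s - q) ^+ 4)),
  (fun s => k * (3 * (s - p) ^+ 2 * (s - q) ^+ 4 + 4 * (s - p) ^+ 3 * (s - q) ^+ 3)),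
  (fun s => k * (6 * (s - p) * (s - q) ^+ 4 + 24 * (s - p) ^+ 2 * (s - q) ^+ 3 + 12 * (s - p)
    ^+ 3 * (s - q) ^+ 2)),
  (fun s => k * (6 * (s - q) ^+ 4 + 72 * (s - p) * (s - q) ^+ 3 + 108 * (s - p) ^+ 2 * (s - q)
    ^+ 2
    + 24 * (s - p) ^+ 3 * (s - q))),
  (fun s => k * (96 * (s - q) ^+ 3 + 432 * (s - p) * (s - q) ^+ 2 + 288 * (s - p) ^+ 2 * (s - q)
    + 24 * (s - p) ^+ 3)).
split; split; try (by move=> y; derive_by; ring); try ring.
- by move=> y; eexists; derive_rules.
- by rewrite /k; field.
Qed.

End Gluing.

Lemma subr_add3 (Z : zmodType) (a1 a2 a3 b1 b2 b3 : Z) :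
  a1 + a2 + a3 - (b1 + b2 + b3) = (a1 - b1) + (a2 - b2) + (a3 - b3).
Proof. by rewrite !opprD addrACA [a1 + a2 + _]addrACA. Qed.

Section Builder.
Variables (R : realType) (E : vectType R) (ip : {dot E for idfun}).
Local Notation mu := (@lebesgue_measure R).
Variables (w1 w2 w3 : E).
Hypothesis on : orthonormal3 ip w1 w2 w3.
Implicit Types (c : R) (x : R -> R).

Definition combine x1 x2 x3 (s : R) : E := x1 s *: w1 + x2 s *: w2 + x3 s *: w3.

Lemma combine_nrm2 (c1 c2 c3 : R) : 
  nrm ip (c1 *: w1 + c2 *: w2 + c3 *: w3) ^+ 2 = c1 ^+ 2 + c2 ^+ 2 + c3 ^+ 2.
Proof.
have [h11 h22 h33 h12 h13 h23] := on.
rewrite nrm_sqr !(ipDl, ipDr) !(ipZl, ipZr) [ip w2 w1]ipC [ip w3 w1]ipC [ip w3 w2]ipC.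
by rewrite h11 h22 h33 h12 h13 h23; ring.
Qed.

Lemma combine_nrm_le (c1 c2 c3 : R) :
  nrm ip (c1 *: w1 + c2 *: w2 + c3 *: w3) <= `|c1| + `|c2| + `|c3|.
Proof.
rewrite -(@ler_pXn2r _ 2)// ?nnegrE ?nrm_ge0 ?addr_ge0// combine_nrm2.
rewrite -[c1 ^+ 2]real_normK ?num_real// -[c2 ^+ 2]real_normK ?num_real// -[c3 ^+ 2]real_normK
  ?num_real//.
have := normr_ge0 c1; have := normr_ge0 c2; have := normr_ge0 c3; nra.
Qed.

Lemma combine_abs_continuous (T : R) x1 x2 x3 :
  AC 0 T x1 -> AC 0 T x2 -> AC 0 T x3 -> abs_continuous ip T (combine x1 x2 x3).
Proof.
move=> a1 a2 a3 e e0; have e3 : 0 < e / 3 by rewrite divr_gt0.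
have [d1 d10 D1] := a1 _ e3; have [d2 d20 D2] := a2 _ e3; have [d3 d30 D3] := a3 _ e3.
exists (Num.min d1 (Num.min d2 d3)); first by rewrite !lt_min d10 d20.
move=> n p q hpq tr; rewrite !lt_min => /and3P[s1 s2 s3].
apply: (@le_lt_trans _ _ (\sum_(i < n) `|x1 (q i) - x1 (p i)| + \sum_(i < n) `|x2 (q i) - x2 (p
  i)|
   + \sum_(i < n) `|x3 (q i) - x3 (p i)|)).
  rewrite -!big_split/=; apply: ler_sum => i _.
  by apply: le_trans (combine_nrm_le _ _ _); rewrite /combine subr_add3 -!scalerBl.
have := D1 n p q hpq tr s1; have := D2 n p q hpq tr s2; have := D3 n p q hpq tr s3; lra.
Qed.

Lemma combine_has_derivative x1 x2 x3 (s d1 d2 d3 : R) :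
  is_derive s 1 x1 d1 -> is_derive s 1 x2 d2 -> is_derive s 1 x3 d3 ->
  has_derivative ip (combine x1 x2 x3) s (d1 *: w1 + d2 *: w2 + d3 *: w3).
Proof.
move=> /is_derive_epsP H1 /is_derive_epsP H2 /is_derive_epsP H3.
apply/cvgrPdist_lt => e e0; have e4 : 0 < e / 4 by rewrite divr_gt0.
have [r1 r10 D1] := H1 _ e4; have [r2 r20 D2] := H2 _ e4; have [r3 r30 D3] := H3 _ e4.
exists (Num.min r1 (Num.min r2 r3)) => /=; first by rewrite !lt_min r10 r20.
move=> h /=; rewrite sub0r normrN !lt_min => /and3P[h1 h2 h3] h0.
rewrite sub0r normrN ger0_norm ?nrm_ge0//.
have quot (x : R -> R) (d r : R) : `|h| < r ->
    (forall y, `|y - s| < r -> `|x y - x s - d * (y - s)| <= e / 4 * `|y - s|) ->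
    `|h^-1 * (x (s + h) - x s) - d| <= e / 4.
  move=> hr /(_ (s + h)); rewrite addrAC subrr add0r => /(_ hr) H.
  have -> : h^-1 * (x (s + h) - x s) - d = h^-1 * (x (s + h) - x s - d * h) by field.
  by rewrite normrM normfV ler_pdivrMl ?normr_gt0// [leRHS]mulrC.
have := quot _ _ _ h1 D1; have := quot _ _ _ h2 D2; have := quot _ _ _ h3 D3.
set k1 := h^-1 * _ - d1; set k2 := h^-1 * _ - d2; set k3 := h^-1 * _ - d3 => q3 q2 q1.
have -> : h^-1 *: (combine x1 x2 x3 (s + h) - combine x1 x2 x3 s) - (d1 *: w1 + d2 *: w2 + d3
  *: w3)
    = k1 *: w1 + k2 *: w2 + k3 *: w3.
  have -> : combine x1 x2 x3 (s + h) - combine x1 x2 x3 s =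
      (x1 (s + h) - x1 s) *: w1 + (x2 (s + h) - x2 s) *: w2 + (x3 (s + h) - x3 s) *: w3.
    by rewrite /combine subr_add3 -!scalerBl.
  by rewrite !scalerDr !scalerA subr_add3 -!scalerBl.
apply: le_lt_trans (combine_nrm_le _ _ _) _; lra.
Qed.

Lemma combine_in_L2 (T K : R) x1 x2 x3 : 0 < T ->
  measurable_fun `]0, T[%classic x1 -> measurable_fun `]0, T[%classic x2 ->
  measurable_fun `]0, T[%classic x3 ->
  (forall s, 0 < s < T -> [/\ `|x1 s| <= K, `|x2 s| <= K & `|x3 s| <= K]) ->
  in_L2 ip T (combine x1 x2 x3).
Proof.
move=> T0 m1 m2 m3 hK; split.
  move=> e; rewrite /combine.
  have -> : (fun s => ip e (x1 s *: w1 + x2 s *: w2 + x3 s *: w3)) =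
      (fun s => x1 s * ip e w1 + x2 s * ip e w2 + x3 s * ip e w3).
    by apply/funext => s; rewrite !ipDr !ipZr.
  by do 2?[apply: measurable_funD]; apply: measurable_funM.
have -> : (fun s => (nrm ip (combine x1 x2 x3 s) ^+ 2)%:E) =
    (fun s => (x1 s ^+ 2 + x2 s ^+ 2 + x3 s ^+ 2)%:E).
  by apply/funext => s; rewrite /combine combine_nrm2.
apply: (@le_lt_trans _ _ (\int[mu]_(s in `]0%R, T[) (3 * K ^+ 2)%:E)%E).
  apply: ge0_le_integral => //.
  - by move=> s _; rewrite lee_fin !addr_ge0 ?sqr_ge0.
  - by apply/measurable_EFinP; do 2?[apply: measurable_funD]; apply: measurable_funX.
  - move=> s; rewrite /= in_itv/= lee_fin => /hK[k1 k2 k3].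
    have sq (c : R) : `|c| <= K -> c ^+ 2 <= K ^+ 2.
      move=> h; rewrite -[c ^+ 2]real_normK ?num_real// lerXn2r ?nnegrE//.
      exact: le_trans h.
    have := sq _ k1; have := sq _ k2; have := sq _ k3; lra.
rewrite integral_cst//= lebesgue_measure_itv/= lte_fin T0 -EFinB -EFinM; exact: ltry.
Qed.

End Builder.

Section HorizontalBuilder.
Variables (R : realType) (V W : vectType R) (ip : {dot V for idfun})
  (wedge : {bilinear V -> V -> W}) (ipW : {dot W for idfun}).
Hypothesis hW : is_exterior_square ip wedge ipW.
Variables e1 e2 e3 : V.
Hypothesis on : orthonormal3 ip e1 e2 e3.
Local Notation mu := (@lebesgue_measure R).

Lemma wedge_orthonormal3 : orthonormal3 ipW (wedge e1 e2) (wedge e1 e3) (wedge e2 e3).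
Proof.
have [h11 h22 h33 h12 h13 h23] := on.
have h21 := h12; rewrite ipC in h21; have h31 := h13; rewrite ipC in h31.
have h32 := h23; rewrite ipC in h32.
by split; rewrite (wedge_inner hW) ?h11 ?h22 ?h33 ?h12 ?h13 ?h23 ?h21 ?h31 ?h32; ring.
Qed.

Lemma horizontal_build (T K : R) (x1 x2 x3 u1 u2 u3 t12 t13 t23 : R -> R) : 0 < T ->
  AD 0 T x1 u1 -> AD 0 T x2 u2 -> AD 0 T x3 u3 ->
  AD 0 T t12 (fun s => 2^-1 * (x1 s * u2 s - x2 s * u1 s)) ->
  AD 0 T t13 (fun s => 2^-1 * (x1 s * u3 s - x3 s * u1 s)) ->
  AD 0 T t23 (fun s => 2^-1 * (x2 s * u3 s - x3 s * u2 s)) ->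
  measurable_fun `]0, T[%classic u1 -> measurable_fun `]0, T[%classic u2 ->
  measurable_fun `]0, T[%classic u3 ->
  (forall s, 0 < s < T -> [/\ `|u1 s| <= K, `|u2 s| <= K & `|u3 s| <= K]) ->
  horizontal ip wedge ipW T
    (fun s => (combine e1 e2 e3 x1 x2 x3 s,
       combine (wedge e1 e2) (wedge e1 e3) (wedge e2 e3) t12 t13 t23 s))
    (combine e1 e2 e3 u1 u2 u3).
Proof.
move=> T0 d1 d2 d3 d12 d13 d23 m1 m2 m3 uK.
have onW := wedge_orthonormal3.
have uL2 := combine_in_L2 on T0 m1 m2 m3 uK.
have dx : {ae mu, forall s, 0 < s < T ->
    has_derivative ip (combine e1 e2 e3 x1 x2 x3) s (combine e1 e2 e3 u1 u2 u3 s)}.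
  have := ae_imp2 (fun s => @conj _ _) d1.2 (ae_imp2 (fun s => @conj _ _) d2.2 d3.2).
  by apply: ae_imp => s [h1 [h2 h3]] hs; apply: combine_has_derivative; auto.
pose v12 s := 2^-1 * (x1 s * u2 s - x2 s * u1 s).
pose v13 s := 2^-1 * (x1 s * u3 s - x3 s * u1 s).
pose v23 s := 2^-1 * (x2 s * u3 s - x3 s * u2 s).
pose vt := combine (wedge e1 e2) (wedge e1 e3) (wedge e2 e3) v12 v13 v23.
have dt : {ae mu, forall s, 0 < s < T -> has_derivative ipW
    (combine (wedge e1 e2) (wedge e1 e3) (wedge e2 e3) t12 t13 t23) s (vt s)}.
  have := ae_imp2 (fun s => @conj _ _) d12.2 (ae_imp2 (fun s => @conj _ _) d13.2 d23.2).
  by apply: ae_imp => s [h1 [h2 h3]] hs; apply: combine_has_derivative; auto.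
have vtE s : vt s = 2^-1 *: wedge (combine e1 e2 e3 x1 x2 x3 s) (combine e1 e2 e3 u1 u2 u3 s).
  rewrite /vt /combine /v12 /v13 /v23.
  by rewrite (wedge_combine hW) !scalerDr !scalerA.
have [Kx1 _ HK1] := AC_bounded (ltW T0) d1.1.
have [Kx2 _ HK2] := AC_bounded (ltW T0) d2.1.
have [Kx3 _ HK3] := AC_bounded (ltW T0) d3.1.
split => //=.
- split; first exact: combine_abs_continuous d1.1 d2.1 d3.1.
  by exists (combine e1 e2 e3 u1 u2 u3).
- split; first exact: combine_abs_continuous d12.1 d13.1 d23.1.
  exists vt => //.
  have mx x u : AD 0 T x u -> measurable_fun `]0, T[%classic x by move=> [h _];
    exact: AC_measurable.
  have hm x y u v : AD 0 T x u -> AD 0 T y v -> measurable_fun `]0, T[%classic u ->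
     measurable_fun `]0, T[%classic v ->
     measurable_fun `]0, T[%classic (fun s => 2^-1 * (x s * v s - y s * u s)).
    move=> dx' dy' mu' mv; apply: measurable_funM => //; apply: measurable_funB;
      apply: measurable_funM => //.
      exact: mx dx'.
    exact: mx dy'.
  pose M := Num.max Kx1 (Num.max Kx2 Kx3).
  apply: (combine_in_L2 onW (K := M * K) T0 (hm _ _ _ _ d1 d2 m1 m2) (hm _ _ _ _ d1 d3 m1 m3)
    (hm _ _ _ _ d2 d3 m2 m3)).
  move=> s /[dup] hs /uK[k1 k2 k3].
  have hs' : 0 <= s <= T by case/andP: hs => /ltW -> /ltW ->.
  have b1 : `|x1 s| <= M by rewrite le_max HK1.
  have b2 : `|x2 s| <= M by rewrite !le_max HK2 ?orbT.
  have b3 : `|x3 s| <= M by rewrite !le_max HK3 ?orbT.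
  have bnd (x y u v : R) : `|x| <= M -> `|y| <= M -> `|u| <= K -> `|v| <= K ->
      `|2^-1 * (x * v - y * u)| <= M * K.
    move=> hx hy hu hv; rewrite normrM ger0_norm ?invr_ge0//.
    have := ler_normB (x * v) (y * u); rewrite !normrM => H.
    have := ler_pM (normr_ge0 x) (normr_ge0 v) hx hv.
    have := ler_pM (normr_ge0 y) (normr_ge0 u) hy hu.
    move: H; lra.
  by split; apply: bnd.
- apply: ae_imp dt => s H /H; by rewrite vtE.
Qed.

End HorizontalBuilder.

Section SpeedInequalities.
Variable R : realType.
Implicit Types (c v n e : R).

Lemma coordinate_le_norm (x y z v : R) : 0 <= v -> x ^+ 2 + y ^+ 2 + z ^+ 2 = v ^+ 2 ->
  [/\ `|x| <= v, `|y| <= v & `|z| <= v].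
Proof.
move=> v0 E; have sq_le (r : R) : r ^+ 2 <= v ^+ 2 -> `|r| <= v.
  by move=> h; rewrite -(@ler_pXn2r _ 2)// ?nnegrE// real_normK ?num_real.
have := sqr_ge0 x; have := sqr_ge0 y; have := sqr_ge0 z.
by split; apply: sq_le; lra.
Qed.

(** The square root lies below its tangent at v^2; equivalently (n - v)^2 >= 0. *)
Lemma le_sqr_perturbation v n e : 0 < v -> n ^+ 2 = v ^+ 2 + e -> n <= v + (2 * v)^-1 * e.
Proof.
move=> v0 E; have v2 : 0 < 2 * v by rewrite mulr_gt0.
rewrite -(ler_pM2l v2) mulrDr mulrA divff ?mul1r ?lt0r_neq0//.
have -> : e = n ^+ 2 - v ^+ 2 by rewrite E; ring.
by have := sqr_ge0 (n - v); lra.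
Qed.

Lemma first_order_gain c (D : R) : 0 < c -> 0 <= D ->
  4 * - (c / (D + 1)) * c + (- (c / (D + 1))) ^+ 2 * D < 0.
Proof.
move=> c0 D0; have D1 : 0 < D + 1 by rewrite ltr_wpDl.
have d0 : 0 < c / (D + 1) by exact: divr_gt0.
have E : c / (D + 1) * D = c - c / (D + 1) by field; exact: lt0r_neq0.
have -> : 4 * - (c / (D + 1)) * c + (- (c / (D + 1))) ^+ 2 * D =
    - (c / (D + 1)) * (4 * c - c / (D + 1) * D) by ring.
by rewrite E mulNr oppr_lt0 mulr_gt0//; lra.
Qed.

Lemma glued_length_le (v z e c M T s lT ls : R) :
  lT - 0 + (ls - lT) <=
    v * T + z * (2 * - e * - c + e ^+ 2 * M * T) - (v * 0 + z * (2 * - e * 0 + e ^+ 2 * M * 0))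
    + (v * s + z * (2 * e * 0 + e ^+ 2 * M * s) - (v * T + z * (2 * e * - c + e ^+ 2 * M * T))) ->
  ls <= v * s + z * (4 * e * c + e ^+ 2 * (M * s)).
Proof. lra. Qed.

End SpeedInequalities.

(** * An extremal in its tilted frame *)

Section TiltedExtremal.
Variables (R : realType) (V W : vectType R) (ip : {dot V for idfun})
  (wedge : {bilinear V -> V -> W}) (ipW : {dot W for idfun}).
Hypothesis hW : is_exterior_square ip wedge ipW.
Hypothesis dim3 : \dim {:V} = 3%N.
Local Notation mu := (@lebesgue_measure R).
Variables (gamma : R -> F3 V W) (u : R -> V) (rho ze th ka si la : R) (e1 e2 e3 : V).
Hypothesis hor : forall T : R, 0 < T -> horizontal ip wedge ipW T gamma u.
Hypothesis g0 : gamma 0 = (0, 0).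
Hypothesis la0 : 0 < la.
Hypothesis hth : pi <= th < phi1 R.
Hypothesis on : orthonormal3 ip e1 e2 e3.
Hypothesis u1E : forall s : R, 0 <= s -> ip e1 (u s) = ka * rho * (cos (la * s - th) - fS th).
Hypothesis u2E : forall s : R, 0 <= s -> ip e2 (u s) = rho * sin (la * s - th).
Hypothesis u3E : forall s : R, 0 <= s -> ip e3 (u s) = si * rho * cos (la * s - th) + ka * ze.

Let lan0 : la != 0. Proof. exact: lt0r_neq0. Qed.
Let thn0 : th != 0.
Proof. by case/andP: hth => /cut_angle_ge2 h _; rewrite gt_eqF//; lra. Qed.
Let SE : th * fS th = sin th. Proof. by rewrite /fS mulrC divfK. Qed.

Lemma AD_primitive_eq (f g G g' : R -> R) (s : R) : 0 <= s -> AD 0 s f g ->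
  f 0 = 0 -> G 0 = 0 -> (forall y : R, is_derive y 1 G (g' y)) ->
  (forall y : R, exists d, is_derive y 1 g' d) ->
  (forall r, 0 < r < s -> g r = g' r) -> f s = G s.
Proof.
move=> s0 df f0 G0 dG dg' E.
have /choice[g'' Hg''] := dg'.
have := AD_eq s0 df (AD_smooth s0 (fun y _ => dG y) (fun y _ => Hg'' y)).
by rewrite f0 G0 !subr0; apply; apply: aeW => r /E.
Qed.

Lemma tilted_x1 s : 0 <= s ->
  ip e1 (gamma s).1 = ka * rho * ((sin (la * s - th) + sin th) / la - fS th * s).
Proof.
rewrite le_eqVlt => /predU1P[<-|s0].
  by rewrite g0 ip0r mulr0 add0r sinN addNr mul0r mulr0 subr0 mulr0.
apply: (AD_primitive_eq (ltW s0) (horizontal_AD_x (hor s0) e1)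
  (G := fun s => ka * rho * ((sin (la * s - th) + sin th) / la - fS th * s))
  (g' := fun s => ka * rho * (cos (la * s - th) - fS th))).
- by rewrite g0 ip0r.
- by rewrite mulr0 add0r sinN addNr mul0r mulr0 subr0 mulr0.
- by move=> y; derive_by; field.
- by move=> y; eexists; derive_rules.
- by move=> r /andP[/ltW r0 _]; rewrite u1E.
Qed.

Lemma tilted_x2 s : 0 <= s ->
  ip e2 (gamma s).1 = rho * ((cos th - cos (la * s - th)) / la).
Proof.
rewrite le_eqVlt => /predU1P[<-|s0].
  by rewrite g0 ip0r mulr0 add0r cosN subrr mul0r mulr0.
apply: (AD_primitive_eq (ltW s0) (horizontal_AD_x (hor s0) e2)
  (G := fun s => rho * ((cos th - cos (la * s - th)) / la))
  (g' := fun s => rho * sin (la * s - th))).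
- by rewrite g0 ip0r.
- by rewrite mulr0 add0r cosN subrr mul0r mulr0.
- by move=> y; derive_by; field.
- by move=> y; eexists; derive_rules.
- by move=> r /andP[/ltW r0 _]; rewrite u2E.
Qed.

Lemma tilted_x3 s : 0 <= s ->
  ip e3 (gamma s).1 = si * rho * ((sin (la * s - th) + sin th) / la) + ka * ze * s.
Proof.
rewrite le_eqVlt => /predU1P[<-|s0].
  by rewrite g0 ip0r mulr0 add0r sinN addNr mul0r !mulr0 addr0.
apply: (AD_primitive_eq (ltW s0) (horizontal_AD_x (hor s0) e3)
  (G := fun s => si * rho * ((sin (la * s - th) + sin th) / la) + ka * ze * s)
  (g' := fun s => si * rho * cos (la * s - th) + ka * ze)).
- by rewrite g0 ip0r.
- by rewrite mulr0 add0r sinN addNr mul0r !mulr0 addr0.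
- by move=> y; derive_by; field.
- by move=> y; eexists; derive_rules.
- by move=> r /andP[/ltW r0 _]; rewrite u3E.
Qed.

Let T1 := 2 * th / la.
Let T10 : 0 < T1.
Proof.
by case/andP: hth => /cut_angle_ge2 h _; rewrite /T1 divr_gt0// mulr_gt0//; lra.
Qed.
Let laT1 : la * T1 - th = th. Proof. by rewrite /T1; field. Qed.

Lemma tilted_t12 : ipW (wedge e1 e2) (gamma T1).2 = ka * rho ^+ 2 * T1 ^+ 2 * fW th.
Proof.
(* An antiderivative, in the phase y = la s - th and up to a factor, of x1 u2 - x2 u1. Over [0, T1]
   the phase runs from - th to th. *)
pose A y := y - fS th * (sin y - y * cos y) - cos th * sin y + cos th * fS th * y - fS th * sin y.
have -> : ka * rho ^+ 2 * T1 ^+ 2 * fW th = ka * rho ^+ 2 / (2 * la ^+ 2) * (A (la * T1 - th) -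
  A (- th)).
  by rewrite laT1 /A sinN cosN /T1 /fW /fU /fV /fS; field; rewrite lan0 thn0.
apply: (AD_primitive_eq (ltW T10) (horizontal_AD_t hW (hor T10) e1 e2)
  (G := fun s => ka * rho ^+ 2 / (2 * la ^+ 2) * (A (la * s - th) - A (- th)))
  (g' := fun s => ka * rho ^+ 2 / (2 * la) *
     ((sin (la * s - th) - fS th * (la * s - th)) * sin (la * s - th)
      - (cos th - cos (la * s - th)) * (cos (la * s - th) - fS th)))).
- by rewrite g0 ip0r.
- by rewrite mulr0 add0r subrr mulr0.
- move=> y; rewrite /A; derive_by; set p := la * y - th.
  by field: (cos2E p).
- by move=> y; eexists; derive_rules.
- move=> r /andP[/ltW r0 _]; rewrite u1E// u2E// tilted_x1// tilted_x2// -SE.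
  by field.
Qed.

Lemma tilted_t13 : ipW (wedge e1 e3) (gamma T1).2 = 0.
Proof.
(* The even terms cancel between th and - th; the odd ones add up to 0 at th because th S = sin
   th. *)
pose A y := si * rho * (- fS th * (y * sin y + cos y) - fS th * cos y - sin th * sin y + fS th
  * sin th * y)
  + ka * ze * (- cos y - y * sin y - cos y - th * sin y + sin th * y).
transitivity (ka * rho / (2 * la ^+ 2) * (A (la * T1 - th) - A (- th))); last first.
  by rewrite laT1 /A sinN cosN -SE; field; exact: lan0.
apply: (AD_primitive_eq (ltW T10) (horizontal_AD_t hW (hor T10) e1 e3)
  (G := fun s => ka * rho / (2 * la ^+ 2) * (A (la * s - th) - A (- th)))
  (g' := fun s => ka * rho / (2 * la) *
     ((sin (la * s - th) - fS th * (la * s - th)) * (si * rho * cos (la * s - th) + ka * ze)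
      - (si * rho * (sin (la * s - th) + sin th) + ka * ze * (la * s)) * (cos (la * s - th) -
        fS th)))).
- by rewrite g0 ip0r.
- by rewrite mulr0 add0r subrr mulr0.
- move=> y; rewrite /A; derive_by; set p := la * y - th; have -> : la * y = p + th by rewrite
  subrK.
  by rewrite -SE; field.
- by move=> y; eexists; derive_rules.
- move=> r /andP[/ltW r0 _]; rewrite u1E// u3E// tilted_x1// tilted_x3//.
  by rewrite -SE; field.
Qed.

Lemma tilted_t23 : rho * si * fU th + ka * ze * fV th = 0 -> ipW (wedge e2 e3) (gamma T1).2 = 0.
Proof.
move=> E.
pose A y := si * rho * (cos th * sin y - y + sin th * cos y)
  + ka * ze * (cos th * y - sin y - (sin y - y * cos y) + th * cos y).
transitivity (rho / (2 * la ^+ 2) * (A (la * T1 - th) - A (- th))); last first.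
  transitivity (rho / (2 * la ^+ 2) * (- 8 * th ^+ 2 * (rho * si * fU th + ka * ze * fV th))).
    by rewrite laT1 /A sinN cosN /fU /fV; field; rewrite lan0 thn0.
  by rewrite E !mulr0.
apply: (AD_primitive_eq (ltW T10) (horizontal_AD_t hW (hor T10) e2 e3)
  (G := fun s => rho / (2 * la ^+ 2) * (A (la * s - th) - A (- th)))
  (g' := fun s => rho / (2 * la) *
     ((cos th - cos (la * s - th)) * (si * rho * cos (la * s - th) + ka * ze)
      - (si * rho * (sin (la * s - th) + sin th) + ka * ze * (la * s)) * sin (la * s - th)))).
- by rewrite g0 ip0r.
- by rewrite mulr0 add0r subrr mulr0.
- move=> y; rewrite /A; derive_by; set p := la * y - th; have -> : la * y = p + th by rewrite
  subrK.
  by field: (cos2E p).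
- by move=> y; eexists; derive_rules.
- move=> r /andP[/ltW r0 _]; rewrite u2E// u3E// tilted_x2// tilted_x3//.
  by field.
Qed.

Lemma tilted_endpoint : rho * si * fU th + ka * ze * fV th = 0 ->
  gamma T1 = (T1 * (si * rho * fS th + ka * ze) *: e3,
              ka * rho ^+ 2 * T1 ^+ 2 * fW th *: wedge e1 e2).
Proof.
move=> E; rewrite [LHS]surjective_pairing; congr pair.
  rewrite {1}(orthonormal3_expand dim3 on (gamma T1).1) tilted_x1 ?tilted_x2 ?tilted_x3 ?ltW//.
  rewrite laT1 subrr mul0r mulr0 scale0r addr0.
  have -> : ka * rho * ((sin th + sin th) / la - fS th * T1) = 0.
    by rewrite /T1 -SE; field.
  rewrite scale0r add0r; congr (_ *: _); rewrite /T1 -SE; field; exact: lan0.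
rewrite {1}(wedge_expand hW dim3 on (gamma T1).2).
by rewrite tilted_t12 tilted_t13 tilted_t23// !scale0r !addr0.
Qed.

Hypotheses (rho0 : 0 < rho) (ka0 : 0 < ka) (sk : si ^+ 2 + ka ^+ 2 = 1).
Hypothesis kS : ka * rho * fS th = si * ze.
Hypothesis balance : rho * si * fU th + ka * ze * fV th = 0.

Lemma tilted_speed (y : R) : (ka * rho * (cos y - fS th)) ^+ 2 + (rho * sin y) ^+ 2
  + (si * rho * cos y + ka * ze) ^+ 2 = rho ^+ 2 + ze ^+ 2.
Proof.
have -> : ka * rho * (cos y - fS th) = ka * rho * cos y - si * ze by rewrite -kS; ring.
transitivity ((si ^+ 2 + ka ^+ 2) * (rho ^+ 2 * cos y ^+ 2 + ze ^+ 2) + rho ^+ 2 * sin y ^+ 2).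
  by ring.
by rewrite sk cos2E; ring.
Qed.

(* Up to T1 the extremal is replaced by its image under the half turn about e3,
   which fixes gamma T1 and creates a corner there; the control is then varied
   in the direction e1 by the derivative of eta = b3 + la^2 b1.  As eta is
   orthogonal to 1, cos and sin, the end point does not move, but the length
   changes at first order because of the corner. *)
Lemma shorter_competitor (s0 : R) : T1 < s0 -> exists gamma' v,
  [/\ horizontal ip wedge ipW s0 gamma' v, gamma' 0 = (0, 0), gamma' s0 = gamma s0 &
    exists2 l, curve_length ip v s0 = l%:E & l < Num.sqrt (rho ^+ 2 + ze ^+ 2) * s0].
Proof.
move=> Ts; have s00 : 0 < s0 := lt_trans T10 Ts.
have T1' := ltW T10; have Ts' := ltW Ts.
pose V2 := rho ^+ 2 + ze ^+ 2; pose vv := Num.sqrt V2.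
have V20 : 0 < V2 by rewrite ltr_wpDr ?sqr_ge0// exprn_gt0.
have vv0 : 0 < vv by rewrite sqrtr_gt0.
have vv2 : vv ^+ 2 = V2 by rewrite sqr_sqrtr// ltW.
have [bl0 [bl1 [bl2 [bl3 [bl4 [[dl0 dl1 dl2 dl3 dl4] [lp0 lp1 lp2 lp3] [lq0 lq1 lq2 lq3]]]]]]] :=
  bump_exists (lt0r_neq0 T10).
have sTn : T1 != s0 by rewrite lt_eqF.
have [br0 [br1 [br2 [br3 [br4 [[dr0 dr1 dr2 dr3 dr4] [rp0 rp1 rp2 rp3] [rq0 rq1 rq2 rq3]]]]]]] :=
  bump_exists sTn.
pose sn s := sin (la * s - th); pose cs s := cos (la * s - th).
have dsn (y : R) : is_derive y 1 sn (la * cs y) by rewrite /sn; derive_by; rewrite /cs; ring.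
have dcs (y : R) : is_derive y 1 cs (- la * sn y) by rewrite /cs; derive_by; rewrite /sn; ring.
have smooth a b (G g : R -> R) : a <= b -> (forall y : R, is_derive y 1 G (g y)) ->
    (forall y : R, exists d, is_derive y 1 g d) -> AD a b G g.
  move=> ab dG dg'; have /choice[g'' Hg''] := dg'.
  exact: (AD_smooth ab (fun y _ => dG y) (fun y _ => Hg'' y)).
have Asn a b : a <= b -> AD a b sn (fun s => la * cs s).
  by move=> ab; apply: smooth => // y; have := dcs y => d; eexists; derive_rules.
have Acs a b : a <= b -> AD a b cs (fun s => - la * sn s).
  by move=> ab; apply: smooth => // y; have := dsn y => d; eexists; derive_rules.
pose u1f s := ka * rho * (cs s - fS th); pose u2f s := rho * sn s.
pose u3f s := si * rho * cs s + ka * ze.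
pose g1 s := ip e1 (gamma s).1; pose g2 s := ip e2 (gamma s).1; pose g3 s := ip e3 (gamma s).1.
pose G12 s := ipW (wedge e1 e2) (gamma s).2.
pose G13 s := ipW (wedge e1 e3) (gamma s).2.
pose G23 s := ipW (wedge e2 e3) (gamma s).2.
have h := hor s00.
have dg1 : AD 0 s0 g1 u1f.
  by apply: AD_ext (horizontal_AD_x h e1) => s /andP[/ltW p0 _]; rewrite u1E.
have dg2 : AD 0 s0 g2 u2f.
  by apply: AD_ext (horizontal_AD_x h e2) => s /andP[/ltW p0 _]; rewrite u2E.
have dg3 : AD 0 s0 g3 u3f.
  by apply: AD_ext (horizontal_AD_x h e3) => s /andP[/ltW p0 _]; rewrite u3E.
have dG12 : AD 0 s0 G12 (fun s => 2^-1 * (g1 s * u2f s - g2 s * u1f s)).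
  by apply: AD_ext (horizontal_AD_t hW h e1 e2) => s /andP[/ltW p0 _]; rewrite u1E// u2E.
have dG13 : AD 0 s0 G13 (fun s => 2^-1 * (g1 s * u3f s - g3 s * u1f s)).
  by apply: AD_ext (horizontal_AD_t hW h e1 e3) => s /andP[/ltW p0 _]; rewrite u1E// u3E.
have dG23 : AD 0 s0 G23 (fun s => 2^-1 * (g2 s * u3f s - g3 s * u2f s)).
  by apply: AD_ext (horizontal_AD_t hW h e2 e3) => s /andP[/ltW p0 _]; rewrite u2E// u3E.
have g1T : g1 T1 = 0.
  by rewrite /g1 tilted_x1// laT1 /T1 -SE; field.
have g2T : g2 T1 = 0 by rewrite /g2 tilted_x2// laT1 subrr mul0r mulr0.
have G13T : G13 T1 = 0 := tilted_t13.
have G23T : G23 T1 = 0 := tilted_t23 balance.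
(* one side of the corner: sg = -1 before T1 and sg = 1 after *)
have side a b (sg eps : R) (b0 b1 b2 b3 b4 : R -> R) : a <= b -> 0 <= a -> b <= s0 ->
    sg ^+ 2 = 1 ->
    (forall y : R, is_derive y 1 b0 (b1 y)) -> (forall y : R, is_derive y 1 b1 (b2 y)) ->
    (forall y : R, is_derive y 1 b2 (b3 y)) -> (forall y : R, is_derive y 1 b3 (b4 y)) ->
    (forall y : R, exists d, is_derive y 1 b4 d) ->
    let et s := b3 s + la ^+ 2 * b1 s in let et' s := b4 s + la ^+ 2 * b2 s in
    let x1 s := sg * g1 s + eps * et s in let v1 s := sg * u1f s + eps * et' s in
    [/\ AD a b x1 v1,
      AD a b (fun s => G12 s - 2^-1 * eps * (sg * (g2 s * et s))
          + eps * (sg * rho) * (b2 s * sn s - la * (b1 s * cs s)))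
        (fun s => 2^-1 * (x1 s * (sg * u2f s) - (sg * g2 s) * v1 s)),
      AD a b (fun s => sg * G13 s - 2^-1 * eps * (g3 s * et s)
          + eps * (b2 s * u3f s + la * si * rho * (b1 s * sn s) + la ^+ 2 * ka * ze * b0 s))
        (fun s => 2^-1 * (x1 s * u3f s - g3 s * v1 s)),
      AD a b (fun s => et s * u1f s + la * ka * rho * (b2 s * sn s - la * (b1 s * cs s)))
        (fun s => et' s * u1f s) &
      exists2 M, 0 <= M & forall s, a <= s <= b -> `|et' s| <= M].
  (* The primitives come from integrations by parts such as (b2 sn - la b1 cs)' = et sn: the change
     of each coordinate is written in et, b0, b1, b2, and is thus known at the ends of the side. *)
  move=> ab a0 bs sg2 db0 db1 db2 db3 db4 et et' x1 v1.
  have A0 : AD a b b0 b1 by apply: smooth => // y; exists (b2 y).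
  have A1 : AD a b b1 b2 by apply: smooth => // y; exists (b3 y).
  have A2 : AD a b b2 b3 by apply: smooth => // y; exists (b4 y).
  have A3 : AD a b b3 b4 by apply: smooth.
  have Aet : AD a b et et' by rewrite /et; AD_by.
  have As := Asn a b ab; have Ac := Acs a b ab.
  have a1 := AD_sub a0 bs dg1; have a2 := AD_sub a0 bs dg2; have a3 := AD_sub a0 bs dg3.
  have a12 := AD_sub a0 bs dG12; have a13 := AD_sub a0 bs dG13.
  have Au3 : AD a b u3f (fun s => si * rho * (- la * sn s)).
    by rewrite /u3f; AD_by => s _; ring.
  have Au1 : AD a b u1f (fun s => ka * rho * (- la * sn s)).
    by rewrite /u1f; AD_by => s _; ring.
  split.
  - by rewrite /x1; AD_by.
  - AD_by => s _; rewrite /x1 /v1 /u2f.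
    apply/eqP; rewrite -subr_eq0; apply/eqP.
    transitivity (2^-1 * (g1 s * (rho * sn s) - g2 s * u1f s) * (1 - sg ^+ 2)).
      by rewrite /et /et'; field.
    by rewrite sg2 subrr mulr0.
  - AD_by => s _; rewrite /x1 /v1 /et /et' /u3f; by field.
  - AD_by => s _; rewrite /et /et'; by ring.
  - apply: (is_derive_bounded (g := fun y => xget 0 [set d | is_derive y 1 b4 d] + la ^+ 2 * b3
    y)) => // y _.
    have [d Hd] := db4 y; have := @xgetI _ 0 [set d | is_derive y 1 b4 d] d Hd => /= D4.
    by have db2y := db2 y; rewrite /et'; derive_by; ring.
have c0 : 0 < 2 * th * fV th * ka * rho.
  have V0 := fV_gt0 hth.
  have t0 : 0 < th by case/andP: hth => /cut_angle_ge2 ? _; lra.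
  by apply: mulr_gt0 => //; apply: mulr_gt0 => //; apply: mulr_gt0 => //; apply: mulr_gt0.
(* The value of u1 at T1 is - c; after the half turn the first control component jumps there from c
   to - c, and this is a true corner since V th > 0. *)
pose c := 2 * th * fV th * ka * rho.
have u1T : u1f T1 = - c.
  rewrite /u1f /cs laT1 /c /fV /fS; field; exact: thn0.
have m1sq : (-1) ^+ 2 = 1 :> R by rewrite sqrrN expr1n.
(* The bound on the derivative of eta does not depend on eps, which is about to be chosen from it;
   hence the value 0 here. *)
have [_ _ _ _ [ML ML0 HL]] := side 0 T1 (-1) 0 bl0 bl1 bl2 bl3 bl4 T1' (lexx 0) Ts' m1sq dl0
  dl1 dl2 dl3 dl4.
have [_ _ _ _ [MR MR0 HR]] := side T1 s0 1 0 br0 br1 br2 br3 br4 Ts' T1' (lexx s0) (expr1n _ 2)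
  dr0 dr1 dr2 dr3 dr4.
pose M := ML + MR; have M0 : 0 <= M by exact: addr_ge0.
have D0 : 0 < M ^+ 2 * s0 + 1 by rewrite ltr_wpDl// mulr_ge0 ?sqr_ge0 ?ltW.
(* Negative, so that the first order change of the length is a gain, and small enough for the
   quadratic term not to use it up. *)
pose eps := - (c / (M ^+ 2 * s0 + 1)).
have gain : 4 * eps * c + eps ^+ 2 * (M ^+ 2 * s0) < 0.
  by apply: first_order_gain c0 _; apply: mulr_ge0 (ltW s00); exact: sqr_ge0.
have [L1 L2 L3 L4 _] := side 0 T1 (-1) eps bl0 bl1 bl2 bl3 bl4 T1' (lexx 0) Ts' m1sq dl0 dl1
  dl2 dl3 dl4.
have [R1 R2 R3 R4 _] := side T1 s0 1 eps br0 br1 br2 br3 br4 Ts' T1' (lexx s0) (expr1n _ 2) dr0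
  dr1 dr2 dr3 dr4.
clear side.
move: HL HR L1 L2 L3 L4 R1 R2 R3 R4.
set etl := (fun s : R => bl3 s + la ^+ 2 * bl1 s); set etl' := (fun s : R =>
  bl4 s + la ^+ 2 * bl2 s).
set etr := (fun s : R => br3 s + la ^+ 2 * br1 s); set etr' := (fun s : R =>
  br4 s + la ^+ 2 * br2 s).
rewrite /= => HL HR L1 L2 L3 L4 R1 R2 R3 R4.
have speed s : u1f s ^+ 2 + u2f s ^+ 2 + u3f s ^+ 2 = V2 := tilted_speed (la * s - th).
have ubd s : [/\ `|u1f s| <= vv, `|u2f s| <= vv & `|u3f s| <= vv].
  by apply: coordinate_le_norm (ltW vv0) _; rewrite speed vv2.
have b1 s : `|u1f s| <= vv by case: (ubd s).
have b2 s : `|u2f s| <= vv by case: (ubd s).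
have b3 s : `|u3f s| <= vv by case: (ubd s).
have meas (G : R -> R) : (forall y : R, exists d, is_derive y 1 G d) -> measurable_fun setT G.
  move=> dG; apply: continuous_measurable_fun => y; have [d [dy _]] := dG y.
  by apply: differentiable_continuous; apply/derivable1_diffP.
have mu1 : forall y : R, exists d, is_derive y 1 u1f d.
  by move=> y; have := dcs y => d; rewrite /u1f; eexists; derive_rules.
have mu2 : forall y : R, exists d, is_derive y 1 u2f d.
  by move=> y; have := dsn y => d; rewrite /u2f; eexists; derive_rules.
have mu3 : forall y : R, exists d, is_derive y 1 u3f d.
  by move=> y; have := dcs y => d; rewrite /u3f; eexists; derive_rules.
have metl : forall y : R, exists d, is_derive y 1 etl' d.
  move=> y; have [d Hd] := dl4 y; have := dl2 y => d2.
  by rewrite /etl'; eexists; derive_rules.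
have metr : forall y : R, exists d, is_derive y 1 etr' d.
  move=> y; have [d Hd] := dr4 y; have := dr2 y => d2.
  by rewrite /etr'; eexists; derive_rules.
pose v1l s := -1 * u1f s + eps * etl' s; pose v1r s := 1 * u1f s + eps * etr' s.
pose x1l s := -1 * g1 s + eps * etl s; pose x1r s := 1 * g1 s + eps * etr s.
have etlT : etl T1 = 1 by rewrite /etl lp3 lp1 mulr0 addr0.
have etrT : etr T1 = 1 by rewrite /etr rp3 rp1 mulr0 addr0.
have etl0 : etl 0 = 0 by rewrite /etl lq3 lq1 mulr0 addr0.
have etrs : etr s0 = 0 by rewrite /etr rq3 rq1 mulr0 addr0.
have x1T : x1l T1 = x1r T1 by rewrite /x1l /x1r etlT etrT g1T !mulr0.
have A1 := AD_glue T1' Ts' x1T L1 R1.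
have A2 : AD 0 s0 (glue T1 (fun s => -1 * g2 s) (fun s => 1 * g2 s))
    (glue T1 (fun s => -1 * u2f s) (fun s => 1 * u2f s)).
  apply: (AD_glue T1' Ts'); first by rewrite g2T !mulr0.
    by apply: AD_sc; exact: AD_sub (lexx 0) Ts' dg2.
  by apply: AD_sc; exact: AD_sub T1' (lexx s0) dg2.
have t12T : (fun s => G12 s - 2^-1 * eps * (-1 * (g2 s * etl s)) +
    eps * (-1 * rho) * (bl2 s * sn s - la * (bl1 s * cs s))) T1 =
    (fun s => G12 s - 2^-1 * eps * (1 * (g2 s * etr s)) +
    eps * (1 * rho) * (br2 s * sn s - la * (br1 s * cs s))) T1.
  by rewrite /= g2T lp1 lp2 rp1 rp2; ring.
have A12 := AD_glue T1' Ts' t12T L2 R2.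
have t13T : (fun s => -1 * G13 s - 2^-1 * eps * (g3 s * etl s) +
    eps * (bl2 s * u3f s + la * si * rho * (bl1 s * sn s) + la ^+ 2 * ka * ze * bl0 s)) T1 =
    (fun s => 1 * G13 s - 2^-1 * eps * (g3 s * etr s) +
    eps * (br2 s * u3f s + la * si * rho * (br1 s * sn s) + la ^+ 2 * ka * ze * br0 s)) T1.
  by rewrite /= G13T lp0 lp1 lp2 rp0 rp1 rp2 etlT etrT; ring.
have A13 := AD_glue T1' Ts' t13T L3 R3.
have A23 : AD 0 s0 (glue T1 (fun s => -1 * G23 s) (fun s => 1 * G23 s))
    (glue T1 (fun s => -1 * (2^-1 * (g2 s * u3f s - g3 s * u2f s)))
       (fun s => 1 * (2^-1 * (g2 s * u3f s - g3 s * u2f s)))).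
  apply: (AD_glue T1' Ts'); first by rewrite G23T !mulr0.
    by apply: AD_sc; exact: AD_sub (lexx 0) Ts' dG23.
  by apply: AD_sc; exact: AD_sub T1' (lexx s0) dG23.
have A12' := AD_ext (g := fun s => 2^-1 * (glue T1 x1l x1r s * glue T1 (fun s =>
  -1 * u2f s) (fun s => 1 * u2f s) s
   - glue T1 (fun s => -1 * g2 s) (fun s => 1 * g2 s) s * glue T1 v1l v1r s)) _ A12.
have {}A12 := A12' (fun s _ => ltac:(by rewrite /glue; case: ifP)).
have A13' := AD_ext (g := fun s => 2^-1 * (glue T1 x1l x1r s * u3f s - g3 s * glue T1 v1l v1r
  s)) _ A13.
have {}A13 := A13' (fun s _ => ltac:(by rewrite /glue; case: ifP)).
have A23' := AD_ext (g := fun s => 2^-1 * (glue T1 (fun s => -1 * g2 s) (fun s =>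
  1 * g2 s) s * u3f s
   - g3 s * glue T1 (fun s => -1 * u2f s) (fun s => 1 * u2f s) s)) _ A23.
have {}A23 := A23' (fun s _ => ltac:(by rewrite /glue; case: ifP => _; ring)).
clear A12' A13' A23'.
have mv1 : measurable_fun `]0, s0[%classic (glue T1 v1l v1r).
  apply: glue_measurable; apply: measurable_funD; apply: measurable_funM => //; exact: meas.
have mv2 : measurable_fun `]0, s0[%classic (glue T1 (fun s => -1 * u2f s) (fun s => 1 * u2f s)).
  apply: glue_measurable; apply: measurable_funM => //; exact: meas.
have mv3 : measurable_fun `]0, s0[%classic u3f.
  by apply: (measurable_funS measurableT) => //; exact: meas.
have ub s : 0 < s < s0 -> [/\ `|glue T1 v1l v1r s| <= vv + `|eps| * M,
    `|glue T1 (fun s => -1 * u2f s) (fun s => 1 * u2f s) s| <= vv + `|eps| * M &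
    `|u3f s| <= vv + `|eps| * M].
  move=> /andP[/ltW s_0 /ltW ss0].
  have eM : 0 <= `|eps| * M by exact: mulr_ge0.
  split.
  - have tri (a e : R) : `|1 * a + eps * e| <= `|a| + `|eps| * `|e|.
      by rewrite mul1r; apply: le_trans (ler_normD _ _) _; rewrite normrM.
    have triN (a e : R) : `|-1 * a + eps * e| <= `|a| + `|eps| * `|e|.
      by rewrite mulN1r; apply: le_trans (ler_normD _ _) _; rewrite normrN normrM.
    rewrite /glue; case: ifPn => [sT|].
      apply: le_trans (triN _ _) _; apply: lerD => //; apply: ler_wpM2l => //.
      by apply: le_trans (HL s _) _; rewrite ?s_0// /M lerDl.
    rewrite -ltNge => /ltW Tx.
    apply: le_trans (tri _ _) _; apply: lerD => //; apply: ler_wpM2l => //.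
    by apply: le_trans (HR s _) _; rewrite ?Tx// /M lerDr.
  - have -> : `|glue T1 (fun s => -1 * u2f s) (fun s => 1 * u2f s) s| = `|u2f s|.
      by rewrite /glue; case: ifPn => _; [rewrite mulN1r normrN|rewrite mul1r].
    by apply: le_trans (b2 s) _; rewrite lerDl.
  - by apply: le_trans (b3 s) _; rewrite lerDl.
have hb := horizontal_build hW on s00 A1 A2 dg3 A12 A13 A23 mv1 mv2 mv3 ub.
have [l [l0 dl lE]] := horizontal_length dim3 s00 hb on.
eexists; eexists; split; first exact: hb.
- have T0' : 0 <= T1 by [].
  congr pair; rewrite /combine /glue T0' /x1l /=.
    rewrite etl0 /g1 /g2 /g3 g0 !ip0r !mulr0 addr0 !scale0r !addr0 //.
  rewrite /G12 /G13 /G23 /g2 /g3 g0 !ip0r lq0 lq1 lq2 lq3.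
  by rewrite !(mul0r, mulr0, subr0, addr0) !scale0r !addr0.
- have Tf : (s0 <= T1) = false by rewrite leNgt Ts.
  rewrite [RHS]surjective_pairing; congr pair; rewrite /combine /glue Tf /x1r /=.
    by rewrite etrs mulr0 addr0 !mul1r /g1 /g2 /g3 -(orthonormal3_expand dim3 on).
  rewrite rq0 rq1 rq2 rq3 !(mul0r, mulr0, subr0, addr0) !mul1r /G12 /G13 /G23.
  by rewrite -(wedge_expand hW dim3 on).
exists (l s0) => //; rewrite -/V2 -/vv.
have nrmE s : nrm ip (combine e1 e2 e3 (glue T1 v1l v1r)
    (glue T1 (fun s => -1 * u2f s) (fun s => 1 * u2f s)) u3f s) ^+ 2 =
    (glue T1 v1l v1r s) ^+ 2 + u2f s ^+ 2 + u3f s ^+ 2.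
  rewrite (combine_nrm2 on) /glue; case: ifP => _; by rewrite ?mulN1r ?mul1r ?sqrrN.
have nrm_le (n e : R) : n ^+ 2 = V2 + e -> n <= vv + (2 * vv)^-1 * e.
  by rewrite -vv2; exact: le_sqr_perturbation.
(* [Jl] and [Jr] integrate the first variation of the length. Both equal - c at T1, but the half
   turn reverses the sign of the left contribution, so that the two add up to 4 eps c instead of
   cancelling. *)
pose Jl s := etl s * u1f s + la * ka * rho * (bl2 s * sn s - la * (bl1 s * cs s)).
pose Jr s := etr s * u1f s + la * ka * rho * (br2 s * sn s - la * (br1 s * cs s)).
have JlT : Jl T1 = - c by rewrite /Jl etlT lp1 lp2 u1T; ring.
have Jl0 : Jl 0 = 0 by rewrite /Jl etl0 lq1 lq2; ring.
have JrT : Jr T1 = - c by rewrite /Jr etrT rp1 rp2 u1T; ring.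
have Jrs : Jr s0 = 0 by rewrite /Jr etrs rq1 rq2; ring.
have dJl : AD 0 T1 Jl (fun s => etl' s * u1f s) := L4.
have dJr : AD T1 s0 Jr (fun s => etr' s * u1f s) := R4.
clear L4 R4; clearbody Jl Jr.
have leL : l T1 - l 0 <= (vv * T1 + (2 * vv)^-1 * (2 * - eps * Jl T1 + eps ^+ 2 * M ^+ 2 * T1))
    - (vv * 0 + (2 * vv)^-1 * (2 * - eps * Jl 0 + eps ^+ 2 * M ^+ 2 * 0)).
  apply: (AD_le (f := fun s => nrm ip (combine e1 e2 e3 (glue T1 v1l v1r)
    (glue T1 (fun s => -1 * u2f s) (fun s => 1 * u2f s)) u3f s))
    (g := fun s => vv + (2 * vv)^-1 * (2 * - eps * (etl' s * u1f s) + eps ^+ 2 * M ^+ 2))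
    (G := fun s => vv * s + (2 * vv)^-1 * (2 * - eps * Jl s + eps ^+ 2 * M ^+ 2 * s)) T1'
      (AD_sub (lexx 0) Ts' dl)).
    by AD_by => s _; ring.
  apply: aeW => s /andP[/ltW s_0 /ltW sT].
  apply: (@le_trans _ _ (vv + (2 * vv)^-1 * (2 * - eps * (etl' s * u1f s) + eps ^+ 2 * etl' s
    ^+ 2))).
    apply: nrm_le; rewrite nrmE /glue sT /v1l -(speed s); ring.
  rewrite lerD2l ler_pM2l ?invr_gt0 ?mulr_gt0// lerD2l ler_wpM2l ?sqr_ge0//.
  rewrite -[etl' s ^+ 2]real_normK ?num_real// lerXn2r ?nnegrE//.
  by rewrite (le_trans (HL s _)) ?s_0// /M lerDl.
have leR : l s0 - l T1 <= (vv * s0 + (2 * vv)^-1 * (2 * eps * Jr s0 + eps ^+ 2 * M ^+ 2 * s0))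
    - (vv * T1 + (2 * vv)^-1 * (2 * eps * Jr T1 + eps ^+ 2 * M ^+ 2 * T1)).
  apply: (AD_le (f := fun s => nrm ip (combine e1 e2 e3 (glue T1 v1l v1r)
    (glue T1 (fun s => -1 * u2f s) (fun s => 1 * u2f s)) u3f s))
    (g := fun s => vv + (2 * vv)^-1 * (2 * eps * (etr' s * u1f s) + eps ^+ 2 * M ^+ 2))
    (G := fun s => vv * s + (2 * vv)^-1 * (2 * eps * Jr s + eps ^+ 2 * M ^+ 2 * s)) Ts' (AD_sub
      T1' (lexx s0) dl)).
    by AD_by => s _; ring.
  apply: aeW => s /andP[sT /ltW ss0].
  apply: (@le_trans _ _ (vv + (2 * vv)^-1 * (2 * eps * (etr' s * u1f s) + eps ^+ 2 * etr' s ^+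
    2))).
    apply: nrm_le; rewrite nrmE /glue leNgt sT /= /v1r -(speed s); ring.
  rewrite lerD2l ler_pM2l ?invr_gt0 ?mulr_gt0// lerD2l ler_wpM2l ?sqr_ge0//.
  rewrite -[etr' s ^+ 2]real_normK ?num_real// lerXn2r ?nnegrE//.
  by rewrite (le_trans (HR s _)) ?(ltW sT)// /M lerDr.
have {leL leR} := lerD leL leR; rewrite l0 JlT Jl0 JrT Jrs => le.
have : l s0 <= vv * s0 + (2 * vv)^-1 * (4 * eps * c + eps ^+ 2 * (M ^+ 2 * s0)).
  exact: glued_length_le le.
move=> H; apply: le_lt_trans H _; rewrite gtrDl pmulr_rlt0// invr_gt0 mulr_gt0//.
Qed.

End TiltedExtremal.

(** * The cut locus *)

Section CutLocus.
Variables (R : realType) (V W : vectType R) (ip : {dot V for idfun})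
  (wedge : {bilinear V -> V -> W}) (ipW : {dot W for idfun}).
Hypothesis hW : is_exterior_square ip wedge ipW.
Hypothesis dim3 : \dim {:V} = 3%N.
Variables (gamma : R -> F3 V W) (u : R -> V).
Hypothesis hor : forall T : R, 0 < T -> horizontal ip wedge ipW T gamma u.
Hypothesis g0 : gamma 0 = (0, 0).

Lemma constant_speed_length (e1 e2 e3 : V) (v T : R) : orthonormal3 ip e1 e2 e3 ->
  0 < T -> (forall s, 0 <= s -> nrm ip (u s) = v) -> curve_length ip u T = (v * T)%:E.
Proof.
move=> on T0 uv; have [l [l0 dl ->]] := horizontal_length dim3 T0 (hor T0) on.
have := AD_eq (ltW T0) dl (AD_sc v (AD_id 0 T)).
rewrite l0 mulr0 !subr0 mulr1 => -> //.
by apply: aeW => s /andP[/ltW s0 _]; exact: uv.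
Qed.

Lemma dist_le_length (s : R) gamma' v : 0 < s -> horizontal ip wedge ipW s gamma' v ->
  (dist ip wedge ipW (gamma' 0%R) (gamma' s) <= curve_length ip v s)%E.
Proof. by move=> s0 h; apply: ereal_inf_lbound; exists s, gamma', v. Qed.

Lemma dist_ge (p q : F3 V W) (L : \bar R) :
  (forall (s : R) gamma' v, 0 < s -> horizontal ip wedge ipW s gamma' v ->
    gamma' 0 = p -> gamma' s = q -> (L <= curve_length ip v s)%E) ->
  (L <= dist ip wedge ipW p q)%E.
Proof. by move=> H; apply: le_ereal_inf_tmp => _ [s [g [v [s0 h gp gq ->]]]];
  exact: H h gp gq. Qed.

Lemma straight_minimizer (e1 e2 e3 w : V) (s : R) : orthonormal3 ip e1 e2 e3 ->
  (forall r, 0 <= r -> u r = w) -> 0 < s -> length_minimizer ip wedge ipW gamma u s.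
Proof.
move=> on uw s0.
have xs : (gamma s).1 = s *: w.
  apply/eqP; rewrite -subr_eq0; apply/eqP/(ip_eq0 (ip := ip)); set e := _ - _.
  rewrite {2}/e ipDr ipNr ipZr.
  have := AD_eq (ltW s0) (horizontal_AD_x (hor s0) e) (AD_sc (ip e w) (AD_id 0 s)).
  rewrite g0 ip0r mulr0 !subr0 mulr1 => -> //; first by rewrite mulrC subrr.
  by apply: aeW => r /andP[/ltW r0 _]; rewrite uw.
have len : curve_length ip u s = (nrm ip w * s)%:E.
  by apply: constant_speed_length on s0 _ => r /uw ->.
apply/eqP; rewrite /length_minimizer eq_le; apply/andP; split; last first.
  exact: dist_le_length s0 (hor s0).
rewrite len g0.
apply: dist_ge => T g v T0 h gp gq.
have -> : nrm ip w * s = nrm ip (gamma s).1 by rewrite xs nrmZ gtr0_norm// mulrC.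
by apply: (curve_length_ge dim3 T0 h on); rewrite ?gp ?gq.
Qed.

Lemma adapted_frame (a b z : V) : ip a b = 0 -> ip a z = 0 -> ip b z = 0 ->
  nrm ip a = nrm ip b -> 0 < nrm ip a -> exists f1 f2 f3, [/\ orthonormal3 ip f1 f2 f3,
    a = nrm ip a *: f1, b = nrm ip a *: f2 & z = nrm ip z *: f3].
Proof.
move=> ab az bz nab a0; set r := nrm ip a in nab a0 *; have rn0 := lt0r_neq0 a0.
have scale (c : R) (v : V) : c != 0 -> v = c *: (c^-1 *: v).
  by move=> cn0; rewrite scalerA divff// scale1r.
have unit v : nrm ip v != 0 -> ip ((nrm ip v)^-1 *: v) ((nrm ip v)^-1 *: v) = 1.
  by move=> vn0; rewrite ipZl ipZr -nrm_sqr; field.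
have f11 := unit _ rn0; have f22 : ip (r^-1 *: b) (r^-1 *: b) = 1 by rewrite nab unit// -nab.
have f12 : ip (r^-1 *: a) (r^-1 *: b) = 0 by rewrite ipZl ipZr ab !mulr0.
have [nz|nz] := eqVneq (nrm ip z) 0.
  have [f3 on] := orthonormal3_complete dim3 f11 f22 f12.
  exists (r^-1 *: a), (r^-1 *: b), f3; split => //; try exact: scale.
  by rewrite nz scale0r (nrm_eq0 nz).
exists (r^-1 *: a), (r^-1 *: b), ((nrm ip z)^-1 *: z); split; try exact: scale.
split => //; first exact: unit.
- by rewrite ipZl ipZr az !mulr0.
- by rewrite ipZl ipZr bz !mulr0.
Qed.

(** A rotation by th about f3 puts the zero of the phase in the middle of [0, 2 th / la]; it is
    followed by the tilt (ka, si) in the plane of the first and third vectors. *)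
Lemma tilted_frame (f1 f2 f3 : V) (ka si th : R) : orthonormal3 ip f1 f2 f3 ->
  si ^+ 2 + ka ^+ 2 = 1 -> orthonormal3 ip
    ((ka * cos th) *: f1 + (ka * sin th) *: f2 + (- si) *: f3)
    ((- sin th) *: f1 + cos th *: f2 + 0 *: f3)
    ((si * cos th) *: f1 + (si * sin th) *: f2 + ka *: f3).
Proof.
move=> on sk; have cE := cos2E th.
have ipE (a1 a2 a3 b1 b2 b3 : R) :
    ip (a1 *: f1 + a2 *: f2 + a3 *: f3) (b1 *: f1 + b2 *: f2 + b3 *: f3) =
    a1 * b1 + a2 * b2 + a3 * b3.
  have [h11 h22 h33 h12 h13 h23] := on.
  have h21 := h12; rewrite ipC in h21; have h31 := h13; rewrite ipC in h31.
  have h32 := h23; rewrite ipC in h32.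
  rewrite !ipDl !ipDr !ipZl !ipZr h11 h22 h33 h12 h13 h23 h21 h31 h32; ring.
have kE : ka ^+ 2 = 1 - si ^+ 2 by rewrite -sk; ring.
by split; rewrite ipE; ring: cE kE.
Qed.

Lemma tilted_cut (rho ze th ka si la : R) (e1 e2 e3 : V) : orthonormal3 ip e1 e2 e3 ->
  0 < rho -> 0 <= ze -> 0 < la -> pi <= th < phi1 R ->
  fS th * fU th * rho ^+ 2 + fV th * ze ^+ 2 = 0 ->
  0 < ka -> si ^+ 2 + ka ^+ 2 = 1 -> ka * rho * fS th = si * ze ->
  rho * si * fU th + ka * ze * fV th = 0 -> ka = Num.sqrt (fU th / fW th) ->
  (forall s, 0 <= s -> ip e1 (u s) = ka * rho * (cos (la * s - th) - fS th)) ->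
  (forall s, 0 <= s -> ip e2 (u s) = rho * sin (la * s - th)) ->
  (forall s, 0 <= s -> ip e3 (u s) = si * rho * cos (la * s - th) + ka * ze) ->
  exists T1 X t, [/\ cut_time ip wedge ipW gamma u = T1%:E, 0 < t, X ^+ 2 = fP th * t,
    gamma T1 = (X *: e3, t *: wedge e1 e2) &
    (dist ip wedge ipW (0%R, 0%R) (gamma T1) ^+ 2)%E = (X ^+ 2 + fR th * t)%:E].
Proof.
move=> on r0 z0 la0 hth E k0 sk kS bal kE u1E u2E u3E.
have t2 : 2 <= th by case/andP: hth => /cut_angle_ge2.
pose T1 := 2 * th / la; have T10 : 0 < T1 by rewrite divr_gt0// mulr_gt0//; lra.
pose X := T1 * (si * rho * fS th + ka * ze); pose t := ka * rho ^+ 2 * T1 ^+ 2 * fW th.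
pose vv := Num.sqrt (rho ^+ 2 + ze ^+ 2).
have t0 : 0 < t.
  by apply: (mulr_gt0 _ (fW_gt0 hth)); apply: (mulr_gt0 (mulr_gt0 k0 _)); exact: exprn_gt0.
have vv2 : vv ^+ 2 = rho ^+ 2 + ze ^+ 2 by rewrite sqr_sqrtr// addr_ge0 ?sqr_ge0.
have speed s : 0 <= s -> nrm ip (u s) = vv.
  move=> s0; rewrite /nrm (orthonormal3_norm _ dim3 on) u1E// u2E// u3E//.
  by rewrite tilted_speed.
have len s : 0 < s -> curve_length ip u s = (vv * s)%:E.
  by move=> s0; exact: constant_speed_length on s0 speed.
have [XP XR] := @cut_point_values _ _ _ _ _ _ T1 r0 z0 hth E sk kS kE.
have gT : gamma T1 = (X *: e3, t *: wedge e1 e2).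
  exact: (tilted_endpoint hW dim3 hor g0 la0 hth on u1E u2E u3E bal).
have dT : dist ip wedge ipW (0, 0) (gamma T1) = (vv * T1)%:E.
  apply/eqP; rewrite eq_le; apply/andP; split.
    by rewrite -g0 -len//; exact: dist_le_length T10 (hor T10).
  apply: dist_ge => T g v T0 h gp gq.
  rewrite gT in gq.
  have [l l0 [-> lb]] := horizontal_length_bound hW dim3 T0 h on t0 hth XP erefl erefl gp gq.
  have vT : 0 <= vv * T1 by apply: mulr_ge0 (ltW T10); exact: sqrtr_ge0.
  by rewrite lee_fin -(@ler_pXn2r _ 2) ?nnegrE// exprMn vv2 mulrC -XR.
exists T1, X, t; split => //; last first.
  by rewrite dT -EFin_expe exprMn vv2 mulrC -XR.
apply/eqP; rewrite /cut_time eq_le; apply/andP; split; last first.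
  apply: ereal_sup_ubound; exists T1 => //; split => //.
  by rewrite /length_minimizer g0 dT len.
apply: ge_ereal_sup => _ [s [s0 min] <-]; rewrite lee_fin leNgt; apply/negP => Ts.
have [g [v [h gp gq [l lE ll]]]] :=
  shorter_competitor hW dim3 hor g0 la0 hth on u1E u2E u3E r0 k0 sk kS bal Ts.
have := dist_le_length s0 h; rewrite gp gq -g0 -min len// lE lee_fin.
by rewrite leNgt ll.
Qed.

End CutLocus.

Theorem theorem1p4 (R : realType) (V W : vectType R)
    (ip : {dot V for idfun}) (wedge : {bilinear V -> V -> W})
    (ipW : {dot W for idfun})
    (dimV : \dim {:V} = 3%N)
    (hW : is_exterior_square ip wedge ipW)
    (x : V) (t : W) (hcut : cut_locus ip wedge ipW (x, t)) :
  let theta := fPinv (nrm ip x ^+ 2 / nrm ipW t) in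
  (pi <= theta < phi1 R) /\
  (dist ip wedge ipW (0%R, 0%R) (x, t) ^+ 2)%E =
    (nrm ip x ^+ 2 + fR theta * nrm ipW t)%:E.
Proof.
have [gamma [u [[g0 hor [la [a [b [z [la0 [ab az bz] nab a0 uE]]]]]] [T cutT gT]]]] := hcut.
have [f1 [f2 [f3 [on aE bE zE]]]] := adapted_frame dimV ab az bz nab a0.
move: la0; rewrite le_eqVlt => /predU1P[la0|la0].
  (* A constant control gives a straight curve, minimizing up to [|T| + 1] as well, so that T cannot
     be its cut time. *)
  have uw s : 0 <= s -> u s = a + z.
    by move=> s0; rewrite uE// -la0 mul0r cos0 sin0 scale1r scale0r addr0.
  have T0 : 0 < `|T| + 1 by rewrite ltr_pwDr.
  have : ((`|T| + 1)%:E <= T%:E)%E.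
    rewrite -cutT; apply: ereal_sup_ubound; exists (`|T| + 1) => //; split => //.
    exact: (straight_minimizer dimV hor g0 on uw T0).
  by rewrite lee_fin; have := ler_norm T; lra.
set rho := nrm ip a in a0 aE bE; set ze := nrm ip z in zE.
have z0 : 0 <= ze := nrm_ge0 ip z.
have [th hth E] := balance_angle_exists ze a0.
have [ka [si [k0 sk kS bal kE]]] := tilt_exists a0 z0 hth E.
have on' := tilted_frame th on sk.
have ipu (c1 c2 c3 : R) s : 0 <= s -> ip (c1 *: f1 + c2 *: f2 + c3 *: f3) (u s) =
    rho * (c1 * cos (la * s) + c2 * sin (la * s)) + c3 * ze.
  have [h11 h22 h33 h12 h13 h23] := on.
  have h21 := h12; rewrite ipC in h21; have h31 := h13; rewrite ipC in h31.
  have h32 := h23; rewrite ipC in h32.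
  move=> s0; rewrite uE// aE bE zE !ipDl !ipDr !ipZl !ipZr.
  by rewrite h11 h22 h33 h12 h13 h23 h21 h31 h32; ring.
have [||| T1 [X [r [cutT1 r0 XP gT1 dT1]]]] :=
    tilted_cut hW dimV hor g0 on' a0 z0 la0 hth E k0 sk kS bal kE.
- by move=> s s0; rewrite ipu// cosB mulrBr kS; ring.
- by move=> s s0; rewrite ipu// sinB; ring.
- by move=> s s0; rewrite ipu// cosB; ring.
have TT : T = T1 by apply/EFin_inj; rewrite -cutT -cutT1.
rewrite gT TT in hcut *; rewrite -TT -gT in dT1 gT1 *.
case: gT1 => xE tE.
have [h11 h22 h33 _ _ _] := on'.
have nx : nrm ip x ^+ 2 = X ^+ 2 by rewrite nrm_sqr xE ipZl ipZr h33; ring.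
have [w11 _ _ _ _ _] := wedge_orthonormal3 hW on'.
have nt : nrm ipW t = r.
  by rewrite tE nrmZ /nrm w11 sqrtr1 mulr1 gtr0_norm.
rewrite nx nt => theta.
have PE : X ^+ 2 / r = fP th by rewrite XP mulfK// lt0r_neq0.
have mem : ([set fP y | y in `[pi, phi1 R[%classic] (fP th)) by exists th => //=; rewrite in_itv.
have thetaE : fP theta = fP th.
  by rewrite /theta PE /fPinv pinvK// inE.
have htheta : pi <= theta < phi1 R.
  have : (`[pi, phi1 R[%classic : set R) theta.
    have surj : set_surj `[pi, phi1 R[%classic [set fP y | y in `[pi,
      phi1 R[%classic] (@fP R) by [].
    have := @surjpinv_image_sub _ _ (fun=> point) _ _ _ surj theta; apply.
    by exists (fP th) => //; rewrite /theta PE.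
  by rewrite /= in_itv.
split => //; suff -> : fR theta = fR th by [].
(* P takes the same value at theta and th, so R(theta) and R(th) are both the minimum of the same
   function 4 Q + P(th) rho on [pi, phi1[. *)
apply/eqP; rewrite eq_le; apply/andP; split.
  by rewrite [leRHS]fR_decomp// -thetaE fR_le.
by rewrite [leRHS]fR_decomp// thetaE fR_le.
Qed.
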